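(* Let $k\ge 2$, $i_1,\ldots,i_k\in\{0,1,\ldots,m\}$, and let $\Phi:[t,T]^k\to\mathbb R$ be a continuous nonrandom function. Then, with probability 1, $$J[\Phi]_{T,t}^{(i_1\ldots i_k)}=J'[\Phi]_{T,t}^{(i_1\ldots i_k)}+\sum_{r=1}^{[k/2]}\ \sum_{(\{\{g_1,g_2\},\ldots,\{g_{2r-1},g_{2r}\}\},\{q_1,\ldots,q_{k-2r}\})}\ \prod_{s=1}^r\mathbf 1_{\{i_{g_{2s-1}}=i_{g_{2s}}\neq 0\}}\ J'\left[\breve T^{k-2r}_{g_1,\ldots,g_{2r}}\Phi\right]_{T,t}^{(i_{q_1}\ldots i_{q_{k-2r}})},$$ where the inner sum runs over all pairings of $\{1,\ldots,k\}$ with $r$ pairs.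
   Context: Let $0\le t<T$, and let $\mathbf w_\tau=(\mathbf w^{(1)}_\tau,\ldots,\mathbf w^{(m)}_\tau)$, $\tau\in[0,T]$, be a standard $m$-dimensional Wiener process with independent components on a complete probability space with filtration; put $\mathbf w^{(0)}_\tau=\tau$. $[x]$ is the integer part of $x$, $\mathbf 1_A$ is an indicator, and l.i.m. is the limit in mean square. Pairings: for $1\le r\le[k/2]$, a pairing of $\{1,\ldots,k\}$ with $r$ pairs is $(\{\{g_1,g_2\},\ldots,\{g_{2r-1},g_{2r}\}\},\{q_1,\ldots,q_{k-2r}\})$, where $\{g_1,\ldots,g_{2r},q_1,\ldots,q_{k-2r}\}=\{1,\ldots,k\}$; the pairs, the order of the pairs, and the set of the $q$'s are unordered, and one labels $q_1<\ldots<q_{k-2r}$. Multiple Stratonovich integral: for partitions $t=\tau_0<\tau_1<\ldots<\tau_N=T$ with $\max_{0\le j\le N-1}|\tau_{j+1}-\tau_j|\to0$ as $N\to\infty$ and $\Delta\mathbf w^{(i)}_{\tau_j}=\mathbf w^{(i)}_{\tau_{j+1}}-\mathbf w^{(i)}_{\tau_j}$, $$J[\Phi]_{T,t}^{(i_1\ldots i_k)}=\mathop{\mathrm{l.i.m.}}_{N\to\infty}\sum_{j_1,\ldots,j_k=0}^{N-1}\Phi(\tau_{j_1},\ldots,\tau_{j_k})\prod_{l=1}^k\Delta\mathbf w^{(i_l)}_{\tau_{j_l}}.$$ Hilbert space valued trace: $$\breve T^{k-2r}_{g_1,\ldots,g_{2r}}\Phi(t_{q_1},\ldots,t_{q_{k-2r}})=\int_{[t,T]^r}\Phi(t_1,\ldots,t_k)\Big|_{t_{g_1}=t_{g_2},\ldots,t_{g_{2r-1}}=t_{g_{2r}}}dt_{g_1}dt_{g_3}\ldots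 dt_{g_{2r-1}}.$$ Multiple Wiener integral: $J'[\cdot]_{T,t}^{(i_1\ldots i_n)}$ is the continuous linear map from $L_2([t,T]^n)$ to square-integrable random variables defined on step functions $\sum_{j_1,\ldots,j_n=0}^{N-1}a_{j_1\ldots j_n}\prod_{l}\mathbf 1_{[\tau_{j_l},\tau_{j_l+1})}(t_l)$ (for partitions $t=\tau_0<\ldots<\tau_N=T$, with $a_{j_1\ldots j_n}=0$ whenever two of the indices coincide) by $\sum a_{j_1\ldots j_n}\prod_{l}(\mathbf w^{(i_l)}_{\tau_{j_l+1}}-\mathbf w^{(i_l)}_{\tau_{j_l}})$ and extended by mean-square continuity. For $n=0$, $J'[c]:=c$ for $c\in\mathbb R$. *)

(* Defs.v *)
From HB Require Import structures.
From mathcomp Require Import all_boot all_order all_algebra.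
From mathcomp Require Import all_classical all_reals all_analysis.

Set Implicit Arguments.
Unset Strict Implicit.
Unset Printing Implicit Defensive.

Import Order.TTheory GRing.Theory Num.Theory numFieldNormedType.Exports.

Local Open Scope classical_set_scope.
Local Open Scope ring_scope.

(* The n-fold product of a sigma-finite measure, on the library's product
   sigma-algebra of n.-tuple T, by recursion on n with binary products. *)
Section cons_measure.
Context d (T : measurableType d) (R : realType) (n : nat).

Definition cons_pair (x : T * n.-tuple T) : n.+1.-tuple T :=
  [the n.+1.-tuple T of x.1 :: x.2].

Lemma measurable_cons_pair : measurable_fun setT cons_pair.
Proof. exact: measurable_cons. Qed.

Variable mu : {sigma_finite_measure set T -> \bar R}.
Variable nu : {sigma_finite_measure set (n.-tuple T) -> \bar R}.

Definition cons_measure : set (n.+1.-tuple T) -> \bar R :=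
  pushforward (mu \x nu)%E cons_pair.

HB.instance Definition _ := Measure.copy cons_measure
  (measure_function_pushforward__canonical__measure_function_Measure
    (mu \x nu)%E measurable_cons_pair).

Let uncons (v : n.+1.-tuple T) : T * n.-tuple T :=
  (thead v, [tuple of behead v]).

Let measurable_uncons : measurable_fun setT uncons.
Proof.
apply/measurable_fun_pairP; split; first exact: measurable_tnth.
exact: measurable_behead.
Qed.

Let cons_measure_sigma_finite : sigma_finite setT cons_measure.
Proof.
have /sigma_finiteP[F [FT ndF Foo]] := sigma_finiteT mu.
have /sigma_finiteP[G [GT ndG Goo]] := sigma_finiteT nu.
exists (fun i => uncons @^-1` (F i `*` G i)) => [|i].
  apply/seteqP; split => [v _|//]; rewrite -preimage_bigcup/=.
  have [i _ Fi] : (\bigcup_i F i) (uncons v).1 by rewrite -FT.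
  have [j _ Gj] : (\bigcup_j G j) (uncons v).2 by rewrite -GT.
  exists (maxn i j) => //; split.
  - by move: Fi; exact/subsetPset/ndF/leq_maxl.
  - by move: Gj; exact/subsetPset/ndG/leq_maxr.
have [mF Fi] := Foo i; have [mG Gi] := Goo i; split.
  rewrite -[X in measurable X]setTI.
  by apply: measurable_uncons => //; exact: measurableX.
rewrite /cons_measure /pushforward -comp_preimage.
suff -> : uncons \o cons_pair = id.
  rewrite preimage_id product_measure1E// lte_mul_pinfty//.
  by rewrite ge0_fin_numE.
by apply/funext => -[x v]; congr pair; exact: val_inj.
Qed.

HB.instance Definition _ :=
  Measure_isSigmaFinite.Build _ _ _ cons_measure cons_measure_sigma_finite.

End cons_measure.

Fixpoint power_measure d (T : measurableType d) (R : realType)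
    (mu : {sigma_finite_measure set T -> \bar R}) (n : nat) :
    {sigma_finite_measure set (n.-tuple T) -> \bar R} :=
  match n with
  | 0 => \d_ [tuple]
  | p.+1 => cons_measure mu (power_measure mu p)
  end.

Definition lebesgue_tuple (R : realType) (n : nat) :
    {sigma_finite_measure set (n.-tuple (measurableTypeR R)) -> \bar R} :=
  power_measure lebesgue_measure n.

Section cube.
Context (R : realType).
Variables t T : R.

Definition row_of_tuple n (v : n.-tuple (measurableTypeR R)) : 'rV[R]_n :=
  \row_i tnth v i.

Definition cube (n : nat) : set 'rV[R]_n :=
  [set x | forall i, t <= x ord0 i <= T].

Definition cube_integral n (f : 'rV[R]_n -> \bar R) : \bar R :=
  (\int[lebesgue_tuple R n]_(v in @row_of_tuple n @^-1` @cube n)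
     f (row_of_tuple v))%E.

Definition L2_sqdist n (f g : 'rV[R]_n -> R) : \bar R :=
  cube_integral (fun x => ((f x - g x) ^+ 2)%:E).

(* Only the values tau 0, ..., tau N matter. *)
Definition is_partition (N : nat) (tau : nat -> R) : Prop :=
  [/\ tau 0%N = t, tau N = T & forall j, (j < N)%N -> tau j < tau j.+1].

End cube.

Arguments cube {R} t T n.

Definition mesh (R : realType) (N : nat) (tau : nat -> R) : R :=
  \big[Num.max/0]_(j < N) `|tau j.+1 - tau j|.

Definition step_fun (R : realType) n N (tau : nat -> R)
    (a : {ffun 'I_n -> 'I_N} -> R) (x : 'rV[R]_n) : R :=
  \sum_(j : {ffun 'I_n -> 'I_N})
    a j * \prod_(l < n) \1_(`[tau (j l), tau (j l).+1[) (x ord0 l).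

Section wiener.
Context d (Omega : measurableType d) (R : realType) (P : probability Omega R).
Local Open Scope ereal_scope.

Definition indep_systems (A B : set (set Omega)) : Prop :=
  forall E F, A E -> B F -> P (E `&` F) = P E * P F.

Definition is_filtration (T : R) (F : R -> set (set Omega)) : Prop :=
  (forall s, (0 <= s <= T)%R ->
     sigma_algebra setT (F s) /\ F s `<=` measurable) /\
  (forall s u, (0 <= s <= u)%R -> (u <= T)%R -> F s `<=` F u).

Section brownian.
Context (m : nat).
Variable W : 'I_m -> R -> {RV P >-> R}.

Definition sigma_path (T : R) (j : 'I_m) : set (set Omega) :=
  <<s \bigcup_(s in `[0%R, T]) preimage_set_system setT (W j s) measurable >>.

Definition sigma_increment (s u : R) : set (set Omega) :=
  <<s \bigcup_(j in [set: 'I_m])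
        preimage_set_system setT (fun w => W j u w - W j s w)%R measurable >>.

Record is_wiener (T : R) (F : R -> set (set Omega)) : Prop := IsWiener {
  wiener_start : forall j, {ae P, forall w, W j 0%R w = 0%R};
  wiener_continuous : forall j,
    {ae P, forall w, {within `[0%R, T], continuous (fun s => W j s w)}};
  wiener_adapted : forall j s, (0 <= s <= T)%R ->
    preimage_set_system setT (W j s) measurable `<=` F s;
  (* normal_prob is parametrised by the standard deviation *)
  wiener_gaussian : forall j s u, (0 <= s < u)%R -> (u <= T)%R ->
    forall B, measurable B ->
      P [set w | B (W j u w - W j s w)%R] =
      normal_prob 0%R (Num.sqrt (u - s)) B;
  wiener_indep_past : forall s u, (0 <= s < u)%R -> (u <= T)%R ->
    indep_systems (F s) (sigma_increment s u);
  (* A j = setT is allowed, so this is the product rule over all subfamilies *)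
  wiener_indep_components : forall A : 'I_m -> set Omega,
    (forall j, sigma_path T j (A j)) ->
    P (\bigcap_(j in [set: 'I_m]) A j) = \prod_(j < m) P (A j)
}.

(* Component 0 is time; component j.+1 is W j. *)
Definition with_time (i : 'I_m.+1) (s : R) (w : Omega) : R :=
  if unlift ord0 i is Some j then W j s w else s.

Definition increment_sum n (i : 'I_n -> 'I_m.+1) N (tau : nat -> R)
    (a : {ffun 'I_n -> 'I_N} -> R) (w : Omega) : R :=
  (\sum_(j : {ffun 'I_n -> 'I_N})
    a j * \prod_(l < n)
      (with_time (i l) (tau (j l).+1) w - with_time (i l) (tau (j l)) w))%R.

Definition ms_sqdist (X Y : Omega -> R) : \bar R :=
  'E_P[fun w => ((X w - Y w) ^+ 2)%R].

Definition stratonovich_sum k (i : 'I_k -> 'I_m.+1) (Phi : 'rV[R]_k -> R)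
    N (tau : nat -> R) : Omega -> R :=
  increment_sum i tau
    (fun j : {ffun 'I_k -> 'I_N} => Phi (\row_l tau (j l))).

Definition is_stratonovich k (i : 'I_k -> 'I_m.+1) (Phi : 'rV[R]_k -> R)
    (tau : nat -> nat -> R) (X : {RV P >-> R}) : Prop :=
  (fun N => ms_sqdist (stratonovich_sum i Phi N (tau N)) X) @ \oo --> 0.

Variables t T : R.

(* X is the value at f of the extension by mean-square continuity of the map
   step_fun tau a |-> increment_sum i tau a on step functions off the
   diagonals. *)
Definition is_wiener_integral n (i : 'I_n -> 'I_m.+1) (f : 'rV[R]_n -> R)
    (X : {RV P >-> R}) : Prop :=
  'E_P[fun w => (X w ^+ 2)%R] < +oo /\
  forall e : R, (0 < e)%R -> exists2 delta : R, (0 < delta)%R &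
    forall N tau (a : {ffun 'I_n -> 'I_N} -> R),
      is_partition t T N tau ->
      (forall j : {ffun 'I_n -> 'I_N}, ~~ injectiveb j -> a j = 0%R) ->
      L2_sqdist t T (step_fun tau a) f < delta%:E ->
      ms_sqdist (increment_sum i tau a) X < e%:E.

(* Such an X exists and is a.s. unique for f in L2([t, T]^n), so the default
   of xget is irrelevant there. *)
Definition wiener_integral n (i : 'I_n -> 'I_m.+1) (f : 'rV[R]_n -> R) :
    {RV P >-> R} :=
  if n == 0%N then (cst (f 0%R) : {mfun Omega >-> R})
  else xget (cst 0%R : {mfun Omega >-> R}) (is_wiener_integral i f).

End brownian.
End wiener.

(* A pairing with r pairs is the set of its pairs; the q's are the elements
   of ~: finset.cover S, which enum_val lists in increasing order. *)
Definition is_pairing k (r : nat) (S : {set {set 'I_k}}) : bool :=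
  [&& finset.trivIset S, [forall B in S, #|B| == 2] & #|S| == r].

Definition unpaired k (S : {set {set 'I_k}}) : {set 'I_k} := ~: finset.cover S.

(* The point of R^k whose coordinates outside the pairs are those of u and
   whose coordinates in a pair both equal the coordinate of v for that pair. *)
Definition pairing_point (R : realType) k (S : {set {set 'I_k}})
    (u : 'rV[R]_#|unpaired S|) (v : 'rV[R]_#|S|) : 'rV[R]_k :=
  \row_a
    if [pick l : 'I_#|unpaired S| | enum_val l == a] is Some l then u ord0 l
    else if [pick s : 'I_#|S| | a \in (enum_val s : {set 'I_k})] is Some s
    then v ord0 s else 0.

Definition pairing_trace (R : realType) (t T : R) k (S : {set {set 'I_k}})
    (Phi : 'rV[R]_k -> R) (u : 'rV[R]_#|unpaired S|) : R :=
  fine (cube_integral t T (fun v => (Phi (pairing_point u v))%:E)).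

Definition pairing_indicator (R : realType) m k (i : 'I_k -> 'I_m.+1)
    (S : {set {set 'I_k}}) : R :=
  \prod_(B in S)
    ([forall g in B, forall h in B, (i g == i h) && (i g != ord0)])%:R.

(* Main.v *)
(* Call the weight of a multi-index j the product of the lengths of the distinct
   cells that it visits; the weights of all multi-indices have a bounded sum.  By
   independence, the covariance of two products of increments is at most a
   constant times the weight of the concatenated multi-indices, so by Schur's
   test the second moment of a sum  sum_j c_j prod_l Delta w_(j_l)  is at most
   a constant times  sum_j c_j^2 weight(j).

   In the Stratonovich sum one replaces the increments inside each cell by their
   leading part: a single increment is kept, a product of two increments becomes
   its quadratic covariation (the length of the cell if both come from the same
   Wiener component, 0 otherwise), and a product of three or more becomes 0.  The
   same covariance estimate shows that the error tends to 0 with the mesh.  The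
   remaining multi-indices visit every cell at most twice, so the coincidences
   between their entries form a pairing S; summing over the cells of the pairs
   gives an off-diagonal sum whose coefficients converge uniformly to the trace
   for S.  Since off-diagonal sums with uniformly close coefficients are close in
   mean square, each of these sums converges to the multiple Wiener integral of
   the trace. *)
Require Import Defs.
From mathcomp Require Import all_boot all_order all_algebra.
From mathcomp Require Import all_classical all_reals all_analysis.
From mathcomp Require Import measurable_realfun ring lra.

Set Implicit Arguments.
Unset Strict Implicit.
Unset Printing Implicit Defensive.

Import Order.TTheory GRing.Theory Num.Theory numFieldNormedType.Exports.

Local Open Scope classical_set_scope.
Local Open Scope ring_scope.

(** * Sums over multi-indices weighted by cell lengths *)

(** Every nonempty product of increments over one cell has a moment at most a constant times the
    length of the cell: for a single increment because its mean is exactly 0 or the length, for more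
    because each increment is of order at most the square root of the length. This is why weights
    count distinct cells and not indices. Exact Gaussian values enter only for one and two
    increments; other moments are merely bounded by size, so neither an Ito formula nor a Wick
    formula is involved. A third increment in a cell brings one more square root, the small factor
    of the error estimate.

    The multiple Wiener integral is chosen by [xget] among the variables that answer to every
    off-diagonal step function on every partition. Its existence has to be proved, and step
    functions on unrelated partitions have to be compared; a common refinement and a one-sided
    substitute for the Ito isometry do this. Continuity acts through a coordinatewise modulus on the
    cube, which survives the passage to a trace, so that traces are handled like the integrand
    itself. *)

Section finite_functions.
Context {T : finType}.

Definition fcons n (x : T) (J : {ffun 'I_n -> T}) : {ffun 'I_n.+1 -> T} :=
  [ffun l => oapp J x (unlift ord0 l)].

Lemma fcons0 n x (J : {ffun 'I_n -> T}) : fcons x J ord0 = x.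
Proof. by rewrite ffunE unlift_none. Qed.

Lemma fconsS n x (J : {ffun 'I_n -> T}) l : fcons x J (lift ord0 l) = J l.
Proof. by rewrite ffunE liftK. Qed.

Lemma sum_fcons (V : nmodType) n (F : {ffun 'I_n.+1 -> T} -> V) :
  \sum_J F J = \sum_x \sum_(J : {ffun 'I_n -> T}) F (fcons x J).
Proof.
rewrite pair_big /= (reindex (fun u => fcons u.1 u.2)) //=.
exists (fun J : {ffun 'I_n.+1 -> T} => (J ord0, [ffun l => J (lift ord0 l)])).
  move=> [x J] _ /=; rewrite fcons0; congr pair.
  by apply/ffunP => l; rewrite !ffunE liftK.
move=> J _; apply/ffunP => l; rewrite ffunE /=.
by case: unliftP => [l'|] -> //=; rewrite ffunE.
Qed.

Definition im n (J : {ffun 'I_n -> T}) : {set T} := J @: [set: 'I_n]%SET.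

Lemma mem_im n (J : {ffun 'I_n -> T}) l : J l \in im J.
Proof. by apply/imsetP; exists l; rewrite ?inE. Qed.

Lemma im_fcons n x (J : {ffun 'I_n -> T}) : im (fcons x J) = x |: im J.
Proof.
apply/setP => y; rewrite !inE; apply/imsetP/orP.
  move=> [l _ ->]; rewrite ffunE; case: unliftP => [l' _|_] /=.
    by right; exact: mem_im.
  by left.
case=> [/eqP ->|/imsetP[l _ ->]]; first by exists ord0; rewrite ?inE ?fcons0.
by exists (lift ord0 l); rewrite ?inE ?fconsS.
Qed.

Lemma card_im n (J : {ffun 'I_n -> T}) : (#|im J| <= n)%N.
Proof. by rewrite (leq_trans (leq_imset_card _ _))// finset.cardsT card_ord. Qed.

End finite_functions.

Section weights.
Context {R : realFieldType} {T : finType} (d : T -> R) (D : R).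
Hypothesis d_ge0 : forall p, 0 <= d p.
Hypothesis sum_d : \sum_p d p <= D.

(** The cells of [A] count as already used. Prepending an index moves its cell into [A]; this
    freedom lets the inductions on the number of indices close. *)
Definition wt (A : {set T}) n (J : {ffun 'I_n -> T}) : R :=
  \prod_(p in im J :\: A) d p.

Lemma wt_ge0 A n (J : {ffun 'I_n -> T}) : 0 <= wt A J.
Proof. by apply: prodr_ge0. Qed.

Lemma wt_fcons A n x (J : {ffun 'I_n -> T}) :
  wt A (fcons x J) = if x \in A then wt A J else d x * wt (x |: A) J.
Proof.
rewrite /wt im_fcons finset.setDUl; case: ifPn => xA.
  have -> : ([set x] :\: A)%SET = finset.set0.
    by apply/eqP; rewrite finset.setD_eq0 finset.sub1set.
  by rewrite finset.set0U.
rewrite (bigD1 x) /=; last by rewrite !inE eqxx xA.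
congr (_ * _); apply: eq_bigl => y; rewrite !inE.
by case: (y == x) => //=; rewrite ?andbF ?andbT.
Qed.

Lemma sum_d_ge0 : 0 <= D.
Proof. by apply: le_trans sum_d; apply: sumr_ge0. Qed.

(* Each further index either falls in the cells already used or ranges freely
   over cells of total length at most [D]. *)
Lemma sum_wt A n :
  \sum_(J : {ffun 'I_n -> T}) wt A J <= (#|A|%:R + n%:R + D) ^+ n.
Proof.
have D0 := sum_d_ge0.
elim: n A => [|n IH] A.
  rewrite expr0.
  have F0 (J J' : {ffun 'I_0 -> T}) : J = J' by apply/ffunP => -[].
  have [J0|J0] := pickP (fun J : {ffun 'I_0 -> T} => true); last first.
    by rewrite big_pred0.
  move=> _; rewrite (bigD1 J0) //= big1 ?addr0; last first.
    by move=> J /eqP; case; exact: F0.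
  rewrite /wt big1 //.
  by move=> p; rewrite inE => /andP[_ /imsetP[[]]].
rewrite sum_fcons.
set c : R := #|A|%:R + n.+1%:R + D.
have c0 : 0 <= c by rewrite !addr_ge0.
rewrite (bigID (mem A)) /=.
apply: (@le_trans _ _ (\sum_(x in A) c ^+ n + \sum_(x | x \notin A) d x * c ^+ n)).
  apply: lerD; apply: ler_sum => x xA.
    under eq_bigr do rewrite wt_fcons xA.
    apply: le_trans (IH _) _; rewrite lerXn2r ?nnegrE ?addr_ge0//.
    by rewrite /c lerD2r lerD2l ler_nat.
  under eq_bigr do rewrite wt_fcons (negbTE xA).
  rewrite -big_distrr /= ler_wpM2l//.
  apply: le_trans (IH _) _; rewrite lerXn2r ?nnegrE ?addr_ge0//.
  by rewrite /c cardsU1 xA -!natrD addnAC addnC addnA addn1 addSn.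
rewrite sumr_const -big_distrl /= -mulr_natl -mulrDl exprS ler_wpM2r ?exprn_ge0//.
rewrite /c -addrA lerD2l.
have h : \sum_(x | x \notin A) d x <= D.
  apply: le_trans sum_d; rewrite [leRHS](bigID (fun x => x \in A)) /=.
  by rewrite lerDr sumr_ge0.
by rewrite (le_trans h)// lerDr.
Qed.

Definition wt2 n (J J' : {ffun 'I_n -> T}) : R := \prod_(p in im J :|: im J') d p.

Lemma wt2C n (J J' : {ffun 'I_n -> T}) : wt2 J J' = wt2 J' J.
Proof. by rewrite /wt2 finset.setUC. Qed.

Lemma wt2E n (J J' : {ffun 'I_n -> T}) :
  wt2 J J' = wt finset.set0 J * wt (im J) J'.
Proof.
rewrite /wt2 /wt finset.setD0 (bigID (mem (im J))) /=; congr (_ * _).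
  by apply: eq_bigl => p; rewrite !inE; case: (p \in im J) => //=; rewrite andbF.
by apply: eq_bigl => p; rewrite !inE; case: (p \in im J) => //=; rewrite ?andbT.
Qed.

(** The inequality 2ab <= a^2 + b^2 and the symmetry of [wt2] reduce the double sum to row sums. By
    [wt2E] a row sum is the weight of [J] times a sum of weights relative to [im J], which [sum_wt]
    bounds uniformly because [im J] has at most [n] cells; hence the second [n] in the constant. *)
Lemma schur_test n (K : {ffun 'I_n -> T} -> {ffun 'I_n -> T} -> R) kappa c :
  0 <= kappa ->
  (forall J J', `|K J J'| <= kappa * wt2 J J') ->
  \sum_J \sum_J' c J * c J' * K J J' <=
    kappa * (n%:R + n%:R + D) ^+ n * \sum_J c J ^+ 2 * wt finset.set0 J.
Proof.
move=> k0 HK.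
have D0 := sum_d_ge0.
have W0 (J J' : {ffun 'I_n -> T}) : 0 <= wt2 J J' by apply: prodr_ge0.
have kW0 (J J' : {ffun 'I_n -> T}) : 0 <= kappa * wt2 J J'.
  by apply: le_trans (HK J J').
apply: (@le_trans _ _ (\sum_J \sum_J'
    (c J ^+ 2 * (kappa * wt2 J J') / 2 + c J' ^+ 2 * (kappa * wt2 J J') / 2))).
  apply: ler_sum => J _; apply: ler_sum => J' _.
  rewrite -mulrDl -mulrDl.
  apply: (@le_trans _ _ (`|c J * c J'| * (kappa * wt2 J J'))).
    by rewrite (le_trans (ler_norm _))// normrM ler_wpM2l.
  rewrite mulrAC ler_wpM2r// normrM -[c J ^+ 2]real_normK ?num_real//.
  rewrite -[c J' ^+ 2]real_normK ?num_real// ler_pdivlMr//.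
  have := sqr_ge0 (`|c J| - `|c J'|); rewrite sqrrB mulr2n; lra.
have -> : \sum_J \sum_J'
    (c J ^+ 2 * (kappa * wt2 J J') / 2 + c J' ^+ 2 * (kappa * wt2 J J') / 2) =
    \sum_J \sum_J' c J ^+ 2 * (kappa * wt2 J J').
  have h : \sum_J \sum_J' c J' ^+ 2 * (kappa * wt2 J J') / 2 =
           \sum_J \sum_J' c J ^+ 2 * (kappa * wt2 J J') / 2.
    rewrite exchange_big /=; apply: eq_bigr => J _; apply: eq_bigr => J' _.
    by rewrite wt2C.
  under eq_bigr do rewrite big_split /=.
  rewrite big_split /= h -big_split /=; apply: eq_bigr => J _.
  rewrite -big_split /=; apply: eq_bigr => J' _; lra.
rewrite mulr_sumr; apply: ler_sum => J _.
rewrite -mulr_sumr.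
have [->|cJ0] := eqVneq (c J) 0.
  by rewrite expr0n !mul0r mulr0.
rewrite mulrCA ler_wpM2l ?sqr_ge0//.
rewrite -mulr_sumr -mulrA ler_wpM2l// [leRHS]mulrC.
under eq_bigr do rewrite wt2E.
rewrite -mulr_sumr ler_wpM2l ?wt_ge0//.
apply: le_trans (sum_wt _ _) _; rewrite lerXn2r ?nnegrE ?addr_ge0//.
by rewrite !lerD2r ler_nat card_im.
Qed.

(* [h] bounds the cells.  A tuple that repeats a cell, or meets [A], has one
   factor more than its weight. *)
Lemma prod_le_wt (h : R) (A : {set T}) n (v : {ffun 'I_n -> T}) :
  1 <= D -> (forall p, d p <= h) -> h <= D ->
  \prod_s d (v s) <= D ^+ n * wt A v /\
  (~~ injectiveb v \/ im v :&: A != finset.set0 ->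
   \prod_s d (v s) <= h * D ^+ n * wt A v).
Proof.
move=> D1 dh hD; have D0 : 0 <= D by apply: le_trans D1.
elim: n A v => [|n IH] A v.
  split.
    rewrite big_ord0 expr0 mul1r /wt big1//.
    by move=> p; rewrite inE => /andP[_ /imsetP[[]]].
  case=> [/injectiveP[]|/set0Pn[x]]; first by move=> [].
  by rewrite inE => /andP[/imsetP[[]]].
have -> : v = fcons (v ord0) [ffun l => v (lift ord0 l)].
  by apply/ffunP => l; rewrite ffunE; case: unliftP => [l'|] -> //=; rewrite ffunE.
set x := v ord0; set v' := [ffun l => v (lift ord0 l)].
rewrite big_ord_recl fcons0 wt_fcons.
under eq_bigr do rewrite fconsS.
have P0 : 0 <= \prod_(i < n) d (v' i) by apply: prodr_ge0.
have [IA1 IA2] := IH A v'; have [IB1 IB2] := IH (x |: A) v'.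
split.
  case: ifPn => xA; rewrite exprS -mulrA.
    by apply: ler_pM => //; exact: le_trans (dh x) hD.
  apply: (@le_trans _ _ (d x * (D ^+ n * wt (x |: A) v'))); first exact: ler_wpM2l.
  rewrite mulrCA (mulrCA (D ^+ n)) -[leLHS]mul1r [leRHS]mulrA.
  rewrite -mulrA; apply: ler_wpM2r => //.
  by rewrite !mulr_ge0 ?exprn_ge0 ?wt_ge0.
(* If the first cell lies in [A], its own length is the surplus factor bounded by [h]; otherwise the
   induction hypothesis for [x |: A] has to supply it. *)
case: ifPn => xA bad.
  apply: (@le_trans _ _ (h * (D ^+ n * wt A v'))).
    by apply: ler_pM.
  have h0 : 0 <= h by apply: le_trans (dh x).
  rewrite exprS -!mulrA ler_wpM2l// ler_peMl// mulr_ge0 ?exprn_ge0 ?wt_ge0//.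
(* A repetition of [x] in [v] becomes a meeting of [v'] with [x |: A]. *)
have bad' : ~~ injectiveb v' \/ im v' :&: (x |: A) != finset.set0.
  case: (boolP (injectiveb v')) => inj; last by left.
  right; case: bad => [ninj|/set0Pn[y]].
    apply/negP => /eqP e0; move/injectiveP: inj => inj.
    case/negP: ninj; apply/injectiveP => a b.
    rewrite !ffunE; case: unliftP => [a'|] -> ; case: unliftP => [b'|] -> //=.
    - by rewrite -!/(v' _) => /inj ->.
    - rewrite -/(v' _) => e; have : v' a' \in im v' :&: (x |: A).
        by rewrite !inE mem_im e eqxx.
      by rewrite e0 inE.
    - rewrite -/(v' _) => e; have : v' b' \in im v' :&: (x |: A).
        by rewrite !inE mem_im -e eqxx.
      by rewrite e0 inE.
  rewrite im_fcons !inE => /andP[/orP[/eqP ->|yv] yA]; first by rewrite yA in xA.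
  by apply/set0Pn; exists y; rewrite !inE yv yA orbT.
apply: (@le_trans _ _ (d x * (h * D ^+ n * wt (x |: A) v'))).
  by rewrite ler_wpM2l// IB2.
have h0 : 0 <= h by apply: le_trans (dh x).
rewrite mulrCA -(mulrA h) -(mulrA h) ler_wpM2l// exprS.
rewrite mulrCA -(mulrA D) [D ^+ n * (d x * _)]mulrCA; apply: ler_peMl => //.
by rewrite !mulr_ge0 ?exprn_ge0 ?wt_ge0.
Qed.

End weights.

(** Telescoping: the factors are exchanged one at a time, and each exchange costs [e] times the
    dominating product. *)
Lemma prod_diff_bound (R : realFieldType) (T : finType) (A : {set T})
    (a b u : T -> R) (e : R) :
  (forall p, p \in A -> `|a p| <= u p) -> (forall p, p \in A -> `|b p| <= u p) ->
  (forall p, p \in A -> `|a p - b p| <= e * u p) ->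
  `|\prod_(p in A) a p - \prod_(p in A) b p| <= #|A|%:R * e * \prod_(p in A) u p.
Proof.
move=> ha hb hab.
rewrite -big_enum -[X in _ - X]big_enum -[X in _ <= _ * X]big_enum /= cardE.
have: forall p, p \in enum A -> p \in A by move=> p; rewrite mem_enum.
elim: (enum A) => [|x s IH] sA; first by rewrite !big_nil subrr normr0 !mul0r.
have xA : x \in A by apply: sA; rewrite inE eqxx.
have {}sA p : p \in s -> p \in A by move=> ps; apply: sA; rewrite inE ps orbT.
rewrite !big_cons.
set Pa := \prod_(_ <- _) a _; set Pb := \prod_(_ <- _) b _.
set Pu := \prod_(_ <- _) u _.
have Pu_b : `|Pb| <= Pu.
  rewrite normr_prod /Pu big_seq [leRHS]big_seq; apply: ler_prod => p ps.
  by rewrite normr_ge0 hb ?sA.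
have ux : 0 <= u x by apply: le_trans (ha x xA).
have -> : a x * Pa - b x * Pb = a x * (Pa - Pb) + (a x - b x) * Pb by ring.
apply: le_trans (ler_normD _ _) _; rewrite !normrM /=.
apply: (@le_trans _ _ (u x * ((size s)%:R * e * Pu) + e * u x * Pu)).
  by apply: lerD; apply: ler_pM; rewrite ?ha ?hab ?IH.
by rewrite -(addn1 (size s)) natrD le_eqVlt; apply/orP; left; apply/eqP; ring.
Qed.

(** * Gaussian moments *)

(** The Radon-Nikodym derivative and the density have the same integral over every measurable set,
    hence agree almost everywhere. *)
Lemma ge0_integral_normal_prob (R : realType) (s : R) (g : R -> R) :
  measurable_fun setT g -> (forall x, 0 <= g x) ->
  (\int[normal_prob 0 s]_x (g x)%:E = \int[lebesgue_measure]_x (g x * normal_pdf 0 s x)%:E)%E.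
Proof.
move=> mg g0; have dom := normal_prob_dominates 0 s.
have mE : measurable_fun setT (EFin \o g) by exact/measurable_EFinP.
rewrite -(Radon_Nikodym_SigmaFinite.change_of_variables dom)//.
under [RHS]eq_integral do rewrite EFinM.
have fi := Radon_Nikodym_SigmaFinite.f_integrable dom.
have mpdf := measurable_normal_pdf 0 s.
apply: ae_eq_integral => //.
- by apply: emeasurable_funM => //; exact: measurable_int fi.
- by apply: emeasurable_funM => //; exact/measurable_EFinP.
apply: ae_eqe_mul2l; apply: integral_ae_eq => //; first exact/measurable_EFinP.
by move=> A _ mA; rewrite -Radon_Nikodym_SigmaFinite.f_integral.
Qed.

Section normal_moments.
Context {R : realType}.
Implicit Types s c u : R.

(** Tilting a centred Gaussian density by the exponential of a multiple of the square gives another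
    one, of standard deviation [c * s], so the exponential moment is read off from total mass 1. The
    parametrisation is chosen to make that moment equal to [c]. *)
Let pdf_sq s c x : 0 < s -> 0 < c ->
  expR ((1 - c ^- 2) / (2 * s ^+ 2) * x ^+ 2) * normal_pdf 0 s x =
  c * normal_pdf 0 (c * s) x.
Proof.
move=> s0 c0; rewrite !normal_pdfE ?gt_eqF ?mulr_gt0//.
rewrite /normal_peak /normal_fun mulrCA -expRD [RHS]mulrA; congr (_ * expR _).
  have sE : Num.sqrt ((c * s) ^+ 2 * pi *+ 2) = c * Num.sqrt (s ^+ 2 * pi *+ 2).
    by rewrite exprMn -mulrA -mulrnAr sqrtrM ?sqr_ge0// sqrtr_sqr gtr0_norm.
  rewrite [X in _ = c / X]sE.
  by rewrite invfM mulrA divff ?mul1r// gt_eqF.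
have sN0 : s != 0 by rewrite gt_eqF.
have cN0 : c != 0 by rewrite gt_eqF.
rewrite !subr0 -(mulr_natr (s ^+ 2)) -(mulr_natr ((c * s) ^+ 2)) exprMn.
clear -sN0 cN0; move: sN0 cN0; generalize s c x => a b y a0 b0.
by field; rewrite a0 b0.
Qed.

Let pdf_lin s u x : 0 < s ->
  expR (u * x) * normal_pdf 0 s x =
  expR (u ^+ 2 * s ^+ 2 / 2) * normal_pdf (u * s ^+ 2) s x.
Proof.
move=> s0; rewrite !normal_pdfE ?gt_eqF//.
rewrite /normal_fun !(mulrCA (expR _)) -!expRD; congr (_ * expR _).
have sN0 : s != 0 by rewrite gt_eqF.
rewrite !subr0 -!(mulr_natr (s ^+ 2)).
clear -sN0; move: sN0; generalize s u x => a b y a0.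
by field; rewrite a0.
Qed.

Lemma normal_exp_sq s c : 0 < s -> 0 < c ->
  (\int[normal_prob 0 s]_x (expR ((1 - c ^- 2) / (2 * s ^+ 2) * x ^+ 2))%:E = c%:E)%E.
Proof.
move=> s0 c0.
rewrite ge0_integral_normal_prob//.
- under eq_integral do rewrite pdf_sq// EFinM.
  rewrite ge0_integralZl; last 4 first.
  + by [].
  + by apply/measurable_EFinP; exact: measurable_normal_pdf.
  + by move=> x _; rewrite lee_fin normal_pdf_ge0.
  + by rewrite lee_fin ltW.
  by rewrite integral_normal_pdf mule1.
- by apply: measurableT_comp => //; exact: measurable_funM.
Qed.

Lemma normal_exp_lin s u : 0 < s ->
  (\int[normal_prob 0 s]_x (expR (u * x))%:E = (expR (u ^+ 2 * s ^+ 2 / 2))%:E)%E.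
Proof.
move=> s0.
rewrite ge0_integral_normal_prob//.
- under eq_integral do rewrite pdf_lin// EFinM.
  rewrite ge0_integralZl; last 4 first.
  + by [].
  + by apply/measurable_EFinP; exact: measurable_normal_pdf.
  + by move=> x _; rewrite lee_fin normal_pdf_ge0.
  + by rewrite lee_fin expR_ge0.
  by rewrite integral_normal_pdf mule1.
- by apply: measurableT_comp => //; exact: measurable_funM.
Qed.

End normal_moments.

Section gaussian_variables.
Context d (Omega : measurableType d) (R : realType) (P : probability Omega R).
Variables (X : Omega -> R) (s : R).
Hypothesis mX : measurable_fun setT X.
Hypothesis s0 : 0 < s.
Hypothesis XN : forall B, measurable B -> P [set w | B (X w)] = normal_prob 0 s B.

Lemma ge0_integral_normal (g : R -> R) :
  measurable_fun setT g -> (forall x, 0 <= g x) ->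
  (\int[P]_w (g (X w))%:E = \int[normal_prob 0 s]_x (g x)%:E)%E.
Proof.
move=> mg g0.
have mX' : measurable_fun setT (X : Omega -> measurableTypeR R) by exact: mX.
pose X' : {mfun Omega >-> measurableTypeR R} := MeasurableFun.Pack
  (MeasurableFun.Class (isMeasurableFun.Build _ _ _ _ _ mX')).
transitivity (\int[distribution P X']_x (g x)%:E)%E.
  rewrite (@ge0_integral_distribution _ _ _ _ _ _ X' (EFin \o g))//.
  exact/measurable_EFinP.
by apply: (@eq_measure_integral _ (measurableTypeR R)) => A mA _; exact: (XN mA).
Qed.

(** From y^n / n! <= exp y with y = [a * X w ^+ 2]. Taking c = 2 in [normal_exp_sq] gives a = 3 / (8
    s^2), the origin of [8 / 3], and the exponential moment 2, the leading factor. *)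
Lemma normal_moment_le n :
  (\int[P]_w (X w ^+ 2 ^+ n)%:E <= (2 * n`!%:R * (8 / 3 * s ^+ 2) ^+ n)%:E)%E.
Proof.
set a : R := (1 - 2 ^- 2) / (2 * s ^+ 2).
have aE : 8 / 3 * s ^+ 2 = a^-1.
  by rewrite /a; field; rewrite !gt_eqF.
have a0 : 0 < a by rewrite -invr_gt0 -aE !mulr_gt0// exprn_gt0.
have mexp : measurable_fun setT (fun x : R => expR (a * x ^+ 2)).
  apply: measurableT_comp => //; apply: measurable_funM => //.
apply: (@le_trans _ _ (\int[P]_w
    (n`!%:R * (8 / 3 * s ^+ 2) ^+ n * expR (a * X w ^+ 2))%:E)%E).
  apply: ge0_le_integral => //.
  - by move=> w _; rewrite lee_fin exprn_ge0// sqr_ge0.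
  - apply/measurable_EFinP; do 2 apply: measurable_funX; exact: mX.
  - apply/measurable_EFinP; apply: measurable_funM => //.
    exact: (measurableT_comp mexp mX).
  - move=> w _; rewrite lee_fin aE exprVn -mulrA mulrCA.
    rewrite ler_pdivlMl ?exprn_gt0// -exprMn.
    set y := a * _; have y0 : 0 <= y by rewrite mulr_ge0 ?sqr_ge0// ltW.
    case: n => [|n]; first by rewrite expr0 fact0 mul1r -expR0 ler_expR.
    rewrite mulrC -ler_pdivrMr ?ltr0n ?fact_gt0//.
    by have := expR_ge1Dxn n y0; apply: le_trans; rewrite lerDr.
under eq_integral do rewrite EFinM.
rewrite ge0_integralZl; last 4 first.
- by [].
- by apply/measurable_EFinP; exact: (measurableT_comp mexp mX).
- by move=> w _; rewrite lee_fin expR_ge0.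
- by rewrite lee_fin mulr_ge0// exprn_ge0// aE invr_ge0 ltW.
rewrite (ge0_integral_normal mexp); last by move=> x; exact: expR_ge0.
by rewrite normal_exp_sq// -EFinM lee_fin; lra.
Qed.

Lemma integrable_normal_sq : P.-integrable setT (EFin \o (fun w => X w ^+ 2)).
Proof.
apply/integrableP; split.
  by apply/measurable_EFinP; exact: measurable_funX.
apply: (@le_lt_trans _ _ (\int[P]_w (X w ^+ 2 ^+ 1)%:E)%E); last first.
  by apply: le_lt_trans (normal_moment_le 1) _; rewrite ltry.
by under eq_integral do rewrite /= ger0_norm ?sqr_ge0// -[_ ^+ 2]expr1.
Qed.

Lemma integrable_normal : P.-integrable setT (EFin \o X).
Proof.
apply: (@le_integrable _ _ _ P setT measurableT _
   (EFin \o (fun w => 1 + X w ^+ 2))).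
- exact/measurable_EFinP.
- move=> w _ /=; rewrite lee_fin [leRHS]ger0_norm; last by rewrite addr_ge0// sqr_ge0.
  rewrite -[X w ^+ 2]real_normK ?num_real//.
  by have := sqr_ge0 (`|X w| - 1); rewrite sqrrB mulr2n; nra.
- rewrite (_ : EFin \o _ = (EFin \o cst 1%R \+ EFin \o (fun w => X w ^+ 2)%R)%E); last first.
    by apply/funext => w /=; rewrite EFinD.
  apply: integrableD => //; last exact: integrable_normal_sq.
  exact: finite_measure_integrable_cst.
Qed.

(** Integrating 1 + y <= exp y against the known exponential moment gives an inequality for every c
    > 0 that is an equality at c = 1. Its first-order terms for c slightly above and slightly below
    1 bound [V] from both sides, with no differentiation under the integral. *)
Lemma normal_variance : (\int[P]_w (X w ^+ 2))%R = s ^+ 2.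
Proof.
set V := Rintegral _ _ _.
have iV := integrable_normal_sq.
have key c : 0 < c -> (1 - c ^- 2) / (2 * s ^+ 2) * V <= c - 1.
  move=> c0; set a := _ / _.
  have mexp : measurable_fun setT (fun x : R => expR (a * x ^+ 2)).
    apply: measurableT_comp => //; apply: measurable_funM => //.
  have E := ge0_integral_normal mexp (fun x => expR_ge0 _).
  rewrite normal_exp_sq// in E.
  have iE : P.-integrable setT (EFin \o (fun w => expR (a * X w ^+ 2))).
    apply/integrableP; split.
      by apply/measurable_EFinP; exact: (measurableT_comp mexp mX).
    by under eq_integral do rewrite /= ger0_norm ?expR_ge0//; rewrite E ltry.
  have i1 : P.-integrable setT (EFin \o cst (1 : R)).
    exact: finite_measure_integrable_cst.
  have iaV : P.-integrable setT (EFin \o (fun w => a * X w ^+ 2)).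
    by apply: (@integrableZl _ _ _ _ _ _ _ (EFin \o _)) => //.
  have : \int[P]_w (cst 1 w + a * X w ^+ 2) <= \int[P]_w expR (a * X w ^+ 2).
    apply: le_Rintegral => //.
      rewrite (_ : EFin \o _ = (EFin \o cst 1%R \+ EFin \o (fun w => a * X w ^+ 2)%R)%E)//.
      exact: integrableD.
    by move=> w _; exact: expR_ge1Dx.
  rewrite RintegralD//= RintegralZl// Rintegral_cst// (congr1 fine (probability_setT P)) mulr1.
  by rewrite [X in _ <= X -> _]/Rintegral E /= -/V; lra.
have s2 : 0 < s ^+ 2 by rewrite exprn_gt0.
have key' c : 0 < c -> V * (c - 1) * (c + 1) <= 2 * c ^+ 2 * s ^+ 2 * (c - 1).
  move=> c0; have k0 : 0 <= c ^+ 2 * (2 * s ^+ 2).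
    by rewrite ltW// !mulr_gt0// exprn_gt0.
  have := ler_wpM2r k0 (key c c0).
  have -> : (1 - c ^- 2) / (2 * s ^+ 2) * V * (c ^+ 2 * (2 * s ^+ 2)) =
     V * (c - 1) * (c + 1).
    have : c != 0 by rewrite gt_eqF.
    have : s != 0 by rewrite gt_eqF.
    clear; move: V => v h1 h2; field; by rewrite h1 h2.
  by move=> h; apply: le_trans h _; rewrite le_eqVlt; apply/orP; left; apply/eqP; ring.
apply/eqP; rewrite eq_le; apply/andP; split; rewrite leNgt; apply/negP => lt.
(* Small enough that the higher-order terms in [e] cannot close the supposed gap between [V] and
   [s ^+ 2]. *)
- set e := (V - s ^+ 2) / (4 * V).
  have V0 : 0 < V by apply: lt_trans lt.
  have e0 : 0 < e by rewrite divr_gt0 ?subr_gt0 ?mulr_gt0.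
  have eE : e * (4 * V) = V - s ^+ 2 by rewrite divfK// gt_eqF// mulr_gt0.
  have := key' (1 + e) ltac:(lra).
  have -> : V * (1 + e - 1) * (1 + e + 1) = e * (V * (2 + e)) by ring.
  have -> : 2 * (1 + e) ^+ 2 * s ^+ 2 * (1 + e - 1) =
            e * (2 * (1 + e) ^+ 2 * s ^+ 2) by ring.
  rewrite ler_pM2l//; nra.
- set e := (s ^+ 2 - V) / (4 * s ^+ 2).
  have V0 : 0 <= V by apply: Rintegral_ge0 => w _; exact: sqr_ge0.
  have e0 : 0 < e by rewrite divr_gt0 ?subr_gt0 ?mulr_gt0.
  have eE : e * (4 * s ^+ 2) = s ^+ 2 - V by rewrite divfK// gt_eqF// mulr_gt0.
  have e1 : e < 1 by nra.
  have := key' (1 - e) ltac:(lra).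
  have -> : V * (1 - e - 1) * (1 - e + 1) = - (e * (V * (2 - e))) by ring.
  have -> : 2 * (1 - e) ^+ 2 * s ^+ 2 * (1 - e - 1) =
            - (e * (2 * (1 - e) ^+ 2 * s ^+ 2)) by ring.
  rewrite lerN2 ler_pM2l//; nra.
Qed.

(** The same convexity argument with a linear tilt: [u * M] is bounded by a quantity of second order
    in [u], for [u] of either sign. *)
Lemma normal_mean : (\int[P]_w X w)%R = 0.
Proof.
set M := Rintegral _ _ _.
have iX := integrable_normal.
have key u : u * M <= expR (u ^+ 2 * s ^+ 2 / 2) - 1.
  have mexp : measurable_fun setT (fun x : R => expR (u * x)).
    by apply: measurableT_comp => //; exact: measurable_funM.
  have E := ge0_integral_normal mexp (fun x => expR_ge0 _).
  rewrite normal_exp_lin// in E.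
  have iE : P.-integrable setT (EFin \o (fun w => expR (u * X w))).
    apply/integrableP; split.
      by apply/measurable_EFinP; exact: (measurableT_comp mexp mX).
    by under eq_integral do rewrite /= ger0_norm ?expR_ge0//; rewrite E ltry.
  have i1 : P.-integrable setT (EFin \o cst (1 : R)).
    exact: finite_measure_integrable_cst.
  have iaV : P.-integrable setT (EFin \o (fun w => u * X w)).
    by apply: (@integrableZl _ _ _ _ _ _ _ (EFin \o _)) => //.
  have : \int[P]_w (cst 1 w + u * X w) <= \int[P]_w expR (u * X w).
    apply: le_Rintegral => //.
      rewrite (_ : EFin \o _ = (EFin \o cst 1%R \+ EFin \o (fun w => u * X w)%R)%E)//.
      exact: integrableD.
    by move=> w _; exact: expR_ge1Dx.
  rewrite RintegralD//= RintegralZl// Rintegral_cst// (congr1 fine (probability_setT P)) mulr1.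
  by rewrite [X in _ <= X -> _]/Rintegral E /= -/M; lra.
have key' u : u ^+ 2 * s ^+ 2 <= 1 -> u * M <= u ^+ 2 * s ^+ 2.
  move=> u1; apply: le_trans (key u) _.
  set y := _ / 2; have y0 : 0 <= y by rewrite divr_ge0// mulr_ge0 ?sqr_ge0.
  have y2 : y <= 1 / 2 by rewrite /y; lra.
  have := expR_ge1Dx (- y); rewrite expRN.
  have e0 := expR_gt0 y.
  rewrite -(ler_pM2r e0) mulVf ?gt_eqF// => h.
  have -> : u ^+ 2 * s ^+ 2 = 2 * y by rewrite /y; lra.
  by nra.
have [//|M0] := eqVneq M 0.
have s2 : 0 < s ^+ 2 by rewrite exprn_gt0.
set e := Num.min (1 / s ) (`|M| / (2 * s ^+ 2)).
have e0 : 0 < e by rewrite lt_min !divr_gt0 ?mulr_gt0 ?normr_gt0.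
have es : e * s <= 1 by rewrite -ler_pdivlMr// ge_min lexx.
have eM : e * (2 * s ^+ 2) <= `|M|.
  by rewrite -ler_pdivlMr ?mulr_gt0// ge_min lexx orbT.
have := key' (Num.sg M * e).
have -> : (Num.sg M * e) ^+ 2 = e ^+ 2 by rewrite exprMn sqr_sg M0 mul1r.
have -> : Num.sg M * e * M = e * `|M| by rewrite [in RHS]normrEsg; ring.
rewrite -exprMn exprn_ile1 ?mulr_ge0 ?(ltW e0) ?(ltW s0)// => /(_ isT).
rewrite exprMn expr2 -mulrA ler_pM2l// => h.
by have := normr_gt0 M; rewrite M0; nra.
Qed.

End gaussian_variables.

(** * Independence *)

Section sub_sigma_algebras.
Context d (Omega : measurableType d) (R : realType).
Implicit Types (A : set (set Omega)) (f g : Omega -> R).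

(** Filtrations and increment sigma-algebras are bare sets of sets, not measurable types;
    [meas_wrtP] passes to the generated measurable type to borrow its closure properties. *)
Definition meas_wrt A f := forall B : set R, measurable B -> A (f @^-1` B).

Lemma meas_wrt_sub A A' f : A `<=` A' -> meas_wrt A f -> meas_wrt A' f.
Proof. by move=> AA' mf B /mf /AA'. Qed.

Lemma meas_wrtP A f : sigma_algebra setT A ->
  meas_wrt A f <-> measurable_fun (setT : set (g_sigma_algebraType A)) f.
Proof.
move=> sA; split=> [mf _ B mB|mf B mB].
  by rewrite setTI measurable_g_measurableTypeE//; exact: mf.
have := mf measurableT B mB.
by rewrite setTI measurable_g_measurableTypeE.
Qed.

Lemma meas_wrt_measurable A f : A `<=` measurable -> meas_wrt A f ->
  measurable_fun setT f.
Proof. by move=> Am mf _ B mB; rewrite setTI; exact/Am/mf. Qed.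

Lemma meas_wrtM A f g : sigma_algebra setT A ->
  meas_wrt A f -> meas_wrt A g -> meas_wrt A (fun w => f w * g w).
Proof.
move=> sA /(meas_wrtP _ sA) mf /(meas_wrtP _ sA) mg.
by apply/(meas_wrtP _ sA); exact: measurable_funM.
Qed.

Lemma meas_wrtB A f g : sigma_algebra setT A ->
  meas_wrt A f -> meas_wrt A g -> meas_wrt A (fun w => f w - g w).
Proof.
move=> sA /(meas_wrtP _ sA) mf /(meas_wrtP _ sA) mg.
by apply/(meas_wrtP _ sA); exact: measurable_funB.
Qed.

Lemma meas_wrt_cst A r : sigma_algebra setT A -> meas_wrt A (fun _ => r).
Proof. by move=> sA; apply/(meas_wrtP _ sA). Qed.

Lemma meas_wrt_prod A (I : Type) (s : seq I) (f : I -> Omega -> R) :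
  sigma_algebra setT A -> (forall i, meas_wrt A (f i)) ->
  meas_wrt A (fun w => \prod_(i <- s) f i w).
Proof.
move=> sA mf; elim: s => [|i s IH].
  by under eq_fun do rewrite big_nil; exact: meas_wrt_cst.
by under eq_fun do rewrite big_cons; exact: meas_wrtM.
Qed.

End sub_sigma_algebras.

Section independence.
Context d (Omega : measurableType d) (R : realType) (P : probability Omega R).

Section real_variables.
Variables X Y : {mfun Omega >-> measurableTypeR R}.
Hypothesis XY : forall A B : set (measurableTypeR R), measurable A -> measurable B ->
  P (X @^-1` A `&` Y @^-1` B) = (P (X @^-1` A) * P (Y @^-1` B))%E.
Hypothesis iX : P.-integrable setT (EFin \o (X : Omega -> R)).
Hypothesis iY : P.-integrable setT (EFin \o (Y : Omega -> R)).

Let Z : Omega -> measurableTypeR R * measurableTypeR R := fun w => (X w, Y w).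

Let mZ : measurable_fun setT Z.
Proof. exact: measurable_fun_pair. Qed.

Let Z' : {mfun Omega >-> (measurableTypeR R * measurableTypeR R)%type} :=
  MeasurableFun.Pack (MeasurableFun.Class (isMeasurableFun.Build _ _ _ _ _ mZ)).

(** Independence says that the joint law and the product of the laws agree on rectangles, and this
    determines the product measure. *)
Let law (f : measurableTypeR R * measurableTypeR R -> \bar R) :
  (\int[distribution P X \x distribution P Y]_z f z = \int[distribution P Z']_z f z)%E.
Proof.
apply: eq_measure_integral => A mA _.
exact: (@product_measure_unique _ _ _ _ R (distribution P X) (distribution P Y)
  (distribution P Z')).
Qed.

Let mmul : measurable_fun setT (fun z : measurableTypeR R * measurableTypeR R =>
  (z.1 * z.2)%:E).
Proof.
apply/measurable_EFinP; apply: measurable_funM.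
  exact: measurable_fst.
exact: measurable_snd.
Qed.

Let mabs : measurable_fun setT (fun z : measurableTypeR R * measurableTypeR R =>
  `|(z.1 * z.2)%:E|%E).
Proof. by apply: measurableT_comp => //; exact: mmul. Qed.

Let iXd : (distribution P X).-integrable setT (EFin : R -> \bar R).
Proof. exact: integrable_pushforward. Qed.

Let iYd : (distribution P Y).-integrable setT (EFin : R -> \bar R).
Proof. exact: integrable_pushforward. Qed.

(** Tonelli for the absolute value comes first: it yields the integrability of the product that
    Fubini presupposes. *)
Let abs_prod : (\int[P]_w `|(X w * Y w)%:E| =
   \int[distribution P X]_x `|x%:E| * \int[distribution P Y]_y `|y%:E|)%E.
Proof.
transitivity (\int[distribution P Z']_z `|(z.1 * z.2)%:E|)%E.
  by rewrite (@ge0_integral_distribution _ _ _ _ _ P Z' (fun z => `|(z.1 * z.2)%:E|)%E)//; exact: mabs.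
rewrite -law fubini_tonelli1; [|exact: mabs|by move=> z; exact: abse_ge0].
rewrite /=.
rewrite -ge0_integralZr//; last 2 first.
- exact: measurableT_comp.
- exact: integral_ge0.
apply: eq_integral => x _; rewrite /fubini_F /= -ge0_integralZl//; last first.
  exact: measurableT_comp.
by apply: eq_integral => y _; rewrite normrM.
Qed.

Let iZ : P.-integrable setT (fun w => (X w * Y w)%:E).
Proof.
apply/integrableP; split.
  exact: (measurableT_comp mmul mZ).
rewrite abs_prod.
have /integrableP[_ hX] := iXd; have /integrableP[_ hY] := iYd.
by rewrite lte_mul_pinfty ?integral_ge0// ge0_fin_numE// integral_ge0.
Qed.

Let iZd : (distribution P X \x distribution P Y)%E.-integrable setT
  (fun z => (z.1 * z.2)%:E).
Proof.
apply/integrableP; split; first exact: mmul.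
rewrite law (@ge0_integral_distribution _ _ _ _ _ P Z' (fun z => `|(z.1 * z.2)%:E|)%E)//.
by have /integrableP[] := iZ.
Qed.

Lemma indep_mfun_integral : P.-integrable setT (EFin \o (fun w => X w * Y w : R)) /\
  (\int[P]_w (X w * Y w) = (\int[P]_w X w) * (\int[P]_w Y w))%R.
Proof.
split; first exact: iZ.
have E : (\int[P]_w (X w * Y w)%:E = \int[P]_w (X w)%:E * \int[P]_w (Y w)%:E)%E.
  transitivity (\int[distribution P Z']_z ((z.1 * z.2)%:E))%E.
    by rewrite (integral_distribution (X := Z') mmul)//; exact: iZ.
  rewrite -law -integral12_prod_meas1; last exact: iZd.
  rewrite /fubini_F /=.
  have fX : (\int[P]_w (X w)%:E = \int[distribution P X]_x x%:E)%E.
    by rewrite (integral_distribution (X := X) (f := EFin)).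
  have fY : (\int[P]_w (Y w)%:E = \int[distribution P Y]_x x%:E)%E.
    by rewrite (integral_distribution (X := Y) (f := EFin)).
  have YE : (\int[distribution P Y]_x x%:E = (fine (\int[distribution P Y]_x x%:E))%:E)%E.
    by rewrite fineK// integrable_fin_num.
  rewrite fX fY [in RHS]YE -integralZr//; apply: eq_integral => x _.
  rewrite -YE -integralZl//.
rewrite /Rintegral E fineM//; exact: integrable_fin_num.
Qed.

End real_variables.

Lemma indep_integral (A B : set (set Omega)) (f g : Omega -> R) :
  A `<=` measurable -> B `<=` measurable -> indep_systems P A B ->
  meas_wrt A f -> meas_wrt B g ->
  P.-integrable setT (EFin \o f) -> P.-integrable setT (EFin \o g) ->
  P.-integrable setT (EFin \o (fun w => f w * g w)) /\
  (\int[P]_w (f w * g w) = (\int[P]_w f w) * (\int[P]_w g w))%R.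
Proof.
move=> Am Bm AB fA gB.
have mf : measurable_fun setT (f : Omega -> measurableTypeR R).
  exact: (meas_wrt_measurable Am fA).
have mg : measurable_fun setT (g : Omega -> measurableTypeR R).
  exact: (meas_wrt_measurable Bm gB).
pose f' : {mfun Omega >-> measurableTypeR R} := MeasurableFun.Pack
  (MeasurableFun.Class (isMeasurableFun.Build _ _ _ _ _ mf)).
pose g' : {mfun Omega >-> measurableTypeR R} := MeasurableFun.Pack
  (MeasurableFun.Class (isMeasurableFun.Build _ _ _ _ _ mg)).
apply: (@indep_mfun_integral f' g') => C D mC mD.
by apply: AB; [exact: fA | exact: gB].
Qed.

End independence.

(** * Mean-square distance *)

Section square_distance.
Context d (T : measurableType d) (R : realType) (mu : {measure set T -> \bar R}).
Local Open Scope ereal_scope.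
Implicit Types (D : set T) (f g h : T -> R).

(** With an arbitrary measure and domain, the same lemmas serve the mean-square distance of random
    variables and the L2 distance on the cube. *)
Definition sqdist D f g : \bar R := \int[mu]_(x in D) ((f x - g x) ^+ 2)%:E.

Lemma sqdist_ge0 D f g : 0 <= sqdist D f g.
Proof. by apply: integral_ge0 => x _; rewrite lee_fin sqr_ge0. Qed.

Lemma sqdistC D f g : sqdist D f g = sqdist D g f.
Proof. by apply: eq_integral => x _; rewrite -opprB sqrrN. Qed.

Lemma measurable_sqrB D f g : measurable_fun D f -> measurable_fun D g ->
  measurable_fun D (fun x => ((f x - g x) ^+ 2)%:E).
Proof.
move=> mf mg; apply/measurable_EFinP; apply: measurable_funX.
exact: measurable_funB.
Qed.

(** Pointwise (a + b)^2 <= 2 a^2 + 2 b^2; for limits this does the work of Minkowski's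
    inequality. *)
Lemma sqdist_triangle D f g h : measurable D ->
  measurable_fun D f -> measurable_fun D g -> measurable_fun D h ->
  sqdist D f h <= 2%:E * (sqdist D f g + sqdist D g h).
Proof.
move=> mD mf mg mh; rewrite /sqdist -ge0_integralD//; last 4 first.
- by move=> x _; rewrite lee_fin sqr_ge0.
- exact: measurable_sqrB.
- by move=> x _; rewrite lee_fin sqr_ge0.
- exact: measurable_sqrB.
rewrite -ge0_integralZl//; last 2 first.
- by apply: emeasurable_funD; exact: measurable_sqrB.
- by move=> x _; rewrite -EFinD lee_fin addr_ge0 ?sqr_ge0.
apply: ge0_le_integral => //.
- by move=> x _; rewrite lee_fin sqr_ge0.
- exact: measurable_sqrB.
- apply: emeasurable_funM => //.
  by apply: emeasurable_funD; exact: measurable_sqrB.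
- move=> x _; rewrite -EFinD -EFinM lee_fin.
  rewrite [leRHS](_ : _ = (f x - h x) ^+ 2 + ((f x - g x) - (g x - h x)) ^+ 2)%R; last by ring.
  by rewrite lerDl sqr_ge0.
Qed.

Lemma sqdist_eq0 f g : measurable_fun setT f -> measurable_fun setT g ->
  sqdist setT f g = 0 -> {ae mu, forall x, f x = g x}.
Proof.
move=> mf mg; rewrite /sqdist => E.
have := (ae_eq_integral_abs mu measurableT (measurable_sqrB mf mg)).1.
have -> : \int[mu]_x `|((f x - g x) ^+ 2)%:E| = \int[mu]_x ((f x - g x) ^+ 2)%:E.
  by apply: eq_integral => x _; rewrite gee0_abs// lee_fin sqr_ge0.
move=> /(_ E); apply: filterS => x /(_ I) /= [] /eqP.
by rewrite sqrf_eq0 subr_eq0 => /eqP.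
Qed.

End square_distance.

(** * Completeness for mean-square convergence *)

Section completeness.
Context d (T : measurableType d) (R : realType) (P : probability T R).
Local Open Scope ereal_scope.
Variable X : nat -> T -> R.
Hypothesis mX : forall n, measurable_fun setT (X n).

Section fast.
Hypothesis fast : forall n,
  sqdist P setT (X n.+1) (X n) <= ((2 ^+ n)^-1 * (1 / (2 ^ n.+1)%:R))%:E.

Let D n w := (X n.+1 w - X n w)%R.

Let mD n : measurable_fun setT (D n).
Proof. exact: measurable_funB. Qed.

Let mabsD n : measurable_fun setT (fun w => `|D n w|%:E).
Proof. by apply/measurable_EFinP; apply: measurableT_comp. Qed.

(** With q = 2^n one has |y| <= 1/(2q) + q y^2. The rate in [fast] makes both terms contribute at
    most 1 / 2^(n+1), which is summable. *)
Let intD n : \int[P]_w `|D n w|%:E <= (2 / (2 ^ n.+1)%:R)%:E.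
Proof.
apply: (@le_trans _ _ (\int[P]_w ((1 / (2 ^ n.+1)%:R)%:E +
    (2 ^+ n)%:E * ((X n.+1 w - X n w) ^+ 2)%:E))).
  apply: ge0_le_integral => //.
  - by apply: emeasurable_funD => //; apply: emeasurable_funM => //; exact: measurable_sqrB.
  - move=> w _; rewrite -EFinM -EFinD lee_fin -/(D n w) natrX exprS.
    set a : R := (2 ^+ n)%R; have a0 : (0 < a)%R by rewrite exprn_gt0.
    rewrite -[(D n w ^+ 2)%R]real_normK ?num_real//.
    set y := `|_|%R; have y0 : (0 <= y)%R by rewrite normr_ge0.
    have aN0 : a != 0%R by rewrite gt_eqF.
    rewrite -(ler_pM2l a0).
    have -> : (a * (1 / (2 * a) + a * y ^+ 2) = 1 / 2 + (a * y) ^+ 2)%R.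
      by clear -aN0; move: aN0; generalize a y => b z b0; field; rewrite b0.
    by have := sqr_ge0 (a * y - 1)%R; rewrite sqrrB mulr2n; nra.
rewrite ge0_integralD//; last 2 first.
- by move=> w _; rewrite -EFinM lee_fin mulr_ge0 ?sqr_ge0 ?exprn_ge0.
- by apply: emeasurable_funM => //; exact: measurable_sqrB.
rewrite integral_cst// [X in _ * X + _](probability_setT P) mule1.
rewrite ge0_integralZl//; last 2 first.
- exact: measurable_sqrB.
- by move=> w _; rewrite lee_fin sqr_ge0.
have h := fast n; rewrite /sqdist in h.
have p2 : (0 < 2 ^+ n :> R)%R by rewrite exprn_gt0.
apply: (@le_trans _ _ ((1 / (2 ^ n.+1)%:R)%:E +
    (2 ^+ n)%:E * ((2 ^+ n)^-1 * (1 / (2 ^ n.+1)%:R))%:E)).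
  by rewrite leeD2l// lee_wpmul2l// lee_fin ltW.
by rewrite -EFinM mulVKf ?gt_eqF// -EFinD lee_fin; lra.
Qed.

Let G w : \bar R := \sum_(0 <= n <oo) `|D n w|%:E.

Let mG : measurable_fun setT G.
Proof. by apply: ge0_emeasurable_sum => // n w _ _; rewrite lee_fin. Qed.

Let intG : \int[P]_w G w <= 2%:E.
Proof.
rewrite /G integral_nneseries//.
apply: (@le_trans _ _ (\sum_(0 <= n <oo) (2 / (2 ^ n.+1)%:R)%:E)).
  by apply: lee_nneseries => [n _ _|n _]; [exact: integral_ge0|exact: intD].
exact: epsilon_trick0.
Qed.

Let A := [set w | G w < +oo].

Let mA : measurable A.
Proof.
by have := emeasurable_fun_infty_o measurableT mG +oo; rewrite setTI.
Qed.

Let PA : P (~` A) = 0.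
Proof.
have iG : P.-integrable setT G.
  apply/integrableP; split => //.
  apply: (@le_lt_trans _ _ 2%:E); last by rewrite ltry.
  apply: le_trans intG; rewrite le_eqVlt; apply/orP; left; apply/eqP.
  by apply: eq_integral => w _; rewrite gee0_abs// nneseries_ge0.
have := integrable_ae measurableT iG.
case=> N [mN PN sN]; apply: (subset_measure0 _ mN) => //; first exact: measurableC.
move=> w /= nA; apply: sN => /= /(_ I) fG; apply: nA.
by rewrite /A /= ltey_eq fG.
Qed.

Let cvgX w : A w -> cvgn (fun n => X n w).
Proof.
move=> Aw.
have cD : cvgn (series (fun n => D n w)).
  apply: (@normed_cvg R R^o); apply: nondecreasing_is_cvgn.
    by apply: nondecreasing_series => n _ _; exact: normr_ge0.
  exists (fine (G w)) => _ [n _ <-].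
  rewrite -lee_fin fineK; last first.
    by rewrite ge0_fin_numE//; exact: nneseries_ge0.
  rewrite /series /= -sumEFin; exact: nneseries_lim_ge.
have -> : (fun n => X n w) = (fun n => X 0%N w + series (fun n => D n w) n)%R.
  apply/funext => n; rewrite /series /=.
  by rewrite telescope_sumr// addrC subrK.
by apply: is_cvgD => //; exact: is_cvg_cst.
Qed.

(** The indicator of the full-measure set [A], where the differences are absolutely summable, makes
    the sequence converge everywhere, so that the limit is measurable. *)
Let Y w := limn (fun n => X n w * \1_A w)%R.

Let cvgY w : (X n w * \1_A w)%R @[n --> \oo] --> Y w.
Proof.
rewrite /Y; have [Aw|nAw] := pselect (A w).
  have -> : (fun n => X n w * \1_A w)%R = (fun n => X n w).
    by apply/funext => n; rewrite indicE mem_set// mulr1.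
  exact: cvgX.
have -> : (fun n => X n w * \1_A w)%R = (fun n => 0%R).
  by apply/funext => n; rewrite indicE memNset// mulr0.
by rewrite lim_cst//; exact: cvg_cst.
Qed.

Let mY : measurable_fun setT Y.
Proof.
apply: (measurable_fun_cvg (h := fun n w => X n w * \1_A w)%R) => [n|w _].
  by apply: measurable_funM => //; exact: measurable_indic.
exact: cvgY.
Qed.

(** Fatou's lemma carries a bound on the distances from [Z] to the tail over to the limit. With [Z]
    a term of the original sequence this gives convergence of the whole sequence, not just of a fast
    subsequence. *)
Lemma fast_L2_limit : exists2 Y : T -> R, measurable_fun setT Y &
  forall (Z : T -> R) (e : R), measurable_fun setT Z ->
    (exists N, forall n, (N <= n)%N -> sqdist P setT Z (X n) <= e%:E) ->
    sqdist P setT Z Y <= e%:E.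
Proof.
exists Y; first exact: mY.
move=> Z e mZ [N HN].
rewrite /sqdist (ge0_negligible_integral (measurableC mA) measurableT _ _ PA)//=; last 2 first.
- exact: measurable_sqrB.
- by move=> x _; rewrite lee_fin sqr_ge0.
rewrite setTD setCK.
have E w : A w -> ((Z w - Y w) ^+ 2)%:E =
    limn_einf (fun n => ((Z w - X n w) ^+ 2)%:E).
  move=> Aw.
  have c : ((Z w - X n w) ^+ 2)%:E @[n --> \oo] --> ((Z w - Y w) ^+ 2)%:E.
    apply: cvg_EFin; first by apply: nearW.
    have cX : X n w @[n --> \oo] --> Y w.
      have := @cvgY w; rewrite indicE mem_set//.
      by under eq_fun do rewrite mulr1.
    rewrite /=; under eq_fun do rewrite /= expr2.
    by rewrite expr2; apply: cvgM; apply: cvgB => //; exact: cvg_cst.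
  rewrite is_cvg_limn_einfE; last by apply/cvg_ex; eexists; exact: c.
  by apply/esym/cvg_lim.
under eq_integral => w /[!inE] wA do rewrite E//.
apply: le_trans (fatou P mA _ _) _ => //.
- move=> n; apply: (@measurable_funS _ _ _ _ setT) => //; exact: measurable_sqrB.
- by move=> n w _; rewrite lee_fin sqr_ge0.
rewrite limn_einf_lim; apply: lime_le; first exact: is_cvg_einfs.
apply: nearW => n; apply: le_trans (HN (maxn n N) (leq_maxr _ _)).
apply: (@le_trans _ _ (\int[P]_(w in A) ((Z w - X (maxn n N) w) ^+ 2)%:E)).
  by apply: ereal_inf_lbound; exists (maxn n N) => //=; exact: leq_maxl.
apply: ge0_subset_integral => //; first exact: measurable_sqrB.
by move=> w _; rewrite lee_fin sqr_ge0.
Qed.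

End fast.

End completeness.

Lemma L2_complete d (T : measurableType d) (R : realType) (P : probability T R)
    (X : nat -> T -> R) :
  (forall n, measurable_fun setT (X n)) ->
  (forall e : R, 0 < e -> exists N, forall n m, (N <= n)%N -> (N <= m)%N ->
    (sqdist P setT (X n) (X m) <= e%:E)%E) ->
  exists2 Y : T -> R, measurable_fun setT Y &
    forall e : R, 0 < e -> exists N, forall n, (N <= n)%N ->
      (sqdist P setT (X n) Y <= e%:E)%E.
Proof.
move=> mX cX.
pose c k : R := (2 ^+ k)^-1 * (1 / (2 ^ k.+1)%:R).
have c0 k : 0 < c k.
  by rewrite /c mulr_gt0 ?invr_gt0 ?exprn_gt0// divr_gt0// ltr0n expn_gt0.
have /choice[M HM] : forall k, exists N, forall n m, (N <= n)%N -> (N <= m)%N ->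
    (sqdist P setT (X n) (X m) <= (c k)%:E)%E by move=> k; exact: cX.
(* As a sum of all earlier thresholds, [s] exceeds [M k] at both [k] and [k.+1]; the summand [k]
   makes it unbounded. *)
pose s k := (k + \sum_(j < k.+1) M j)%N.
have sM k : (M k <= s k)%N.
  by rewrite /s big_ord_recr /= addnA leq_addl.
have sS k : (M k <= s k.+1)%N.
  by rewrite (leq_trans (sM k))// /s [in leqRHS]big_ord_recr /= leq_add// leq_addr.
have [|Y mY HY] := @fast_L2_limit _ _ _ P (X \o s) (fun n => mX (s n)).
  by move=> n; apply: HM.
exists Y => // e e0; have [N HN] := cX e e0; exists N => n Nn.
apply: HY => //; exists N => k Nk; apply: HN => //.
by rewrite (leq_trans Nk)// leq_addr.
Qed.

(** The product is at most the power of its largest factor, and q <= 1 + q^2. This reduces mixed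
    moments of increments, repeated or not, to even moments of single ones without Holder's
    inequality. *)
Lemma prod_norm_le (R : realFieldType) (l : seq R) :
  `|\prod_(y <- l) y| <= 1 + \sum_(y <- l) y ^+ 2 ^+ size l.
Proof.
have S0 : 0 <= \sum_(y <- l) y ^+ 2 ^+ size l.
  by apply: sumr_ge0 => y _; rewrite exprn_ge0// sqr_ge0.
case: l S0 => [|a l] S0; first by rewrite !big_nil normr1 addr0.
have [y yl ymax] : exists2 y, y \in a :: l & forall z, z \in a :: l -> `|z| <= `|y|.
  elim: l a {S0} => [|b l IH] a.
    by exists a; rewrite ?mem_head// => z; rewrite inE => /eqP ->.
  have [y yl ymax] := IH b; have [ay|ya] := leP `|a| `|y|.
    by exists y; rewrite 1?inE ?yl ?orbT// => z; rewrite inE => /predU1P[->|/ymax].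
  exists a; rewrite ?mem_head// => z; rewrite inE => /predU1P[->//|/ymax zy].
  exact: le_trans zy (ltW ya).
set s := a :: l in S0 yl ymax *.
apply: (@le_trans _ _ (`|y| ^+ size s)).
  rewrite normr_prod.
  have -> : `|y| ^+ size s = \prod_(z <- s) `|y|.
    by rewrite big_const_seq count_predT iter_mulr_1.
  by rewrite big_seq [leRHS]big_seq; apply: ler_prod => z zs; rewrite normr_ge0 ymax.
set n := size s; set q := `|y| ^+ n.
apply: (@le_trans _ _ (1 + q ^+ 2)).
  have := sqr_ge0 (q - 1); have : 0 <= q by rewrite exprn_ge0.
  by rewrite sqrrB mulr2n; nra.
rewrite lerD2l (big_rem y)//= /q -exprM mulnC exprM real_normK ?num_real//.
by rewrite lerDl; apply: sumr_ge0 => z _; rewrite exprn_ge0// sqr_ge0.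
Qed.

(** * Increments of a Wiener process *)

Section wiener_increments.
Context d (Omega : measurableType d) (R : realType) (P : probability Omega R).
Context (m : nat) (T : R) (F : R -> set (set Omega)).
Hypothesis hF : is_filtration T F.
Variable W : 'I_m -> R -> {RV P >-> R}.
Hypothesis hW : is_wiener W T F.
Implicit Types i : 'I_m.+1.

Definition incr i (s u : R) (w : Omega) : R := with_time W i u w - with_time W i s w.

Lemma incr_time s u w : incr ord0 s u w = u - s.
Proof. by rewrite /incr /with_time unlift_none. Qed.

Lemma incr_W j s u w : incr (lift ord0 j) s u w = W j u w - W j s w.
Proof. by rewrite /incr /with_time liftK. Qed.

Lemma incr_WE j s u : incr (lift ord0 j) s u = fun w => W j u w - W j s w.
Proof. by apply/funext => w; exact: incr_W. Qed.

Lemma incr_timeE s u : incr ord0 s u = fun _ => u - s.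
Proof. by apply/funext => w; exact: incr_time. Qed.

Lemma measurable_incr i s u : measurable_fun setT (incr i s u).
Proof.
case: (unliftP ord0 i) => [j|] ->.
  by rewrite incr_WE; exact: measurable_funB.
by rewrite incr_timeE.
Qed.

Lemma sigma_increment_algebra s u : sigma_algebra setT (sigma_increment W s u).
Proof. exact: smallest_sigma_algebra. Qed.

Lemma measurable_sigma_algebra : sigma_algebra setT (@measurable d Omega).
Proof.
split; first exact: measurable0.
- by move=> A mA; rewrite setTD; exact: measurableC.
- by move=> A mA; exact: bigcupT_measurable.
Qed.

Lemma sigma_increment_sub s u : sigma_increment W s u `<=` measurable.
Proof.
apply: smallest_sub; first exact: measurable_sigma_algebra.
move=> A [j _ [B mB <-]]; rewrite setTI -[X in measurable X]setTI.
exact: measurable_funB.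
Qed.

Lemma sigma_path_sub j : sigma_path W T j `<=` measurable.
Proof.
apply: smallest_sub; first exact: measurable_sigma_algebra.
by move=> A [s _ [B mB <-]]; exact: measurable_funPT.
Qed.

Lemma incr_sigma_increment i s u : meas_wrt (sigma_increment W s u) (incr i s u).
Proof.
have sA := sigma_increment_algebra s u.
case: (unliftP ord0 i) => [j|] ->; last first.
  by rewrite incr_timeE; exact: meas_wrt_cst.
move=> B mB; apply: sub_sigma_algebra; exists j => //; exists B => //.
by rewrite setTI incr_WE.
Qed.

Lemma incr_F i s u v : 0 <= s <= u -> u <= v <= T -> meas_wrt (F v) (incr i s u).
Proof.
move=> /andP[s0 su] /andP[uv vT].
have v0 : 0 <= v <= T by rewrite vT andbT (le_trans s0)// (le_trans su).
have [sA _] := hF.1 v v0.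
case: (unliftP ord0 i) => [j|] ->; last first.
  by rewrite incr_timeE; exact: meas_wrt_cst.
rewrite incr_WE.
have h r : 0 <= r <= v -> meas_wrt (F v) (W j r).
  move=> /andP[r0 rv] B mB; apply: (hF.2 r v) => //; first by rewrite r0.
    have rT : 0 <= r <= T by rewrite r0 (le_trans rv).
    apply: (wiener_adapted hW rT).
    by exists B => //; rewrite setTI.
by apply: meas_wrtB => //; apply: h; rewrite ?s0 ?(le_trans s0 su)//= (le_trans su).
Qed.

Lemma incr_sigma_path j s u : 0 <= s <= u -> u <= T ->
  meas_wrt (sigma_path W T j) (incr (lift ord0 j) s u).
Proof.
move=> /andP[s0 su] uT.
rewrite incr_WE.
have sA : sigma_algebra setT (sigma_path W T j) by exact: smallest_sigma_algebra.
have h r : 0 <= r <= T -> meas_wrt (sigma_path W T j) (W j r).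
  move=> rT B mB; apply: sub_sigma_algebra; exists r; first by rewrite /= in_itv.
  by exists B => //; rewrite setTI.
by apply: meas_wrtB => //; apply: h; rewrite ?s0 ?(le_trans s0 su)//= (le_trans su).
Qed.

(** The product rule over all components is applied to a family that is the whole space except at
    [j] and [j']. *)
Lemma indep_paths j j' : j != j' ->
  indep_systems P (sigma_path W T j) (sigma_path W T j').
Proof.
move=> jj' A B hA hB.
pose C k := if k == j then A else if k == j' then B else setT.
have hC k : sigma_path W T k (C k).
  rewrite /C; case: eqP => [->//|_]; case: eqP => [->//|_].
  exact: (@measurableT _ (g_sigma_algebraType _)).
have := wiener_indep_components hW hC.
have -> : \bigcap_(k in [set: 'I_m]) C k = A `&` B.
  apply/seteqP; split => [w h|w [hA' hB'] k _].
    split; first by have := h j I; rewrite /C eqxx.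
    by have := h j' I; rewrite /C eqxx eq_sym (negbTE jj').
  by rewrite /C; case: eqP => // _; case: eqP.
move=> ->; rewrite (bigD1 j)//= (bigD1 j')/=; last by rewrite eq_sym.
rewrite big1 ?mule1; last first.
  move=> k /andP[/negbTE kj /negbTE kj'].
  by rewrite /C kj kj' probability_setT.
by rewrite /C !eqxx eq_sym (negbTE jj').
Qed.

Section cell.
Variables (s u : R).
Hypothesis su : 0 <= s < u.
Hypothesis uT : u <= T.

Let dl := u - s.
Let dl0 : 0 < dl. Proof. by rewrite subr_gt0; case/andP: su. Qed.

Lemma incr_normal j B : measurable B ->
  P [set w | B (incr (lift ord0 j) s u w)] = normal_prob 0 (Num.sqrt (u - s)) B.
Proof.
move=> mB; rewrite -(wiener_gaussian hW j su uT mB).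
by congr (P _); apply/funext => w /=; rewrite incr_W.
Qed.

Let sd0 : 0 < Num.sqrt dl. Proof. by rewrite sqrtr_gt0. Qed.

(** The first summand is the Gaussian bound with the variance factored out; the second serves the
    time component, where (u - s)^(2n) <= (u - s)^n D^n. *)
Definition moment_bound (D : R) n : R := 2 * n`!%:R * (8 / 3) ^+ n + D ^+ n.

Lemma incr_moment D i n : dl <= D ->
  (\int[P]_w (incr i s u w ^+ 2 ^+ n)%:E <= (dl ^+ n * moment_bound D n)%:E)%E.
Proof.
move=> dD; have D0 : 0 <= D by apply: le_trans dD; exact: ltW.
have c0 : 0 <= 2 * n`!%:R * (8 / 3) ^+ n :> R by rewrite !mulr_ge0.
case: (unliftP ord0 i) => [j|] ->.
  apply: le_trans (normal_moment_le (measurable_incr _ _ _) sd0 (@incr_normal j) n) _.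
  rewrite lee_fin sqr_sqrtr ?(ltW dl0)// exprMn mulrA mulrC ler_wpM2l ?exprn_ge0 ?(ltW dl0)//.
  by rewrite lerDl exprn_ge0.
under eq_integral do rewrite incr_time.
rewrite integral_cst// [X in (_ * X)%E](probability_setT P) mule1 lee_fin -/dl.
rewrite expr2 exprMn ler_wpM2l ?exprn_ge0 ?(ltW dl0)//.
rewrite (@le_trans _ _ (D ^+ n))//; last by rewrite lerDr.
by rewrite lerXn2r ?nnegrE ?(ltW dl0).
Qed.

Definition mono (l : seq 'I_m.+1) (w : Omega) : R := \prod_(i <- l) incr i s u w.

Lemma measurable_mono l : measurable_fun setT (mono l).
Proof. by apply: measurable_prod => i _; exact: measurable_incr. Qed.

(** Dividing each increment by [Num.sqrt dl] makes its even moments bounded uniformly over cells,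
    and [prod_norm_le] applies to the normalised increments. The later estimates count the square
    roots that remain in front. *)
Lemma mono_abs_integral D l : dl <= D ->
  (\int[P]_w `|mono l w|%:E <= (Num.sqrt dl ^+ size l *
     (1 + (size l)%:R * moment_bound D (size l)))%:E)%E.
Proof.
move=> dD; set n := size l; set r := Num.sqrt dl.
have rN0 : r != 0 by rewrite gt_eqF.
have r20 : 0 <= r ^+ n by rewrite exprn_ge0// ltW.
have a0 : 0 <= (dl ^+ n)^-1 by rewrite invr_ge0 exprn_ge0// ltW.
have mi i : measurable_fun setT (fun w => (incr i s u w ^+ 2 ^+ n)%:E).
  by apply/measurable_EFinP; do 2 apply: measurable_funX; exact: measurable_incr.
have i0 i w : (0 <= (incr i s u w ^+ 2 ^+ n)%:E)%E.
  by rewrite lee_fin exprn_ge0// sqr_ge0.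
have ms : measurable_fun setT
    (fun w => \sum_(i <- l) (dl ^+ n)^-1%:E * (incr i s u w ^+ 2 ^+ n)%:E)%E.
  by apply: emeasurable_sum => i; apply: emeasurable_funM.
have s0 w : (0 <= \sum_(i <- l) (dl ^+ n)^-1%:E * (incr i s u w ^+ 2 ^+ n)%:E)%E.
  by apply: sume_ge0 => i _; rewrite mule_ge0.
apply: (@le_trans _ _ (\int[P]_w ((r ^+ n)%:E * (1%:E +
   \sum_(i <- l) (dl ^+ n)^-1%:E * (incr i s u w ^+ 2 ^+ n)%:E)))%E).
  apply: ge0_le_integral => //.
  - by apply/measurable_EFinP; apply: measurableT_comp => //; exact: measurable_mono.
  - by apply: emeasurable_funM => //; apply: emeasurable_funD.
  - move=> w _; rewrite /mono.
    have -> : (\sum_(i <- l) (dl ^+ n)^-1%:E * (incr i s u w ^+ 2 ^+ n)%:E =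
       (\sum_(i <- l) (dl ^+ n)^-1 * incr i s u w ^+ 2 ^+ n)%:E)%E.
      by rewrite -sumEFin; apply: eq_bigr => i _; rewrite EFinM.
    rewrite -EFinD -EFinM lee_fin.
    have -> : \prod_(i <- l) incr i s u w = r ^+ n * \prod_(y <- [seq incr i s u w / r | i <- l]) y.
      rewrite big_map big_split /= mulrCA.
      have -> : \prod_(i <- l) r^-1 = (r ^+ n)^-1.
        by rewrite big_const_seq count_predT iter_mulr_1 exprVn.
      by rewrite mulfV ?mulr1// expf_neq0.
    rewrite normrM ger0_norm// ler_wpM2l//.
    apply: le_trans (prod_norm_le _) _; rewrite size_map big_map lerD2l.
    apply: ler_sum => i _; have rr : r^-1 ^+ 2 = dl^-1 by rewrite exprVn sqr_sqrtr// ltW.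
    by rewrite [(_ / r) ^+ 2]exprMn rr exprMn exprVn mulrC.
rewrite ge0_integralZl//; last 2 first.
- by apply: emeasurable_funD.
- by move=> w _; rewrite adde_ge0.
rewrite EFinM lee_wpmul2l// ge0_integralD//.
rewrite integral_cst// [X in (_ * X + _)%E](probability_setT P) mule1 EFinD leeD2l//.
rewrite ge0_integral_sum//; last 2 first.
- by move=> i; apply: emeasurable_funM.
- by move=> i w _; rewrite mule_ge0.
apply: (@le_trans _ _ (\sum_(i <- l) (moment_bound D n)%:E)%E).
  apply: lee_sum => i _; rewrite ge0_integralZl//.
  apply: (@le_trans _ _ ((dl ^+ n)^-1%:E * (dl ^+ n * moment_bound D n)%:E)%E).
    by apply: lee_wpmul2l => //; exact: incr_moment.
  by rewrite -EFinM mulKf// gt_eqF// exprn_gt0.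
by rewrite sumEFin lee_fin big_const_seq count_predT iter_addr_0 mulr_natl.
Qed.

Lemma integrable_mono l : P.-integrable setT (EFin \o mono l).
Proof.
apply/integrableP; split.
  by apply/measurable_EFinP; exact: measurable_mono.
by apply: le_lt_trans (mono_abs_integral _ (lexx dl)) _; rewrite ltry.
Qed.

Definition moment l : R := (\int[P]_w mono l w)%R.

Lemma moment_le D l : dl <= D -> `|moment l| <= Num.sqrt dl ^+ size l *
     (1 + (size l)%:R * moment_bound D (size l)).
Proof.
move=> dD; rewrite /moment; apply: le_trans (le_normr_Rintegral _ (integrable_mono l)) _ => //.
rewrite -lee_fin; apply: le_trans (mono_abs_integral l dD).
rewrite /Rintegral fineK//.
apply: integrable_fin_num => //; exact: (integrable_norm (integrable_mono l)).
Qed.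

Lemma moment0 : moment [::] = 1.
Proof.
rewrite /moment /mono; under eq_Rintegral do rewrite big_nil.
by rewrite Rintegral_cst// (congr1 fine (probability_setT P)) mulr1.
Qed.

Lemma moment1 i : moment [:: i] = if i == ord0 then dl else 0.
Proof.
rewrite /moment /mono; case: (unliftP ord0 i) => [j|] ->.
  under eq_Rintegral do rewrite big_seq1.
  by rewrite (normal_mean (measurable_incr _ _ _) sd0 (@incr_normal j)).
under eq_Rintegral do rewrite big_seq1 incr_time.
by rewrite Rintegral_cst// (congr1 fine (probability_setT P)) mulr1 eqxx.
Qed.

(** These are the values that the leading part of a pair has to match. Distinct Wiener components
    give 0 by independence; two time increments give [dl ^+ 2], which is of higher order. *)
Lemma moment2 i i' : moment [:: i; i'] =
  if i == i' then if i == ord0 then dl ^+ 2 else dl else 0.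
Proof.
have E w : mono [:: i; i'] w = incr i s u w * incr i' s u w.
  by rewrite /mono big_cons big_seq1.
rewrite /moment; under eq_Rintegral do rewrite E.
have PT := congr1 fine (probability_setT P).
have iI k : P.-integrable setT (EFin \o incr k s u).
  have := integrable_mono [:: k]; congr (_.-integrable _ _).
  by apply/funext => w; rewrite /= /mono big_seq1.
have zero k : \int[P]_w incr (lift ord0 k) s u w = 0.
  exact: (normal_mean (measurable_incr _ _ _) sd0 (@incr_normal k)).
case: (unliftP ord0 i) => [j|] ->; case: (unliftP ord0 i') => [j'|] ->.
- rewrite (inj_eq (@lift_inj _ ord0)); case: eqVneq => [->|jj'].
    under eq_Rintegral do rewrite -expr2.
    rewrite (normal_variance (measurable_incr _ _ _) sd0 (@incr_normal j')).
    by rewrite sqr_sqrtr// ltW.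
  have su' : 0 <= s <= u by case/andP: su => -> /ltW.
  have [_ ->] := indep_integral (@sigma_path_sub j) (@sigma_path_sub j')
    (indep_paths jj') (incr_sigma_path su' uT) (incr_sigma_path su' uT) (iI _) (iI _).
  by rewrite zero mul0r.
- under eq_Rintegral do rewrite incr_time.
  by rewrite RintegralZr// zero mul0r.
- under eq_Rintegral do rewrite incr_time.
  by rewrite RintegralZl// zero mulr0.
- rewrite eqxx; under eq_Rintegral do rewrite !incr_time.
  by rewrite Rintegral_cst// PT mulr1.
Qed.

End cell.
End wiener_increments.

(** * Second moments of finite sums *)

Section Rintegral_sum.
Context d (X : measurableType d) (R : realType) (mu : {measure set X -> \bar R}).
Variables (D : set X) (mD : measurable D).

Lemma Rintegral_sum (I : Type) (s : seq I) (f : I -> X -> R) :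
  (forall i, mu.-integrable D (EFin \o f i)) ->
  mu.-integrable D (EFin \o (fun w => \sum_(i <- s) f i w)) /\
  \int[mu]_(w in D) (\sum_(i <- s) f i w) = \sum_(i <- s) \int[mu]_(w in D) f i w.
Proof.
move=> fi; elim: s => [|i s [IH1 IH2]].
  have E : (fun w => \sum_(i <- [::]) f i w) = cst 0 by apply/funext => w; rewrite big_nil.
  rewrite E big_nil Rintegral_cst// mul0r; split => //.
  exact: integrable0.
have E : (fun w => \sum_(j <- i :: s) f j w) = fun w => f i w + \sum_(j <- s) f j w.
  by apply/funext => w; rewrite big_cons.
rewrite E big_cons; split; last by rewrite RintegralD// IH2.
exact: (@integrableD _ _ _ _ _ _ (EFin \o f i) (EFin \o (fun w => \sum_(j <- s) f j w))).
Qed.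

End Rintegral_sum.

Section integral_of_sums.
Context d (Omega : measurableType d) (R : realType) (P : probability Omega R).

Lemma integrableZ (c : R) (f : Omega -> R) : P.-integrable setT (EFin \o f) ->
  P.-integrable setT (EFin \o (fun w => c * f w)).
Proof. by move=> fi; apply: (@integrableZl _ _ _ _ _ _ _ (EFin \o f)). Qed.

Lemma integrable_sub (f g : Omega -> R) : P.-integrable setT (EFin \o f) ->
  P.-integrable setT (EFin \o g) -> P.-integrable setT (EFin \o (fun w => f w - g w)).
Proof. by move=> fi gi; apply: (@integrableB _ _ _ _ _ _ (EFin \o f) (EFin \o g)). Qed.

Lemma sq_sum_le (T : finType) (dl : T -> R) (D : R) n
    (G : {ffun 'I_n -> T} -> Omega -> R) (kappa : R) (c : {ffun 'I_n -> T} -> R) :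
  (forall p, 0 <= dl p) -> \sum_p dl p <= D ->
  (forall j j', P.-integrable setT (EFin \o (fun w => G j w * G j' w))) ->
  0 <= kappa ->
  (forall j j', `|\int[P]_w (G j w * G j' w)| <= kappa * wt2 dl j j') ->
  (\int[P]_w ((\sum_j c j * G j w) ^+ 2)%:E <=
    (kappa * (n%:R + n%:R + D) ^+ n * \sum_j c j ^+ 2 * wt dl finset.set0 j)%:E)%E.
Proof.
move=> dl0 sdl iG k0 HG.
have E w : (\sum_j c j * G j w) ^+ 2 =
    \sum_j \sum_j' (c j * c j') * (G j w * G j' w).
  rewrite expr2 big_distrl /=; apply: eq_bigr => j _.
  by rewrite big_distrr /=; apply: eq_bigr => j' _; ring.
have I1 j := Rintegral_sum measurableT (index_enum _) (f := fun j' w => (c j * c j') * (G j w * G j' w))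
  (fun j' => integrableZ _ (iG j j')).
have [I2 I3] := Rintegral_sum measurableT (index_enum _)
  (f := fun j w => \sum_j' (c j * c j') * (G j w * G j' w)) (fun j => (I1 j).1).
have -> : (\int[P]_w ((\sum_j c j * G j w) ^+ 2)%:E =
    (\int[P]_w (\sum_j \sum_j' (c j * c j') * (G j w * G j' w)))%:E)%E.
  rewrite /Rintegral fineK; last exact: integrable_fin_num.
  by apply: eq_integral => w _; rewrite E.
rewrite lee_fin I3.
under eq_bigr do rewrite (I1 _).2.
under eq_bigr do under eq_bigr do rewrite RintegralZl//.
exact: (schur_test dl0 sdl c k0 HG).
Qed.

End integral_of_sums.

(** * Products of increments over the cells of a partition *)

Section cells.
Context d (Omega : measurableType d) (R : realType) (P : probability Omega R).
Context (m : nat) (T : R) (F : R -> set (set Omega)).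
Hypothesis hF : is_filtration T F.
Variable W : 'I_m -> R -> {RV P >-> R}.
Hypothesis hW : is_wiener W T F.
Variables (t : R) (N : nat) (tau : nat -> R).
Hypothesis t0 : 0 <= t.
Hypothesis htau : is_partition t T N tau.

Lemma partition_le a b : (a <= b <= N)%N -> tau a <= tau b.
Proof.
have [_ _ h] := htau; move=> /andP[]; elim: b => [|b IH].
  by rewrite leqn0 => /eqP ->.
rewrite leq_eqVlt => /predU1P[->//|]; rewrite ltnS => ab bN.
exact: le_trans (IH ab (ltnW bN)) (ltW (h _ bN)).
Qed.

Lemma partition_bounds a : (a <= N)%N -> t <= tau a <= T.
Proof.
move=> aN; have [h0 hN _] := htau.
by rewrite -{1}h0 -hN !partition_le ?leqnn ?aN.
Qed.

Definition delta (p : 'I_N) : R := tau p.+1 - tau p.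

Lemma delta_gt0 p : 0 < delta p.
Proof. by rewrite subr_gt0; have [_ _] := htau; apply. Qed.

Lemma sum_delta : \sum_p delta p = T - t.
Proof.
have [h0 hN _] := htau.
by rewrite /delta -(big_mkord xpredT (fun p => tau p.+1 - tau p)) telescope_sumr// h0 hN.
Qed.

Let cell_lt p : (p < N)%N -> 0 <= tau p < tau p.+1.
Proof.
move=> pN; have [_ _ h] := htau; rewrite h// andbT.
by have /andP[+ _] := partition_bounds (ltnW pN); exact: le_trans.
Qed.

Let cell_T p : (p < N)%N -> tau p.+1 <= T.
Proof. by move=> pN; have /andP[] := partition_bounds pN. Qed.

Let cmono p := mono W (tau p) (tau p.+1).

(* Markov-type factorisation: the increments over successive cells are
   independent of the past. *)
Lemma cells_integral_nat (A : nat -> seq 'I_m.+1) n : (n <= N)%N ->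
  [/\ meas_wrt (F (tau n)) (fun w => \prod_(p < n) cmono p (A p) w),
      P.-integrable setT (EFin \o (fun w => \prod_(p < n) cmono p (A p) w)) &
      \int[P]_w (\prod_(p < n) cmono p (A p) w) =
      \prod_(p < n) moment W (tau p) (tau p.+1) (A p)].
Proof.
have FB k : (k <= N)%N -> 0 <= tau k <= T.
  move=> kN; have /andP[h1 ->] := partition_bounds kN.
  by rewrite (le_trans t0).
elim: n => [|n IH] nN.
  have sA := (hF.1 _ (FB _ nN)).1.
  have E : (fun w => \prod_(p < 0) cmono p (A p) w) = cst (1 : R).
    by apply/funext => w; rewrite big_ord0.
  rewrite E big_ord0 Rintegral_cst// (congr1 fine (probability_setT P)) mulr1; split => //.
    exact: meas_wrt_cst.
  exact: finite_measure_integrable_cst.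
have [IH1 IH2 IH3] := IH (ltnW nN).
have E : (fun w => \prod_(p < n.+1) cmono p (A p) w) =
    fun w => (\prod_(p < n) cmono p (A p) w) * cmono n (A n) w.
  by apply/funext => w; rewrite big_ord_recr.
have FS := FB _ nN; have Fn := FB _ (ltnW nN).
have sA := (hF.1 _ FS).1.
have mG : meas_wrt (sigma_increment W (tau n) (tau n.+1)) (cmono n (A n)).
  apply: meas_wrt_prod; first exact: sigma_increment_algebra.
  by move=> i; exact: incr_sigma_increment.
have iG := integrable_mono hW (cell_lt nN) (cell_T nN) (A n).
have [h1 h2] := indep_integral (hF.1 _ Fn).2 (@sigma_increment_sub _ _ _ _ _ W _ _)
  (wiener_indep_past hW (cell_lt nN) (cell_T nN)) IH1 mG IH2 iG.
rewrite E; split => //; last by rewrite h2 IH3 big_ord_recr.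
apply: meas_wrtM => //.
  apply: meas_wrt_sub IH1; apply: hF.2; last by case/andP: FS.
  by have /andP[-> /ltW ->] := cell_lt nN.
apply: meas_wrt_prod => // i; apply: (incr_F hF hW).
  by have /andP[-> /ltW ->] := cell_lt nN.
by rewrite lexx; case/andP: FS.
Qed.

Lemma cells_integral (A : 'I_N -> seq 'I_m.+1) :
  P.-integrable setT (EFin \o (fun w => \prod_(p < N) cmono p (A p) w)) /\
  \int[P]_w (\prod_(p < N) cmono p (A p) w) = \prod_(p < N) moment W (tau p) (tau p.+1) (A p).
Proof.
pose A' n := oapp A [::] (insub n).
have AE (p : 'I_N) : A' p = A p by rewrite /A' valK.
have [_ h1 h2] := @cells_integral_nat A' N (leqnn N).
have E : (fun w => \prod_(p < N) cmono p (A' p) w) = (fun w => \prod_(p < N) cmono p (A p) w).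
  by apply/funext => w; apply: eq_bigr => p _; rewrite AE.
rewrite E in h1 h2; split => //.
by rewrite h2; apply: eq_bigr => p _; rewrite AE.
Qed.

Lemma mono_cat p (l l' : seq 'I_m.+1) w :
  cmono p (l ++ l') w = cmono p l w * cmono p l' w.
Proof. by rewrite /cmono /mono big_cat. Qed.

Section families.
Variables (n : nat) (i : 'I_n -> 'I_m.+1).

(** Components are listed with multiplicity, since the moment and the leading part of a cell depend
    on how often each occurs. *)
Definition fiber (j : {ffun 'I_n -> 'I_N}) (p : 'I_N) : seq 'I_m.+1 :=
  [seq i l | l <- enum 'I_n & j l == p].

Lemma size_fiber j p : (size (fiber j p) <= n)%N.
Proof.
by rewrite size_map size_filter (leq_trans (count_size _ _))// size_enum_ord.
Qed.

Lemma fiber_eq0 j p : (fiber j p == [::]) = (p \notin im j).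
Proof.
apply/eqP/idP => [E|pj].
  apply/imsetP => -[l _ pE].
  have : i l \in fiber j p by apply: map_f; rewrite mem_filter pE eqxx mem_enum.
  by rewrite E.
case E : (fiber j p) => [//|x s].
have : x \in fiber j p by rewrite E mem_head.
case/mapP => l; rewrite mem_filter => /andP[/eqP lp _] _.
by move: pj; rewrite -lp mem_im.
Qed.

Definition incr_prod (j : {ffun 'I_n -> 'I_N}) (w : Omega) : R :=
  \prod_(l < n) incr W (i l) (tau (j l)) (tau (j l).+1) w.

Lemma incr_prodE j w : incr_prod j w = \prod_(p < N) cmono p (fiber j p) w.
Proof.
rewrite /incr_prod (partition_big (fun l => j l) xpredT)//=.
apply: eq_bigr => p _; rewrite /cmono /mono /fiber big_map big_filter.
rewrite [RHS]big_enum_cond /=.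
by apply: eq_bigr => l /eqP ->.
Qed.

(* The leading part of a cell: a single increment is kept, the product of two
   increments becomes their quadratic covariation, and longer products vanish. *)
Definition lead (p : 'I_N) (l : seq 'I_m.+1) : R * seq 'I_m.+1 :=
  match l with
  | [::] => (1, [::])
  | [:: a] => (1, [:: a])
  | [:: a; b] => (if (a == b) && (a != ord0) then delta p else 0, [::])
  | _ => (0, [::])
  end.

Definition lead_prod (j : {ffun 'I_n -> 'I_N}) (w : Omega) : R :=
  \prod_(p < N) ((lead p (fiber j p)).1 * cmono p (lead p (fiber j p)).2 w).

End families.

Let prodM (a b : 'I_N -> R) (A B : 'I_N -> seq 'I_m.+1) :
  P.-integrable setT (EFin \o (fun w =>
    \prod_(p < N) (a p * cmono p (A p) w) * \prod_(p < N) (b p * cmono p (B p) w))) /\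
  \int[P]_w (\prod_(p < N) (a p * cmono p (A p) w) * \prod_(p < N) (b p * cmono p (B p) w)) =
  \prod_(p < N) (a p * b p * moment W (tau p) (tau p.+1) (A p ++ B p)).
Proof.
have E : (fun w => \prod_(p < N) (a p * cmono p (A p) w) * \prod_(p < N) (b p * cmono p (B p) w)) =
    fun w => (\prod_(p < N) (a p * b p)) * (\prod_(p < N) cmono p (A p ++ B p) w).
  apply/funext => w; rewrite -big_split -big_split /=; apply: eq_bigr => p _.
  by rewrite mono_cat; ring.
have [h1 h2] := cells_integral (fun p => A p ++ B p).
rewrite E; split; first exact: integrableZ.
by rewrite RintegralZl// h2 -big_split.
Qed.

Variable D : R.
Hypothesis D1 : 1 <= D.
Hypothesis TD : T - t <= D.
Variable e : R.
Hypothesis de : forall p, Num.sqrt (delta p) <= e.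

Let D0 : 0 <= D. Proof. exact: le_trans D1. Qed.

Lemma delta_le p : delta p <= D.
Proof.
apply: le_trans TD; rewrite -sum_delta (bigD1 p)//= lerDl.
by apply: sumr_ge0 => q _; exact: ltW (delta_gt0 q).
Qed.

(** A sum of nonnegative terms dominates the bounds for all sizes up to [n] at once; the powers of
    [D] absorb the surplus square roots of the length. *)
Definition moment_const n : R :=
  1 + \sum_(c < n.+1) (1 + c%:R * moment_bound D c) * D ^+ c.

Let bound_ge0 c : 0 <= 1 + c%:R * moment_bound D c.
Proof. by rewrite addr_ge0// mulr_ge0// addr_ge0// ?exprn_ge0// !mulr_ge0// exprn_ge0. Qed.

Lemma moment_const_ge1 n : 1 <= moment_const n.
Proof.
by rewrite /moment_const lerDl; apply: sumr_ge0 => c _; rewrite mulr_ge0// exprn_ge0.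
Qed.

Let r p := Num.sqrt (delta p).
Let r0 p : 0 <= r p. Proof. exact: sqrtr_ge0. Qed.
Let rr p : r p ^+ 2 = delta p.
Proof. by rewrite sqr_sqrtr// ltW// delta_gt0. Qed.
Let rD p : r p <= D.
Proof.
rewrite -[D]ger0_norm// -sqrtr_sqr ler_sqrt; last by rewrite exprn_ge0.
by apply: le_trans (delta_le p) _; rewrite expr2 ler_peMl.
Qed.
Let e0 (p : 'I_N) : 0 <= e. Proof. exact: le_trans (r0 p) (de p). Qed.

Let term_le n c : (c <= n)%N ->
  (1 + c%:R * moment_bound D c) * D ^+ c <= moment_const n.
Proof.
move=> cn; rewrite /moment_const (bigD1 (Ordinal (cn : (c < n.+1)%N)))//= addrCA lerDl.
by rewrite addr_ge0//; apply: sumr_ge0 => k _; rewrite mulr_ge0// exprn_ge0.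
Qed.

(** For one increment the exact mean is used, as the size bound would give only the square root of
    the length. Two increments give the length itself, and from three on a further square root is at
    most [e]. *)
Lemma moment_bound_gen (p : 'I_N) n l : (0 < size l <= n)%N ->
  `|moment W (tau p) (tau p.+1) l| <= moment_const n * delta p /\
  ((3 <= size l)%N -> `|moment W (tau p) (tau p.+1) l| <= moment_const n * (e * delta p)).
Proof.
move=> /andP[l0 ln]; have pN := ltn_ord p.
have dp0 := ltW (delta_gt0 p).
have M1 := moment_const_ge1 n.
have h := moment_le hW (cell_lt pN) (cell_T pN) l (delta_le p).
rewrite -/(r p) in h.
have K := term_le ln.
have K0 := bound_ge0 (size l).
case: l l0 ln h K K0 => // a [|b l] _ ln h K K0.
  split => //; rewrite (moment1 hW (cell_lt pN) (cell_T pN)).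
  case: ifP => _; last by rewrite normr0 mulr_ge0// (le_trans _ M1).
  by rewrite ger0_norm// ler_peMl.
have E2 : r p ^+ size [:: a, b & l] = delta p * r p ^+ size l.
  by rewrite /= -[(size l).+2]/(2 + size l)%N exprD rr.
have sl : r p ^+ size l <= D ^+ size [:: a, b & l].
  rewrite (@le_trans _ _ (D ^+ size l))//; first by rewrite lerXn2r ?nnegrE.
  by rewrite ler_weXn2l//= leqW.
split.
  apply: le_trans h _; rewrite E2 [leRHS]mulrC -mulrA ler_wpM2l//.
  by apply: le_trans K; rewrite mulrC ler_wpM2l.
move=> /=; case: l ln h K K0 E2 sl => // x l ln h K K0 E2 sl _.
apply: le_trans h _; rewrite E2 [leRHS]mulrC (mulrC e) -!mulrA ler_wpM2l//=.
rewrite exprS -mulrA; apply: ler_pM => //; [by rewrite mulr_ge0// exprn_ge0|exact: de|].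
apply: le_trans K; rewrite mulrC ler_wpM2l//.
rewrite (@le_trans _ _ (D ^+ size l))//; first by rewrite lerXn2r ?nnegrE.
by rewrite ler_weXn2l//= !leqW.
Qed.

(** The flag selects the full product or its leading part, so that all covariances occurring in the
    error are instances of [lead_moment]. *)
Definition lead_if (b : bool) p (l : seq 'I_m.+1) : R * seq 'I_m.+1 :=
  if b then lead p l else (1, l).

Lemma lead_if_fst b p l : 0 <= (lead_if b p l).1 <= D.
Proof.
have d0 := ltW (delta_gt0 p); have dD := delta_le p.
rewrite /lead_if; case: b; last by rewrite ler01.
case: l => [|a [|a' [|a'' l]]] /=; rewrite ?ler01 ?lexx//.
by case: ifP; rewrite ?d0 ?lexx.
Qed.

Lemma lead_if_size b p l : (size (lead_if b p l).2 <= size l)%N.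
Proof. by case: b => //; case: l => [|a [|a' [|a'' l]]]. Qed.

Definition lead_moment b b' p l l' : R :=
  (lead_if b p l).1 * (lead_if b' p l').1 *
  moment W (tau p) (tau p.+1) ((lead_if b p l).2 ++ (lead_if b' p l').2).

(** [D ^+ 2] bounds the two leading coefficients, [n + n] is the largest size of the concatenated
    lists, and 2 allows for a difference of two moments. *)
Definition lead_const n : R := 2 * moment_const (n + n) * D ^+ 2.

Lemma lead_const_ge1 n : 1 <= lead_const n.
Proof.
have M1 := moment_const_ge1 (n + n).
rewrite /lead_const -[leLHS]mul1r; apply: ler_pM => //; last first.
  by rewrite -[leLHS](expr1n _ 2) lerXn2r ?nnegrE.
by rewrite -[leLHS]mul1r; apply: ler_pM => //; rewrite ler1n.
Qed.

(** If increments survive in the concatenated list, their moment supplies the factor [delta p].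
    Otherwise some nonempty list was replaced by its leading coefficient alone, which is [delta p]
    or 0. *)
Lemma lead_moment_le b b' p n l l' : (size l <= n)%N -> (size l' <= n)%N ->
  (l != [::]) || (l' != [::]) ->
  `|lead_moment b b' p l l'| <= lead_const n * delta p.
Proof.
move=> ln ln' ll'.
have d0 := ltW (delta_gt0 p); have dD := delta_le p.
have M1 := moment_const_ge1 (n + n).
have M0 : 0 <= moment_const (n + n) by exact: le_trans M1.
have /andP[a0 aD] := lead_if_fst b p l; have /andP[a0' aD'] := lead_if_fst b' p l'.
have s := lead_if_size b p l; have s' := lead_if_size b' p l'.
rewrite /lead_moment normrM ger0_norm ?mulr_ge0//.
have -> : lead_const n * delta p =
    2 * (D ^+ 2 * (moment_const (n + n) * delta p)) by rewrite /lead_const; ring.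
have Z : 0 <= D ^+ 2 * (moment_const (n + n) * delta p).
  by rewrite !mulr_ge0.
apply: (@le_trans _ _ (D ^+ 2 * (moment_const (n + n) * delta p))); last by lra.
set A := (lead_if b p l).2 ++ _.
case: (posnP (size A)) => A0; last first.
  have A1 : (0 < size A <= n + n)%N.
    by rewrite A0 size_cat leq_add ?(leq_trans s) ?(leq_trans s').
  have [h _] := moment_bound_gen p A1.
  by apply: ler_pM => //; rewrite ?mulr_ge0// expr2; apply: ler_pM.
have A_nil : A = [::] by apply: size0nil.
rewrite A_nil moment0 normr1 mulr1.
have nil1 c l0 : l0 != [::] -> (lead_if c p l0).2 = [::] -> (lead_if c p l0).1 <= delta p.
  rewrite /lead_if; case: c => /=; last by case: l0.
  by case: l0 => [|x [|y [|z l0]]]//= _ _; case: ifP.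
move: A_nil; rewrite /A; case E : (lead_if b p l).2 => [|//] /= E'.
rewrite (@le_trans _ _ (D * delta p))//.
  case/orP: ll' => [/nil1/(_ E) h|/nil1/(_ E') h]; last exact: ler_pM.
  by rewrite mulrC; apply: ler_pM.
apply: ler_pM => //; first by rewrite expr2 ler_peMl.
by rewrite ler_peMl.
Qed.

(** At most one increment is its own leading part, and for three or more the leading part is 0 while
    the moment is already small. Only a pair calls for the exact second moment. *)
Lemma lead_moment_diff b p n l l' : (size l <= n)%N -> (size l' <= n)%N ->
  `|lead_moment b false p l l' - lead_moment b true p l l'| <=
  e * (lead_const n * delta p).
Proof.
move=> ln ln'.
have d0 := ltW (delta_gt0 p); have dD := delta_le p.
have M1 := moment_const_ge1 (n + n).
have M0 : 0 <= moment_const (n + n) by exact: le_trans M1.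
have /andP[a0 aD] := lead_if_fst b p l.
have s := leq_trans (lead_if_size b p l) ln.
rewrite /lead_moment /= mulr1 -mulrA -mulrBr normrM ger0_norm//.
move: (lead_if b p l).1 a0 aD => al a0 aD; move: (lead_if b p l).2 s => S Sn {ln l}.
set C := moment_const (n + n) in M1 M0 *.
have eD := e0 p; have de' : delta p <= e * D.
  by rewrite -rr expr2; apply: ler_pM => //; exact: de.
have -> : e * (lead_const n * delta p) = D * (2 * D * (C * (e * delta p))).
  by rewrite /lead_const -/C; ring.
have X0 : 0 <= C * (e * delta p) by rewrite !mulr_ge0.
have YX : C * (e * delta p) <= D * (C * (e * delta p)) by rewrite ler_peMl.
apply: ler_pM => //.
have big3 l0 : (2 < size l0 <= n + n)%N ->
   `|moment W (tau p) (tau p.+1) l0| <= C * (e * delta p).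
  move=> /andP[l3 ln]; apply: (moment_bound_gen p _).2 => //.
  by rewrite ln (ltn_trans _ l3).
have nn k : (k <= n)%N -> (size S + k <= n + n)%N by move=> kn; rewrite leq_add.
case: l' ln' => [|x [|y [|z l']]] ln' /=.
- by rewrite mul1r subrr normr0; lra.
- by rewrite mul1r subrr normr0; lra.
(* If nothing is left of the first list, [moment2] equals the leading part except for two time
   increments, where [delta p ^+ 2] is small. Otherwise both terms are small separately: one has at
   least three increments, the other a factor [delta p] from the pair and one from the moment of
   [c :: S]. *)
- rewrite cats0; case: S Sn nn => [|c S] Sn nn /=.
    rewrite moment0 mulr1 (moment2 hW (cell_lt (ltn_ord p)) (cell_T (ltn_ord p))).
    rewrite -/(delta p); case: (x == y); last by rewrite subrr normr0; lra.
    case: (x == ord0); last by rewrite subrr normr0; lra.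
    rewrite subr0 ger0_norm ?exprn_ge0// expr2.
    apply: (@le_trans _ _ (D * (e * delta p))).
      by rewrite mulrA (mulrC D); exact: ler_wpM2r.
    apply: (@le_trans _ _ (D * (C * (e * delta p)))); last by lra.
    by rewrite ler_wpM2l// ler_peMl// mulr_ge0.
  apply: le_trans (ler_normB _ _) _; rewrite normrM.
  have h1 : `|moment W (tau p) (tau p.+1) (c :: S ++ [:: x; y])| <= C * (e * delta p).
    have nn2 := nn 2%N ln'; apply: big3.
    by rewrite -cat_cons size_cat nn2 andbT /= addSn addn2.
  have c1 : (0 < size (c :: S) <= n + n)%N by rewrite /= (leq_trans Sn)// leq_addr.
  have [h2 _] := moment_bound_gen p c1.
  have h3 : `|if (x == y) && (x != ord0) then delta p else 0| <= delta p.
    by case: ifP => _; rewrite ?normr0// ger0_norm.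
  have h4 : `|if (x == y) && (x != ord0) then delta p else 0| *
     `|moment W (tau p) (tau p.+1) (c :: S)| <= D * (C * (e * delta p)).
    apply: (@le_trans _ _ (delta p * (C * delta p))); first exact: ler_pM.
    rewrite mulrCA [leRHS]mulrCA ler_wpM2l//; rewrite mulrA ler_wpM2r//.
    by rewrite mulrC.
  lra.
- rewrite mul0r subr0; apply: (@le_trans _ _ (C * (e * delta p))); last by lra.
  by apply: big3; rewrite size_cat nn ?andbT//= !addnS.
Qed.

Section families_bounds.
Variables (n : nat) (i : 'I_n -> 'I_m.+1) (c : {ffun 'I_n -> 'I_N} -> R).

Let G b (j : {ffun 'I_n -> 'I_N}) w := \prod_(p < N)
  ((lead_if b p (fiber i j p)).1 * cmono p (lead_if b p (fiber i j p)).2 w).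

Let GF j w : G false j w = incr_prod i j w.
Proof. by rewrite incr_prodE; apply: eq_bigr => p _; rewrite mul1r. Qed.

Let GT j w : G true j w = lead_prod i j w. Proof. by []. Qed.

Let iG b b' j j' : P.-integrable setT (EFin \o (fun w => G b j w * G b' j' w)) /\
  \int[P]_w (G b j w * G b' j' w) =
  \prod_(p in im j :|: im j') lead_moment b b' p (fiber i j p) (fiber i j' p).
Proof.
have [h1 h2] := prodM (fun p => (lead_if b p (fiber i j p)).1)
  (fun p => (lead_if b' p (fiber i j' p)).1)
  (fun p => (lead_if b p (fiber i j p)).2) (fun p => (lead_if b' p (fiber i j' p)).2).
split => //; rewrite h2 [RHS]big_mkcond /=; apply: eq_bigr => p _.
case: ifPn => //; rewrite inE negb_or -!(fiber_eq0 i) => /andP[/eqP -> /eqP ->].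
have L a : lead_if a p [::] = (1, [::]) by case: a.
by rewrite !L /= !mul1r moment0.
Qed.

Let C := lead_const n.
Let C1 : 1 <= C. Proof. exact: lead_const_ge1. Qed.
Let C0 : 0 <= C. Proof. exact: le_trans C1. Qed.

Let cardU (j j' : {ffun 'I_n -> 'I_N}) : (#|im j :|: im j'| <= n + n)%N.
Proof.
by rewrite (leq_trans _ (leq_add (card_im j) (card_im j')))// cardsU leq_subr.
Qed.

Let prod_le (j j' : {ffun 'I_n -> 'I_N}) :
  \prod_(p in im j :|: im j') (C * delta p) <= C ^+ (n + n) * wt2 delta j j'.
Proof.
rewrite big_split /= prodr_const ler_wpM2r ?ler_weXn2l//.
by apply: prodr_ge0 => p _; exact: ltW (delta_gt0 p).
Qed.

Let mem_fiber j j' p : p \in im j :|: im j' ->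
  (fiber i j p != [::]) || (fiber i j' p != [::]).
Proof. by rewrite inE !fiber_eq0 !negbK. Qed.

Let d0 p : 0 <= delta p. Proof. exact: ltW (delta_gt0 p). Qed.

Let sum_delta_le : \sum_p delta p <= D. Proof. by rewrite sum_delta. Qed.

Lemma incr_sum_le :
  (\int[P]_w ((\sum_j c j * incr_prod i j w) ^+ 2)%:E <=
   (C ^+ (n + n) * (n%:R + n%:R + D) ^+ n *
    \sum_j c j ^+ 2 * wt delta finset.set0 j)%:E)%E.
Proof.
apply: sq_sum_le => //.
- move=> j j'; have [h _] := iG false false j j'.
  by move: h; congr (_.-integrable _ _); apply/funext => w /=; rewrite !GF.
- by rewrite exprn_ge0.
- move=> j j'; have [_ h] := iG false false j j'.
  under eq_Rintegral do rewrite -!GF.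
  rewrite h normr_prod; apply: le_trans (prod_le j j').
  apply: ler_prod => p /mem_fiber pj; rewrite normr_ge0.
  by apply: lead_moment_le => //; exact: size_fiber.
Qed.

(** The covariance of two errors is a difference of two differences, in each of which only the
    second factor passes to its leading part. [prod_diff_bound] over at most [n + n] cells then
    produces the factor [e]. *)
Lemma incr_lead_sum_le : 0 <= e ->
  (\int[P]_w ((\sum_j c j * (incr_prod i j w - lead_prod i j w)) ^+ 2)%:E <=
   (e * (2 * (n + n)%:R * C ^+ (n + n) * (n%:R + n%:R + D) ^+ n *
    \sum_j c j ^+ 2 * wt delta finset.set0 j))%:E)%E.
Proof.
move=> ep.
have E j j' w : (incr_prod i j w - lead_prod i j w) *
    (incr_prod i j' w - lead_prod i j' w) =
    (G false j w * G false j' w - G false j w * G true j' w) -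
    (G true j w * G false j' w - G true j w * G true j' w).
  by rewrite -!GF -!GT; ring.
have iE j j' : P.-integrable setT (EFin \o (fun w => (incr_prod i j w - lead_prod i j w) *
    (incr_prod i j' w - lead_prod i j' w))).
  under eq_fun do rewrite E.
  by apply: integrable_sub; apply: integrable_sub; exact: (iG _ _ _ _).1.
set kappa := e * (2 * (n + n)%:R * C ^+ (n + n)).
have -> : e * (2 * (n + n)%:R * C ^+ (n + n) * (n%:R + n%:R + D) ^+ n *
    \sum_j c j ^+ 2 * wt delta finset.set0 j) =
    kappa * (n%:R + n%:R + D) ^+ n * \sum_j c j ^+ 2 * wt delta finset.set0 j.
  by rewrite /kappa; ring.
apply: sq_sum_le => //.
  by rewrite /kappa !mulr_ge0// exprn_ge0.
move=> j j'; under eq_Rintegral do rewrite E.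
rewrite RintegralB//; last 2 first.
- by apply: integrable_sub; exact: (iG _ _ _ _).1.
- by apply: integrable_sub; exact: (iG _ _ _ _).1.
rewrite !RintegralB//; do ?exact: (iG _ _ _ _).1.
rewrite !(iG _ _ _ _).2.
have key b : `|\prod_(p in im j :|: im j') lead_moment b false p (fiber i j p) (fiber i j' p) -
    \prod_(p in im j :|: im j') lead_moment b true p (fiber i j p) (fiber i j' p)| <=
    (n + n)%:R * e * (C ^+ (n + n) * wt2 delta j j').
  apply: le_trans (prod_diff_bound (u := fun p => C * delta p) (e := e) _ _ _) _.
  - by move=> p /mem_fiber pj; apply: lead_moment_le => //; exact: size_fiber.
  - by move=> p /mem_fiber pj; apply: lead_moment_le => //; exact: size_fiber.
  - by move=> p _; apply: lead_moment_diff; exact: size_fiber.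
  apply: ler_pM => //; first by rewrite mulr_ge0.
    by apply: prodr_ge0 => p _; rewrite mulr_ge0.
  by rewrite ler_wpM2r// ler_nat cardU.
apply: le_trans (ler_normB _ _) _; apply: le_trans (lerD (key _) (key _)) _.
by rewrite /kappa le_eqVlt; apply/orP; left; apply/eqP; ring.
Qed.

End families_bounds.

End cells.

(** * Integrals over the cube *)

Section lebesgue_boxes.
Context (R : realType).
Local Open Scope ereal_scope.
Local Notation RT := (measurableTypeR R).

Definition box n (A : 'I_n -> set R) : set (n.-tuple RT) :=
  [set v | forall l, A l (tnth v l)].

Lemma measurable_box n (A : 'I_n -> set R) : (forall l, measurable (A l)) ->
  measurable (box A).
Proof.
move=> mA.
have -> : box A = \bigcap_(l in [set: 'I_n]) ((@tnth n RT)^~ l @^-1` A l).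
  by apply/seteqP; split=> v h l => [_|]; exact: h.
apply: fin_bigcap_measurable => // l _.
rewrite -[X in measurable X]setTI.
by apply: (@measurable_tnth _ RT n l) => //; exact: mA.
Qed.

Lemma lebesgue_tuple_box n (A : 'I_n -> set R) : (forall l, measurable (A l)) ->
  lebesgue_tuple R n (box A) = \prod_(l < n) lebesgue_measure (A l : set RT).
Proof.
elim: n A => [|n IH] A mA.
  rewrite big_ord0 /lebesgue_tuple /= diracE mem_set//.
  by move=> -[].
have mA' := measurable_box (fun l => mA (lift ord0 l)).
rewrite big_ord_recl -(IH (fun l => A (lift ord0 l)))//.
rewrite /lebesgue_tuple /= /cons_measure /pushforward.
rewrite (_ : cons_pair (n:=n) @^-1` box A = (A ord0 : set RT) `*` box (fun l => A (lift ord0 l))).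
  by rewrite product_measure1E//; exact: mA.
apply/seteqP; split => -[x v] /= h.
  split; first by have := h ord0; rewrite (tnth_nth 0%R).
  by move=> l; have := h (lift ord0 l); rewrite !(tnth_nth 0%R).
move=> l; case: (unliftP ord0 l) h => [l'|] -> [/= h1 h2].
  by have := h2 l'; rewrite !(tnth_nth 0%R).
by rewrite (tnth_nth 0%R).
Qed.

End lebesgue_boxes.

(** Used to discard the faces by which cells closed at [T] exceed the half-open cells of
    [step_fun]. *)
Lemma ge0_integral_setD0 d (X : measurableType d) (R : realType)
    (mu : {measure set X -> \bar R}) (A B : set X) (f : X -> \bar R) :
  measurable A -> measurable B -> B `<=` A -> mu A = mu B -> (mu A < +oo)%E ->
  measurable_fun A f -> (forall x, A x -> 0 <= f x)%E ->
  (\int[mu]_(x in A) f x = \int[mu]_(x in B) f x)%E.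
Proof.
move=> mA mB BA AB Aoo mf f0.
have D0 : mu (A `\` B) = 0%E.
  have -> : mu (A `\` B) = (mu A - mu A)%E.
    by rewrite measureD// (setIidr BA); congr (_ - _)%E; exact/esym.
  by rewrite subee// ge0_fin_numE.
rewrite (ge0_negligible_integral (measurableD mA mB) mA mf f0 D0).
by rewrite setDD (setIidr BA).
Qed.

Section grid.
Context (R : realType) (t T : R) (N : nat) (tau : nat -> R).
Hypothesis htT : t < T.
Hypothesis htau : is_partition t T N tau.
Local Notation RT := (measurableTypeR R).
Local Notation delta := (@delta R N tau).

(** Closing the last cell makes the cells partition all of [t, T]; the half-open [cello], used by
    [step_fun], miss the point [T]. *)
Definition cellc (p : 'I_N) : set R :=
  [set x | tau p <= x /\ (if p.+1 == N then x <= tau p.+1 else x < tau p.+1)].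

Definition cello (p : 'I_N) : set R := `[tau p, tau p.+1[%classic.

Lemma cello_sub p : cello p `<=` cellc p.
Proof.
move=> x; rewrite /cello /cellc /= in_itv /= => /andP[-> xp]; split => //.
by case: ifP => // _; exact: ltW.
Qed.

Lemma measurable_cello p : measurable (cello p).
Proof. exact: measurable_itv. Qed.

Lemma cellcE p : cellc p = if p.+1 == N then `[tau p, tau p.+1]%classic else cello p.
Proof.
rewrite /cellc /cello; case: ifP => _; apply/seteqP; split => x /=;
  by rewrite in_itv /= => /andP.
Qed.

Lemma measurable_cellc p : measurable (cellc p).
Proof. by rewrite cellcE; case: ifP => _; [exact: measurable_itv|exact: measurable_cello]. Qed.

Lemma lebesgue_cello p : (lebesgue_measure (cello p : set RT) = (delta p)%:E)%E.
Proof.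
rewrite /cello lebesgue_measure_itv /= lte_fin.
by have := delta_gt0 htau p; rewrite subr_gt0 => ->; rewrite -EFinB.
Qed.

Lemma lebesgue_cellc p : (lebesgue_measure (cellc p : set RT) = (delta p)%:E)%E.
Proof.
rewrite cellcE; case: ifP => _; last exact: lebesgue_cello.
rewrite lebesgue_measure_itv /= lte_fin.
by have := delta_gt0 htau p; rewrite subr_gt0 => ->; rewrite -EFinB.
Qed.

Lemma cellc_bounds p x : cellc p x -> tau p <= x <= tau p.+1.
Proof. by rewrite /cellc /= => -[-> ]; case: ifP => // _ /ltW ->. Qed.

Lemma cellc_dist p x : cellc p x -> `|x - tau p| <= delta p.
Proof.
move=> /cellc_bounds/andP[h1 h2]; rewrite ger0_norm ?subr_ge0//.
by rewrite lerD2r.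
Qed.

Lemma cellc_in p x : cellc p x -> t <= x <= T.
Proof.
move=> /cellc_bounds/andP[h1 h2].
have /andP[a1 _] := partition_bounds htau (ltnW (ltn_ord p)).
have /andP[_ a2] := partition_bounds htau (ltn_ord p).
by rewrite (le_trans a1 h1) (le_trans h2 a2).
Qed.

Lemma cellc_disj p q x : cellc p x -> cellc q x -> p = q.
Proof.
wlog pq : p q / (p <= q)%N.
  by move=> h hp hq; case: (leqP p q) => [|/ltnW] pq; [exact: h|apply/esym; exact: h].
move=> hp hq; apply/val_inj/eqP; rewrite eqn_leq pq /= leqNgt; apply/negP => pltq.
move: hp => [_]; rewrite (_ : (p.+1 == N) = false); last first.
  by apply/negbTE; rewrite neq_ltn (leq_ltn_trans pltq (ltn_ord q)).
have /andP[hq1 _] := cellc_bounds hq.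
have := partition_le htau (_ : (p.+1 <= q <= N)%N).
rewrite pltq (ltnW (ltn_ord q)) => /(_ isT) h; rewrite ltNge.
by rewrite (le_trans h hq1).
Qed.

Lemma cellc_cover x : t <= x <= T -> exists p, cellc p x.
Proof.
move=> /andP[tx xT].
have [h0 hN hlt] := htau.
have N0 : (0 < N)%N.
  by rewrite lt0n; apply/eqP => N0; move: htT; rewrite -h0 -hN N0 ltxx.
pose Q k := (k < N)%N && (tau k <= x).
have exQ : exists k, Q k by exists 0%N; rewrite /Q N0 h0.
have ubQ k : Q k -> (k <= N)%N by move=> /andP[/ltnW].
case: (ex_maxnP exQ ubQ) => k /andP[kN kx] kmax.
exists (Ordinal kN); split => //=.
case: eqP => [->|/eqP kN']; first by rewrite hN.
rewrite ltNge; apply/negP => kx'.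
have := kmax k.+1; rewrite /Q kx' andbT ltn_neqAle kN' kN => /(_ isT).
by rewrite ltnn.
Qed.

Definition cellsc n (j : {ffun 'I_n -> 'I_N}) := box (fun l => cellc (j l)).
Definition cellso n (j : {ffun 'I_n -> 'I_N}) := box (fun l => cello (j l)).

Section dim.
Variable n : nat.
Implicit Types j : {ffun 'I_n -> 'I_N}.

Definition tcube : set (n.-tuple RT) := @row_of_tuple R n @^-1` cube t T n.

Lemma tcubeE : tcube = box (fun=> `[t, T]%classic).
Proof.
by apply/seteqP; split => v /= h l; have := h l; rewrite ?in_itv /= ?mxE.
Qed.

Lemma measurable_tcube : measurable tcube.
Proof. by rewrite tcubeE; apply: measurable_box => l; exact: measurable_itv. Qed.

Lemma measurable_cellsc j : measurable (cellsc j).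
Proof. by apply: measurable_box => l; exact: measurable_cellc. Qed.

Lemma measurable_cellso j : measurable (cellso j).
Proof. by apply: measurable_box => l; exact: measurable_cello. Qed.

Definition vol j : R := \prod_(l < n) delta (j l).

Lemma vol_ge0 j : 0 <= vol j.
Proof. by apply: prodr_ge0 => l _; exact: ltW (delta_gt0 htau _). Qed.

Lemma lebesgue_cellsc j : lebesgue_tuple R n (cellsc j) = (vol j)%:E.
Proof.
rewrite lebesgue_tuple_box; last by move=> l; exact: measurable_cellc.
by rewrite -prodEFin; apply: eq_bigr => l _; exact: lebesgue_cellc.
Qed.

Lemma lebesgue_cellso j : lebesgue_tuple R n (cellso j) = (vol j)%:E.
Proof.
rewrite lebesgue_tuple_box; last by move=> l; exact: measurable_cello.
by rewrite -prodEFin; apply: eq_bigr => l _; exact: lebesgue_cello.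
Qed.

Lemma cellso_sub j : cellso j `<=` cellsc j.
Proof. by move=> v h l; apply: cello_sub; exact: h. Qed.

Lemma cellsc_disj j j' v : cellsc j v -> cellsc j' v -> j = j'.
Proof. by move=> h h'; apply/ffunP => l; exact: (cellc_disj (h l) (h' l)). Qed.

Lemma cellsc_sub j : cellsc j `<=` tcube.
Proof. by move=> v h l; rewrite mxE; exact: cellc_in (h l). Qed.

Lemma tcube_cover v : tcube v -> exists j, cellsc j v.
Proof.
move=> h; have hl l : exists p, cellc p (tnth v l).
  by apply: cellc_cover; have := h l; rewrite mxE.
have [j hj] := choice hl.
by exists [ffun l => j l] => l; rewrite ffunE.
Qed.

Lemma tcube_bigcup : tcube = \big[setU/set0]_(j <- index_enum {ffun 'I_n -> 'I_N}) cellsc j.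
Proof.
apply/seteqP; split => v.
  move=> /tcube_cover[j jv]; rewrite -bigcup_seq; exists j => //.
  by rewrite /= mem_index_enum.
by rewrite -bigcup_seq => -[j _ /cellsc_sub].
Qed.

(** The cube is the disjoint union of the [cellsc]; each is then replaced by [cellso], of the same
    volume, on which step functions are constant. *)
Lemma ge0_integral_cells (f : n.-tuple RT -> \bar R) :
  measurable_fun tcube f -> (forall v, tcube v -> 0 <= f v)%E ->
  (\int[lebesgue_tuple R n]_(v in tcube) f v =
   \sum_j \int[lebesgue_tuple R n]_(v in cellso j) f v)%E.
Proof.
move=> mf f0; rewrite tcube_bigcup in mf f0 *.
rewrite ge0_integral_bigsetU//; last 3 first.
- by move=> j; exact: measurable_cellsc.
- exact: index_enum_uniq.
- by move=> j j' _ _ [v [h h']]; exact: cellsc_disj h h'.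
apply: eq_bigr => j _.
have sub : cellsc j `<=` \big[setU/set0]_(j <- index_enum {ffun 'I_n -> 'I_N}) cellsc j.
  by move=> v jv; rewrite -bigcup_seq; exists j => //=; rewrite mem_index_enum.
apply: ge0_integral_setD0 => //.
- exact: measurable_cellsc.
- exact: measurable_cellso.
- exact: cellso_sub.
- by rewrite /= lebesgue_cellsc lebesgue_cellso.
- by rewrite /= lebesgue_cellsc ltry.
- apply: measurable_funS mf => //; rewrite -tcube_bigcup; exact: measurable_tcube.
- by move=> v /sub; exact: f0.
Qed.

Lemma step_fun_cell a j v : cellso j v -> step_fun tau a (row_of_tuple v) = a j.
Proof.
move=> jv; rewrite /step_fun (bigD1 j)//= [X in _ + X]big1 ?addr0.
  rewrite big1 ?mulr1 ?addr0// => l _; rewrite indicE mem_set//= mxE.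
  exact: (jv l).
move=> j' /eqP j'j; have [h|/forallP] := boolP [forall l, row_of_tuple v ord0 l \in cello (j' l)].
  exfalso; apply: j'j; apply: (@cellsc_disj _ _ v); last exact: cellso_sub.
  apply: cellso_sub => l; move/forallP: h => /(_ l); rewrite inE mxE; exact.
move=> h; have [l hl] : exists l, row_of_tuple v ord0 l \notin cello (j' l).
  by apply/existsP; rewrite -negb_forall; apply/forallP.
by rewrite (bigD1 l)//= indicE (negbTE hl) mul0r mulr0.
Qed.

Lemma measurable_step_fun (a : {ffun 'I_n -> 'I_N} -> R) :
  measurable_fun setT (fun v : n.-tuple RT => step_fun tau a (row_of_tuple v)).
Proof.
rewrite /step_fun; apply: measurable_sum => j; apply: measurable_funM => //.
apply: measurable_prod => l _.
rewrite (_ : (fun v => _) = (\1_(cello (j l)) : RT -> R) \o (fun v => tnth v l)).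
  apply: measurableT_comp; last exact: measurable_tnth.
  by apply: measurable_indic; exact: measurable_cello.
by apply/funext => v /=; rewrite mxE.
Qed.

Lemma cube_integral_step_sq a :
  (cube_integral t T (fun x => (step_fun tau a x ^+ 2)%:E) = (\sum_j a j ^+ 2 * vol j)%:E :> \bar R)%E.
Proof.
rewrite /cube_integral -/tcube ge0_integral_cells//; last 2 first.
- apply/measurable_EFinP/measurable_funX; apply: measurable_funTS.
  exact: measurable_step_fun.
- by move=> v _; rewrite lee_fin sqr_ge0.
rewrite -sumEFin; apply: eq_bigr => j _.
rewrite (eq_integral (fun=> (a j ^+ 2)%:E)); last first.
  by move=> v /[!inE] jv; rewrite (step_fun_cell _ jv).
rewrite integral_cst; last exact: measurable_cellso.
by rewrite [RHS]EFinM; congr (_ * _)%E; exact: lebesgue_cellso.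
Qed.

End dim.
End grid.

Lemma delta_le_mesh (R : realType) N (tau : nat -> R) (p : 'I_N) :
  delta tau p <= mesh N tau.
Proof.
by rewrite (le_trans (ler_norm _))// /mesh /delta (bigD1 p)//= le_max lexx.
Qed.

Section uniformly_continuous.
Context (R : realType) (t T : R).
Hypothesis htT : t < T.
Local Notation RT := (measurableTypeR R).

(** This form of the modulus is inherited when coordinates are identified, frozen or integrated out,
    and so passes to traces. *)
Definition ucont n (f : 'rV[R]_n -> R) := forall e : R, 0 < e -> exists2 dl : R, 0 < dl &
  forall x y, cube t T n x -> cube t T n y ->
    (forall l, `|x ord0 l - y ord0 l| < dl) -> `|f x - f y| <= e.

Section one_partition.
Variables (N : nat) (tau : nat -> R).
Hypothesis htau : is_partition t T N tau.
Variable n : nat.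
Implicit Types j : {ffun 'I_n -> 'I_N}.

Definition gridpt j : 'rV[R]_n := \row_l tau (j l).

Lemma gridpt_cube j : cube t T n (gridpt j).
Proof. by move=> l; rewrite mxE; apply: (partition_bounds htau); exact: ltnW (ltn_ord _). Qed.

Lemma gridpt_dist dl j v : (forall p : 'I_N, delta tau p < dl) -> cellsc tau j v ->
  forall l, `|row_of_tuple v ord0 l - gridpt j ord0 l| < dl.
Proof. by move=> h jv l; rewrite !mxE; exact: le_lt_trans (cellc_dist (jv l)) (h _). Qed.

(** Unlike [step_fun] it takes the intended value on the whole cube, also where a coordinate equals
    [T], so that it approximates at every point. *)
Definition cstep_fun (a : {ffun 'I_n -> 'I_N} -> R) (v : n.-tuple RT) : R :=
  \sum_j a j * \1_(cellsc tau j) v.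

Lemma cstep_fun_cell a j v : cellsc tau j v -> cstep_fun a v = a j.
Proof.
move=> jv; rewrite /cstep_fun (bigD1 j)//= indicE mem_set// mulr1 big1 ?addr0//.
move=> j' /eqP j'j; rewrite indicE memNset ?mulr0// => j'v.
exact: j'j (cellsc_disj htau j'v jv).
Qed.

Lemma measurable_cstep_fun a : measurable_fun setT (cstep_fun a).
Proof.
rewrite /cstep_fun; apply: measurable_sum => j; apply: measurable_funM => //.
by apply: measurable_indic; exact: measurable_cellsc.
Qed.

Lemma sum_vol : \sum_(j : {ffun 'I_n -> 'I_N}) vol tau j = (T - t) ^+ n.
Proof.
rewrite -(sum_delta htau) -[in RHS](card_ord n) -prodr_const bigA_distr_bigA /=.
by apply: eq_big => // j; apply/esym/ffun_onP.
Qed.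

Lemma lebesgue_tcube : lebesgue_tuple R n (@tcube R t T n) = ((T - t) ^+ n)%:E.
Proof.
rewrite tcubeE lebesgue_tuple_box; last by move=> l; exact: measurable_itv.
rewrite big_const_ord lebesgue_measure_itv /= lte_fin htT -EFinB.
by elim: n => //= k ->; rewrite exprS EFinM.
Qed.

Lemma tcube_lty : (lebesgue_tuple R n (@tcube R t T n) < +oo)%E.
Proof. by rewrite lebesgue_tcube ltry. Qed.

Variable f : 'rV[R]_n -> R.
Hypothesis mf : measurable_fun (@tcube R t T n) (f \o @row_of_tuple R n).

Lemma bounded_integrable (g : n.-tuple RT -> R) (M : R) :
  measurable_fun (@tcube R t T n) g -> (forall v, @tcube R t T n v -> `|g v| <= M) ->
  (lebesgue_tuple R n).-integrable (@tcube R t T n) (EFin \o g).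
Proof.
move=> mg gM; apply/integrableP; split; first exact/measurable_EFinP.
apply: (@le_lt_trans _ _ (\int[lebesgue_tuple R n]_(v in @tcube R t T n) (`|M|)%:E)%E).
  apply: ge0_le_integral => //.
  - exact: measurable_tcube.
  - by apply: measurableT_comp => //; exact/measurable_EFinP.
  - by move=> v hv; rewrite lee_fin (le_trans (gM v hv))// ler_norm.
rewrite integral_cst; last exact: measurable_tcube.
by rewrite lte_mul_pinfty ?lee_fin//; exact: tcube_lty.
Qed.

(** The Riemann sum is the integral of [cstep_fun] with the grid values, which stays within [e] of
    [f] on the cube. *)
Lemma riemann_sum_close (M e : R) : (forall x, cube t T n x -> `|f x| <= M) ->
  (forall j v, cellsc tau j v -> `|f (row_of_tuple v) - f (gridpt j)| <= e) ->
  `|fine (cube_integral t T (fun x => (f x)%:E)) - \sum_j f (gridpt j) * vol tau j|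
    <= e * (T - t) ^+ n.
Proof.
move=> fM hosc; have mC := @measurable_tcube R t T n.
have if_ : (lebesgue_tuple R n).-integrable (@tcube R t T n) (EFin \o (f \o @row_of_tuple R n)).
  by apply: (@bounded_integrable _ M) => // v hv; exact: fM.
set F := cstep_fun (fun j => f (gridpt j)).
have iF : (lebesgue_tuple R n).-integrable (@tcube R t T n) (EFin \o F).
  apply: (@bounded_integrable _ M).
    by apply: measurable_funTS; exact: measurable_cstep_fun.
  move=> v /(tcube_cover htT htau)[j jv]; rewrite /F (cstep_fun_cell _ jv).
  exact/fM/gridpt_cube.
have -> : \sum_j f (gridpt j) * vol tau j =
    \int[lebesgue_tuple R n]_(v in @tcube R t T n) F v.
  have iI j : (lebesgue_tuple R n).-integrable (@tcube R t T n)
      (EFin \o (fun v => f (gridpt j) * \1_(cellsc tau j) v)).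
    apply: (@bounded_integrable _ M).
      apply: measurable_funM => //; apply: measurable_indic; exact: measurable_cellsc.
    move=> v _; rewrite indicE; case: (_ \in _); rewrite ?mulr1 ?mulr0 ?normr0.
      exact/fM/gridpt_cube.
    by apply: le_trans (fM _ (gridpt_cube j)).
  rewrite /F /cstep_fun (Rintegral_sum mC _ iI).2; apply: eq_bigr => j _.
  rewrite RintegralZl//; last first.
    apply: (@bounded_integrable _ 1).
      apply: measurable_indic; exact: measurable_cellsc.
    by move=> v _; rewrite indicE; case: (_ \in _); rewrite ?normr1 ?normr0.
  congr (_ * _); rewrite /Rintegral integral_indic//; last exact: measurable_cellsc.
  rewrite setIidl; last exact: cellsc_sub.
  by rewrite [X in fine X](lebesgue_cellsc htau j).
rewrite /cube_integral -/(@tcube R t T n).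
have -> : fine (\int[lebesgue_tuple R n]_(v in @tcube R t T n) (f (row_of_tuple v))%:E) =
  \int[lebesgue_tuple R n]_(v in @tcube R t T n) (f \o @row_of_tuple R n) v by [].
rewrite -RintegralB//.
have iB : (lebesgue_tuple R n).-integrable (@tcube R t T n)
    (EFin \o (fun v => (f \o @row_of_tuple R n) v - F v)).
  exact: (@integrableB _ _ _ _ _ _ (EFin \o _) (EFin \o F)).
apply: le_trans (le_normr_Rintegral _ iB) _ => //.
have <- : \int[lebesgue_tuple R n]_(v in @tcube R t T n) cst e v = e * (T - t) ^+ n.
  by rewrite Rintegral_cst// [X in _ * fine X]lebesgue_tcube.
apply: le_Rintegral => //.
- exact: (integrable_norm iB).
- by apply: (@bounded_integrable _ `|e|).
- by move=> v /(tcube_cover htT htau)[j jv] /=; rewrite /F (cstep_fun_cell _ jv); exact: hosc.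
Qed.

(** The bound [b] depends on the cell because off the diagonals it will be an oscillation, and on
    them, where the coefficient vanishes, only the size of [f]. *)
Lemma L2_sqdist_step_le (a b : {ffun 'I_n -> 'I_N} -> R) :
  (forall j v, cellsc tau j v -> (a j - f (row_of_tuple v)) ^+ 2 <= b j) ->
  (L2_sqdist t T (step_fun tau a) f <= (\sum_j b j * vol tau j)%:E)%E.
Proof.
move=> hb; rewrite /L2_sqdist /cube_integral -/(@tcube R t T n).
have mg : measurable_fun (@tcube R t T n)
    (fun v => ((step_fun tau a (row_of_tuple v) - f (row_of_tuple v)) ^+ 2)%:E).
  apply: measurable_sqrB => //.
  by apply: measurable_funTS; exact: measurable_step_fun.
rewrite (ge0_integral_cells htT htau)//; last by move=> v _; rewrite lee_fin sqr_ge0.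
rewrite -sumEFin; apply: lee_sum => j _.
apply: (@le_trans _ _ (\int[lebesgue_tuple R n]_(v in cellso tau j) (b j)%:E)%E).
  apply: ge0_le_integral => //.
  - exact: measurable_cellso.
  - by move=> v _; rewrite lee_fin sqr_ge0.
  - apply: measurable_funS mg; first exact: measurable_tcube.
    by move=> v /cellso_sub; exact: cellsc_sub.
  - by move=> v jv; rewrite (step_fun_cell htau _ jv) lee_fin; exact/hb/cellso_sub.
rewrite integral_cst; last exact: measurable_cellso.
by rewrite [leRHS]EFinM [X in (_ * X <= _)%E](lebesgue_cellso htau j).
Qed.

End one_partition.

Section refining_partitions.
Variable tau : nat -> nat -> R.
Hypothesis htau : forall N, (0 < N)%N -> is_partition t T N (tau N).
Hypothesis hmesh : (fun N => mesh N (tau N)) @ \oo --> (0 : R).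

Lemma fine_mesh (dl : R) : 0 < dl -> exists N0, forall N, (N0 <= N)%N ->
  (0 < N)%N /\ mesh N (tau N) < dl.
Proof.
move=> dl0; have /cvgrPdist_lt/(_ _ dl0)[N0 _ HN] := hmesh.
exists N0.+1 => N NN; split; first exact: leq_ltn_trans NN.
have := HN N (ltnW NN); rewrite /= sub0r normrN.
exact: le_lt_trans (ler_norm _).
Qed.

Variables (n : nat) (f : 'rV[R]_n -> R).
Hypothesis uf : ucont f.

Lemma ucont_cell (e : R) : 0 < e -> exists N0, forall N, (N0 <= N)%N -> (0 < N)%N /\
  forall (j : {ffun 'I_n -> 'I_N}) v, cellsc (tau N) j v ->
    `|f (row_of_tuple v) - f (gridpt (tau N) j)| <= e.
Proof.
move=> e0; have [dl dl0 hdl] := uf e0; have [N0 HN0] := fine_mesh dl0.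
exists N0 => N /HN0[Np hN]; split=> // j v jv; apply: hdl.
- by have := cellsc_sub (htau Np) jv.
- exact: (gridpt_cube (htau Np)).
- apply: gridpt_dist jv => p.
  by apply: le_lt_trans hN; exact: delta_le_mesh.
Qed.

Lemma ucont_bounded : exists2 M : R, 0 <= M & forall x, cube t T n x -> `|f x| <= M.
Proof.
have [N0 HN] := ucont_cell ltr01; have [Np hN] := HN _ (leqnn _).
exists (\sum_(j : {ffun 'I_n -> 'I_N0}) `|f (gridpt (tau N0) j)| + 1).
  by rewrite addr_ge0// sumr_ge0.
move=> x hx; pose v : n.-tuple RT := [tuple x ord0 l | l < n].
have xv : row_of_tuple v = x by apply/rowP => l; rewrite mxE tnth_mktuple.
have [|j jv] := @tcube_cover _ _ _ _ _ htT (htau Np) n v; first by rewrite /tcube /= xv.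
have := hN j v jv; rewrite xv => h.
rewrite -[f x](subrK (f (gridpt (tau N0) j))) (le_trans (ler_normD _ _))// addrC lerD//.
by rewrite (bigD1 j)//= lerDl sumr_ge0.
Qed.

(** Measurability for the product sigma-algebra of tuples comes from pointwise approximation by
    [cstep_fun] along the given partitions. *)
Lemma ucont_measurable : measurable_fun (@tcube R t T n) (f \o @row_of_tuple R n).
Proof.
apply: (@measurable_fun_cvg _ _ _ _
  (fun N => cstep_fun (tau N) (fun j : {ffun 'I_n -> 'I_N} => f (gridpt (tau N) j)))).
  by move=> N; apply: measurable_funTS; exact: measurable_cstep_fun.
move=> v hv; apply/cvgrPdist_le => e e0.
have [N0 HN0] := ucont_cell e0; exists N0 => // N /= /HN0[Np hN].
have [j jv] := tcube_cover htT (htau Np) hv.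
by rewrite (cstep_fun_cell (htau Np) _ jv); exact: hN.
Qed.

End refining_partitions.
End uniformly_continuous.

(** * The multiple Wiener integral of a continuous function *)

Section refinement.
Context (R : realType) (t T : R).

(* [a] sends a cell boundary of [tau] to its position in the finer partition. *)
Definition refines N (tau : nat -> R) M (rho : nat -> R) (a : nat -> nat) :=
  [/\ forall p, (p <= N)%N -> tau p = rho (a p),
      forall p, (p <= N)%N -> (a p <= M)%N &
      forall p, (p < N)%N -> (a p < a p.+1)%N].

(** The points of both partitions are sorted without duplicates; the position of a point in that
    list gives [a] and [a']. *)
Lemma common_refinement N tau N' tau' : is_partition t T N tau ->
  is_partition t T N' tau' ->
  exists M rho a a', [/\ is_partition t T M rho, refines N tau M rho a &
    refines N' tau' M rho a'].
Proof.
move=> htau htau'.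
pose pts := [seq tau p | p <- iota 0 N.+1] ++ [seq tau' p | p <- iota 0 N'.+1].
pose s := sort <=%R (undup pts).
have mem_s x : (x \in s) = (x \in pts) by rewrite mem_sort mem_undup.
have s_sorted : sorted <%R s by rewrite sort_lt_sorted undup_uniq.
have in1 p : (p <= N)%N -> tau p \in s.
  by move=> pN; rewrite mem_s mem_cat map_f// mem_iota.
have in2 p : (p <= N')%N -> tau' p \in s.
  by move=> pN; rewrite mem_s mem_cat [X in _ || X]map_f ?orbT// mem_iota.
have s_bounds x : x \in s -> t <= x <= T.
  rewrite mem_s mem_cat => /orP[] /mapP[p]; rewrite mem_iota /= add0n ltnS => pN ->.
    exact: (partition_bounds htau pN).
  exact: (partition_bounds htau' pN).
have s0 : (0 < size s)%N by have := in1 0%N isT; case: (s).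
have ts : t \in s by have [<- _ _] := htau; exact: in1.
have Ts : T \in s by have [_ <- _] := htau; exact: in1.
pose rho q := nth T s q.
pose M := (size s).-1.
have MS : M.+1 = size s by rewrite prednK.
have rho_index x : x \in s -> rho (index x s) = x by exact: nth_index.
have index_le x : x \in s -> (index x s <= M)%N by rewrite -ltnS MS index_mem.
have rho_lt p q : (p < size s)%N -> (q < size s)%N -> (p < q)%N -> rho p < rho q.
  by move=> ps qs; exact: (sorted_ltn_nth lt_trans T s_sorted).
have rho_le p q : (p < size s)%N -> (q < size s)%N -> (p <= q)%N -> rho p <= rho q.
  by move=> ps qs; rewrite leq_eqVlt => /predU1P[->//|/(rho_lt _ _ ps qs)/ltW].
have index_lt x y : x \in s -> y \in s -> x < y -> (index x s < index y s)%N.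
  move=> xs ys xy; rewrite ltnNge; apply/negP => h.
  have := rho_le _ _ _ _ h; rewrite !index_mem ys xs => /(_ isT isT).
  by rewrite !rho_index// leNgt xy.
exists M, rho, (fun p => index (tau p) s), (fun p => index (tau' p) s); split.
- split.
  + apply/eqP; rewrite eq_le; apply/andP; split; last first.
      by have /andP[] := s_bounds _ (mem_nth T s0).
    rewrite -[leRHS](rho_index _ ts); apply: rho_le => //; by rewrite index_mem.
  + apply/eqP; rewrite eq_le; apply/andP; split.
      have Ms : (M < size s)%N by rewrite -MS.
      by have /andP[] := s_bounds _ (mem_nth T Ms).
    rewrite -[leLHS](rho_index _ Ts); apply: rho_le; rewrite ?index_mem//.
      by rewrite -MS.
    exact: index_le.
  + move=> j jM; apply: rho_lt => //; first by rewrite -MS ltnS ltnW.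
    by rewrite -MS ltnS.
- split=> p pN; first by rewrite rho_index// in1.
    exact/index_le/in1.
  apply: index_lt; [exact/in1/ltnW|exact: in1|]; have [_ _] := htau; exact.
- split=> p pN; first by rewrite rho_index// in2.
    exact/index_le/in2.
  apply: index_lt; [exact/in2/ltnW|exact: in2|]; have [_ _] := htau'; exact.
Qed.

Section one_refinement.
Variables (N : nat) (tau : nat -> R) (M : nat) (rho : nat -> R) (a : nat -> nat).
Hypothesis ref : refines N tau M rho a.

Definition in_cell (p : 'I_N) (q : 'I_M) := (a p <= q < a p.+1)%N.

Lemma in_cell_inj p p' q : in_cell p q -> in_cell p' q -> p = p'.
Proof.
have [_ _ ha] := ref.
have mono k l : (k <= l <= N)%N -> (a k <= a l)%N.
  move=> /andP[]; elim: l => [|l IH]; first by rewrite leqn0 => /eqP ->.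
  rewrite leq_eqVlt => /predU1P[->//|]; rewrite ltnS => kl lN.
  by rewrite (leq_trans (IH kl (ltnW lN)))// ltnW// ha.
wlog pp' : p p' / (p <= p')%N.
  by move=> h h1 h2; case: (leqP p p') => [|/ltnW] le; [exact: h|apply/esym; exact: h].
move=> /andP[_ h1] /andP[h2 _]; apply/val_inj/eqP; rewrite eqn_leq pp' /= leqNgt.
apply/negP => lt; have := mono p.+1 p'; rewrite lt (ltnW (ltn_ord p')) => /(_ isT) h.
by move: (leq_ltn_trans h2 h1); rewrite ltnNge h.
Qed.

Lemma cell_telescope (V : zmodType) (g : R -> V) (p : 'I_N) :
  g (tau p.+1) - g (tau p) = \sum_(q < M | in_cell p q) (g (rho q.+1) - g (rho q)).
Proof.
have [h1 h2 h3] := ref.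
rewrite !h1 ?(ltnW (ltn_ord p))//.
rewrite -(telescope_sumr (fun q => g (rho q)) (ltnW (h3 p (ltn_ord p)))).
rewrite (big_nat_widen _ _ M) ?h2//.
rewrite (big_nat_widenl _ 0)// big_mkord.
by apply: eq_bigl => q; rewrite /in_cell andbC.
Qed.

Variable n : nat.

Definition refined_coef (c : {ffun 'I_n -> 'I_N} -> R) (q : {ffun 'I_n -> 'I_M}) : R :=
  \sum_(p : {ffun 'I_n -> 'I_N}) c p * \prod_(l < n) (in_cell (p l) (q l))%:R.

(** The functions [g] are arbitrary because two instances are needed: the paths, which give
    increment sums, and s |-> (x < s), which gives step functions. Both thus acquire the same
    refined coefficients. *)
Lemma refined_sum (g : 'I_n -> R -> R) c :
  \sum_(p : {ffun 'I_n -> 'I_N}) c p * \prod_(l < n) (g l (tau (p l).+1) - g l (tau (p l))) =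
  \sum_(q : {ffun 'I_n -> 'I_M}) refined_coef c q *
    \prod_(l < n) (g l (rho (q l).+1) - g l (rho (q l))).
Proof.
transitivity (\sum_(p : {ffun 'I_n -> 'I_N}) \sum_(q : {ffun 'I_n -> 'I_M})
   c p * \prod_(l < n) ((in_cell (p l) (q l))%:R *
      (g l (rho (q l).+1) - g l (rho (q l))))).
  apply: eq_bigr => p _; rewrite -mulr_sumr; congr (_ * _).
  transitivity (\prod_(l < n) \sum_(q < M) (in_cell (p l) q)%:R * (g l (rho q.+1) - g l (rho q))).
    apply: eq_bigr => l _; rewrite cell_telescope big_mkcond /=; apply: eq_bigr => q _.
    by case: ifP => _; rewrite ?mul1r ?mul0r.
  rewrite bigA_distr_bigA /=; apply: eq_big => // q; exact/esym/ffun_onP.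
rewrite exchange_big /=; apply: eq_bigr => q _; rewrite /refined_coef mulr_suml.
by apply: eq_bigr => p _; rewrite big_split /= mulrA.
Qed.

(** Equal fine indices lie in the same coarse cell, so every coarse multi-index above them repeats
    as well. *)
Lemma refined_coef_offdiag (c : {ffun 'I_n -> 'I_N} -> R) :
  (forall p : {ffun 'I_n -> 'I_N}, ~~ injectiveb p -> c p = 0) ->
  forall q : {ffun 'I_n -> 'I_M}, ~~ injectiveb q -> refined_coef c q = 0.
Proof.
move=> hc q /injectivePn[l [l' ll' qq]].
rewrite /refined_coef big1// => p _.
have [pp|pp] := eqVneq (p l) (p l').
  by rewrite hc ?mul0r//; apply/injectivePn; exists l, l'.
have [h1|h1] := boolP (in_cell (p l) (q l)); last first.
  by rewrite (bigD1 l)//= (negbTE h1) mul0r mulr0.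
have [h2|h2] := boolP (in_cell (p l') (q l')); last first.
  by rewrite (bigD1 l')//= (negbTE h2) mul0r mulr0.
by move: pp; rewrite -qq in h2; rewrite (in_cell_inj h1 h2) eqxx.
Qed.

Lemma refined_step_fun c x : is_partition t T N tau -> is_partition t T M rho ->
  step_fun tau c x = step_fun rho (refined_coef c) x.
Proof.
move=> [_ _ h] [_ _ h'].
(* The indicator of [u, v) is an increment of s |-> (y < s), which brings step functions under
   [refined_sum]. *)
have E (u v y : R) : u < v -> (\1_(`[u, v[%classic) : R -> R) y = (y < v)%R%:R - (y < u)%R%:R.
  move=> uv; rewrite indicE; have [yu|yu] := ltP y u.
    rewrite (lt_trans yu uv) subrr memNset//= in_itv /= => /andP[].
    by rewrite leNgt yu.
  rewrite subr0; have [yv|yv] := ltP y v.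
    by rewrite mem_set//= in_itv /= yu yv.
  by rewrite memNset//= in_itv /= => /andP[_]; rewrite ltNge yv.
rewrite /step_fun; transitivity (\sum_(p : {ffun 'I_n -> 'I_N}) c p *
    \prod_(l < n) ((x ord0 l < tau (p l).+1)%R%:R - (x ord0 l < tau (p l))%R%:R)).
  by apply: eq_bigr => p _; congr (_ * _); apply: eq_bigr => l _; rewrite E// h.
rewrite (refined_sum (fun l s => (x ord0 l < s)%R%:R)).
by apply: eq_bigr => q _; congr (_ * _); apply: eq_bigr => l _; rewrite E// h'.
Qed.

End one_refinement.
End refinement.

Lemma refined_increment_sum d (Omega : measurableType d) (R : realType)
    (P : probability Omega R) m (W : 'I_m -> R -> {RV P >-> R})
    N (tau : nat -> R) M rho a n (i : 'I_n -> 'I_m.+1)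
    (c : {ffun 'I_n -> 'I_N} -> R) w : refines N tau M rho a ->
  increment_sum W i tau c w = increment_sum W i rho (refined_coef (M := M) a c) w.
Proof.
by move=> ref; rewrite /increment_sum (refined_sum ref (fun l s => with_time W (i l) s w)).
Qed.

Lemma wt_injective (R : realFieldType) (T : finType) (dl : T -> R) n (j : {ffun 'I_n -> T}) :
  injectiveb j -> wt dl finset.set0 j = \prod_l dl (j l).
Proof.
move=> /injectiveP inj; rewrite /wt finset.setD0 /im big_imset /=; last first.
  by move=> x y _ _ /inj.
by apply: eq_bigl => l; rewrite inE.
Qed.

Lemma ms_sqdistE d (Omega : measurableType d) (R : realType) (P : probability Omega R)
  (X Y : Omega -> R) : ms_sqdist P X Y = sqdist P setT X Y.
Proof. by rewrite /ms_sqdist unlock. Qed.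

Lemma increment_sum0 (R : realType) d (Omega : measurableType d) (P : probability Omega R) m
    (W : 'I_m -> R -> {RV P >-> R}) n (i : 'I_n -> 'I_m.+1) N (tau : nat -> R)
    (c : {ffun 'I_n -> 'I_N} -> R) v w : n = 0%N -> (forall j, c j = v) ->
  increment_sum W i tau c w = v.
Proof.
move=> n0; subst n => cv; rewrite /increment_sum.
pose j0 : {ffun 'I_0 -> 'I_N} := ffun0 (card_ord 0).
rewrite (bigD1 j0)//= cv big_ord0 mulr1 big1 ?addr0// => j /eqP; case.
by apply/ffunP => -[].
Qed.

Section wiener_integral_existence.
Context d (Omega : measurableType d) (R : realType) (P : probability Omega R).
Context (m : nat) (t T : R) (F : R -> set (set Omega)).
Hypothesis hF : is_filtration T F.
Variable W : 'I_m -> R -> {RV P >-> R}.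
Hypothesis hW : is_wiener W T F.
Hypothesis t0 : 0 <= t.
Hypothesis htT : t < T.

Let D := T - t + 1.
Let D1 : 1 <= D. Proof. by rewrite /D lerDr subr_ge0 ltW. Qed.
Let TD : T - t <= D. Proof. by rewrite /D lerDl. Qed.

Section sums.
Variables (n : nat) (i : 'I_n -> 'I_m.+1).

Lemma measurable_increment_sum N (tau : nat -> R) (c : {ffun 'I_n -> 'I_N} -> R) :
  measurable_fun setT (increment_sum W i tau c).
Proof.
apply: measurable_sum => j; apply: measurable_funM => //.
by apply: measurable_prod => l _; exact: measurable_incr.
Qed.

(** It stands in for an exact Ito isometry, which fails in general here: components may repeat or be
    time, so the second moment of an off-diagonal sum need not be the squared norm of its
    coefficients. *)
Definition isometry_const : R := lead_const D n ^+ (n + n) * (n%:R + n%:R + D) ^+ n.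

Lemma isometry_const_ge0 : 0 <= isometry_const.
Proof.
have D0 : 0 <= D by exact: le_trans D1.
have L0 : 0 <= lead_const D n by apply: le_trans (lead_const_ge1 D1 n).
by rewrite mulr_ge0// exprn_ge0// addr_ge0// addr_ge0.
Qed.

Lemma increment_sum_sq_le N (tau : nat -> R) (c : {ffun 'I_n -> 'I_N} -> R) :
  is_partition t T N tau ->
  (\int[P]_w (increment_sum W i tau c w ^+ 2)%:E <=
    (isometry_const * \sum_j c j ^+ 2 * wt (delta tau) finset.set0 j)%:E)%E.
Proof.
move=> htau.
have de (p : 'I_N) : Num.sqrt (delta tau p) <= Num.sqrt D.
  by apply: ler_wsqrtr; exact: (delta_le htau TD).
exact: (incr_sum_le hF hW t0 htau D1 TD de i c).
Qed.

(** On a common refinement the difference is a single off-diagonal sum. Off the diagonals the weight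
    of a multi-index is the volume of its cell, so the weighted sum is an L2 distance. *)
Lemma increment_sum_isometry N (tau : nat -> R) (c : {ffun 'I_n -> 'I_N} -> R)
    N' (tau' : nat -> R) (c' : {ffun 'I_n -> 'I_N'} -> R) :
  is_partition t T N tau -> is_partition t T N' tau' ->
  (forall p : {ffun 'I_n -> 'I_N}, ~~ injectiveb p -> c p = 0) ->
  (forall p : {ffun 'I_n -> 'I_N'}, ~~ injectiveb p -> c' p = 0) ->
  (sqdist P setT (increment_sum W i tau c) (increment_sum W i tau' c') <=
   isometry_const%:E * L2_sqdist t T (step_fun tau c) (step_fun tau' c'))%E.
Proof.
move=> htau htau' hc hc'.
have [M [rho [a [a' [hrho ra ra']]]]] := common_refinement htau htau'.
pose b q := refined_coef (M := M) a c q - refined_coef (M := M) a' c' q.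
have hb (q : {ffun 'I_n -> 'I_M}) : ~~ injectiveb q -> b q = 0.
  move=> nq; rewrite /b (refined_coef_offdiag ra hc nq) (refined_coef_offdiag ra' hc' nq).
  by rewrite subrr.
have E1 w : increment_sum W i tau c w - increment_sum W i tau' c' w = increment_sum W i rho b w.
  rewrite (refined_increment_sum _ _ _ _ ra) (refined_increment_sum _ _ _ _ ra').
  by rewrite /increment_sum -sumrB; apply: eq_bigr => q _; rewrite mulrBl.
have E2 x : step_fun tau c x - step_fun tau' c' x = step_fun rho b x.
  rewrite (refined_step_fun ra _ _ htau hrho) (refined_step_fun ra' _ _ htau' hrho).
  by rewrite /step_fun -sumrB; apply: eq_bigr => q _; rewrite mulrBl.
rewrite /sqdist /L2_sqdist; under eq_integral do rewrite E1.
rewrite (_ : (fun x => _) = (fun x => (step_fun rho b x ^+ 2)%:E)); last first.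
  by apply/funext => x; rewrite E2.
rewrite (cube_integral_step_sq htT hrho) -EFinM.
apply: le_trans (increment_sum_sq_le _ hrho) _; rewrite lee_fin.
rewrite le_eqVlt; apply/orP; left; apply/eqP; congr (_ * _).
apply: eq_bigr => j _; case: (boolP (injectiveb j)) => ij; first by rewrite (wt_injective _ ij).
by rewrite hb// expr0n /= !mul0r.
Qed.

End sums.
Section approximation.
Variables (n : nat) (i : 'I_n -> 'I_m.+1).
Variable tau : nat -> nat -> R.
Hypothesis htau : forall N, (0 < N)%N -> is_partition t T N (tau N).
Hypothesis hmesh : (fun N => mesh N (tau N)) @ \oo --> (0 : R).
Variable f : 'rV[R]_n -> R.
Hypothesis uf : ucont t T f.

Let D0 : 0 <= D. Proof. exact: le_trans D1. Qed.

(** A repeated index leaves one factor, at most [h], beyond the weight, so the diagonal cells have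
    total volume of the order of the mesh. *)
Lemma noninj_vol N (s : nat -> R) (h : R) : is_partition t T N s ->
  (forall p : 'I_N, delta s p <= h) -> h <= D ->
  \sum_(j : {ffun 'I_n -> 'I_N} | ~~ injectiveb j) vol s j <= h * (D ^+ n * (n%:R + D) ^+ n).
Proof.
move=> hs dh hD.
have d0 (p : 'I_N) : 0 <= delta s p by exact: (ltW (delta_gt0 hs p)).
have sD : \sum_(p < N) delta s p <= D by rewrite (sum_delta hs).
have N0 : (0 < N)%N.
  rewrite lt0n; apply/eqP => N0; have [h1 h2 _] := hs.
  by move: htT; rewrite -h1 -h2 N0 ltxx.
have h0 : 0 <= h by apply: le_trans (d0 (Ordinal N0)) (dh _).
apply: (@le_trans _ _ (\sum_(j : {ffun 'I_n -> 'I_N}) h * D ^+ n * wt (delta s) finset.set0 j)).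
  rewrite [leRHS](bigID (fun j : {ffun 'I_n -> 'I_N} => ~~ injectiveb j)) /=.
  rewrite -[leLHS]addr0 lerD//; last first.
    by apply: sumr_ge0 => j _; rewrite !mulr_ge0 ?exprn_ge0 ?wt_ge0.
  apply: ler_sum => j nj.
  by apply: (prod_le_wt d0 finset.set0 j D1 dh hD).2; left.
rewrite -mulr_sumr -mulrA ler_wpM2l// ler_wpM2l ?exprn_ge0//.
by apply: le_trans (sum_wt d0 sD _ _) _; rewrite cards0 add0r.
Qed.

Definition offdiag N (j : {ffun 'I_n -> 'I_N}) : R :=
  if injectiveb j then f (gridpt (tau N) j) else 0.

Lemma offdiag_noninj N (j : {ffun 'I_n -> 'I_N}) : ~~ injectiveb j -> offdiag j = 0.
Proof. by rewrite /offdiag => /negbTE ->. Qed.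

Lemma offdiag_L2 (e : R) : 0 < e -> exists N0, forall N, (N0 <= N)%N ->
  (0 < N)%N /\ (L2_sqdist t T (step_fun (tau N) (@offdiag N)) f <= e%:E)%E.
Proof.
move=> e0; have Dn : 0 < D ^+ n by rewrite exprn_gt0// (lt_le_trans _ D1).
have [M M0 hM] := ucont_bounded htT htau hmesh uf.
(* The cap 1 gives e1^2 <= e1, so the oscillation contributes at most e / 2; [h] below does the same
   for the diagonal cells. *)
set e1 := Num.min 1 (e / (2 * D ^+ n)).
have e10 : 0 < e1 by rewrite lt_min ltr01 divr_gt0// mulr_gt0.
have e11 : e1 ^+ 2 * D ^+ n <= e / 2.
  apply: (@le_trans _ _ (e1 * D ^+ n)).
    by rewrite ler_wpM2r ?(ltW Dn)// expr2 ler_piMl ?(ltW e10)// ge_min lexx.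
  by rewrite -ler_pdivlMr// -mulrA -invfM ge_min lexx orbT.
set C := (M ^+ 2 * (D ^+ n * (n%:R + D) ^+ n)).
have nD0 : 0 <= n%:R + D by rewrite addr_ge0.
have C0 : 0 <= C by rewrite !mulr_ge0 ?exprn_ge0.
set h := Num.min D (e / (2 * (C + 1))).
have h0 : 0 < h by rewrite lt_min (lt_le_trans _ D1)// divr_gt0// mulr_gt0// ltr_wpDl.
have hC : h * C <= e / 2.
  apply: (@le_trans _ _ (h * (C + 1))); first by rewrite ler_wpM2l ?(ltW h0)// lerDl.
  by rewrite -ler_pdivlMr ?ltr_wpDl// -mulrA -invfM ge_min lexx orbT.
have [N1 HN1] := ucont_cell htau hmesh uf e10.
have [N2 HN2] := fine_mesh hmesh h0.
exists (maxn N1 N2) => N; rewrite geq_max => /andP[/HN1[Np osc] /HN2[_ hN]].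
split=> //; have hs := htau Np.
pose b (j : {ffun 'I_n -> 'I_N}) := if injectiveb j then e1 ^+ 2 else M ^+ 2.
apply: le_trans (L2_sqdist_step_le htT hs (ucont_measurable htT htau hmesh uf) (b := b) _) _.
  move=> j v jv; rewrite /offdiag /b; case: ifP => _.
    rewrite -real_normK ?num_real// lerXn2r ?nnegrE ?(ltW e10)//.
    by rewrite distrC; exact: osc.
  rewrite sub0r sqrrN -real_normK ?num_real// lerXn2r ?nnegrE//.
  by apply: hM; have := cellsc_sub hs jv.
rewrite lee_fin (bigID (fun j : {ffun 'I_n -> 'I_N} => injectiveb j)) /=.
have -> : e = e / 2 + e / 2 by lra.
apply: lerD.
  apply: le_trans e11; apply: (@le_trans _ _ (\sum_(j : {ffun 'I_n -> 'I_N}) e1 ^+ 2 * vol (tau N) j)).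
    rewrite [leRHS](bigID (fun j : {ffun 'I_n -> 'I_N} => injectiveb j)) /=.
    rewrite -[leLHS]addr0 lerD//.
      by apply: ler_sum => j ij; rewrite /b ij.
    by apply: sumr_ge0 => j _; rewrite mulr_ge0 ?sqr_ge0 ?(vol_ge0 hs).
  rewrite -mulr_sumr ler_wpM2l ?sqr_ge0// (sum_vol hs).
  by rewrite lerXn2r ?nnegrE// subr_ge0 ltW.
apply: le_trans hC; rewrite /C mulrCA.
apply: (@le_trans _ _ (\sum_(j : {ffun 'I_n -> 'I_N} | ~~ injectiveb j) M ^+ 2 * vol (tau N) j)).
  by apply: ler_sum => j ij; rewrite /b (negbTE ij).
rewrite -mulr_sumr ler_wpM2l ?sqr_ge0//; apply: noninj_vol => //.
  by move=> p; apply: le_trans (ltW hN); exact: delta_le_mesh.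
by rewrite ge_min lexx.
Qed.

Let mC := @measurable_tcube R t T n.
Let mf := ucont_measurable htT htau hmesh uf.
Let mstep N (s : nat -> R) (c : {ffun 'I_n -> 'I_N} -> R) :
  measurable_fun (@tcube R t T n) (step_fun s c \o @row_of_tuple R n).
Proof. by apply: measurable_funTS; exact: measurable_step_fun. Qed.

Lemma L2_triangle N (s : nat -> R) (c : {ffun 'I_n -> 'I_N} -> R)
    N' (s' : nat -> R) (c' : {ffun 'I_n -> 'I_N'} -> R) :
  (L2_sqdist t T (step_fun s c) (step_fun s' c') <=
   2%:E * (L2_sqdist t T (step_fun s c) f + L2_sqdist t T (step_fun s' c') f))%E.
Proof.
have := sqdist_triangle (lebesgue_tuple R n) mC (mstep s c) mf (mstep s' c').
by rewrite [X in (_ <= _ * (_ + X))%E -> _]sqdistC.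
Qed.

(** The added 1 makes the constant positive, so that tolerances can be divided by it. *)
Let K := isometry_const n + 1.
Let K0 : 0 < K. Proof. by rewrite /K ltr_wpDl// isometry_const_ge0. Qed.

Lemma increment_sum_dist_le (e : R) N (s : nat -> R) (c : {ffun 'I_n -> 'I_N} -> R)
    N' (s' : nat -> R) (c' : {ffun 'I_n -> 'I_N'} -> R) :
  is_partition t T N s -> is_partition t T N' s' ->
  (forall p : {ffun 'I_n -> 'I_N}, ~~ injectiveb p -> c p = 0) ->
  (forall p : {ffun 'I_n -> 'I_N'}, ~~ injectiveb p -> c' p = 0) ->
  (L2_sqdist t T (step_fun s c) f <= e%:E)%E ->
  (L2_sqdist t T (step_fun s' c') f <= e%:E)%E ->
  (sqdist P setT (increment_sum W i s c) (increment_sum W i s' c') <= (4 * K * e)%:E)%E.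
Proof.
move=> hs hs' hc hc' l l'.
apply: le_trans (increment_sum_isometry i hs hs' hc hc') _.
apply: (@le_trans _ _ (K%:E * (2%:E * (e%:E + e%:E)))%E); last first.
  by rewrite -EFinD -!EFinM lee_fin; lra.
apply: lee_pmul => //.
- by rewrite lee_fin isometry_const_ge0.
- exact: (sqdist_ge0 (lebesgue_tuple R n)).
- by rewrite lee_fin /K lerDl.
- by apply: le_trans (L2_triangle _ _ _ _) _; apply: lee_wpmul2l => //; exact: leeD.
Qed.

Let Xs N := increment_sum W i (tau N) (@offdiag N).

(** The off-diagonal sums with grid values of [f] are Cauchy by the isometry bound. Their limit is
    compared with an arbitrary step function through one such sum far along the sequence. *)
Lemma wiener_integral_exists : exists X : {RV P >-> R}, is_wiener_integral W t T i f X.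
Proof.
have cX : forall e : R, 0 < e -> exists N, forall k l, (N <= k)%N -> (N <= l)%N ->
    (sqdist P setT (Xs k) (Xs l) <= e%:E)%E.
  move=> e e0; have d0 : 0 < e / (4 * K) by rewrite divr_gt0// mulr_gt0.
  have [N HN] := offdiag_L2 d0; exists N => k l /HN[kp hk] /HN[lp hl].
  have := increment_sum_dist_le (htau kp) (htau lp) (@offdiag_noninj k) (@offdiag_noninj l) hk hl.
  by rewrite mulrC divfK// gt_eqF// mulr_gt0.
have mXs N : measurable_fun setT (Xs N) by exact: measurable_increment_sum.
have [X mX HX] := L2_complete mXs cX.
pose X' : {RV P >-> R} := MeasurableFun.Pack
  (MeasurableFun.Class (isMeasurableFun.Build _ _ _ _ _ mX)).
exists X'; split.
  have [N1 HN1] := offdiag_L2 ltr01; have [N2 HN2] := HX _ ltr01.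
  set N := maxn N1 N2; have [Np _] := HN1 N (leq_maxl _ _).
  have h := HN2 N (leq_maxr _ _).
  have E : ('E_P[fun w => (X' w ^+ 2)%R] = sqdist P setT X (cst 0%R))%E.
    by rewrite unlock /sqdist; apply: eq_integral => w _; rewrite /= subr0.
  rewrite E; apply: le_lt_trans (sqdist_triangle P measurableT mX (mXs N) (measurable_cst _)) _.
  rewrite lte_mul_pinfty// ?adde_ge0 ?sqdist_ge0// lte_add_pinfty//.
    by rewrite sqdistC (le_lt_trans h)// ltry.
  rewrite /sqdist; under eq_integral do rewrite /= subr0.
  by apply: le_lt_trans (increment_sum_sq_le _ _ (htau Np)) _; rewrite ltry.
(* The two distances become at most e / 4 and e / 8; doubled by [sqdist_triangle] they total 3 e /
   4, strictly below [e]. *)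
move=> e e0; have d0 : 0 < e / (16 * K) by rewrite divr_gt0// mulr_gt0.
have e8 : 0 < e / 8 by rewrite divr_gt0.
exists (e / (16 * K)) => // N s c hs hc hL.
have [N1 HN1] := offdiag_L2 d0; have [N2 HN2] := HX _ e8.
set M := maxn N1 N2; have [Mp hM] := HN1 M (leq_maxl _ _).
have h := HN2 M (leq_maxr _ _).
have h2 := increment_sum_dist_le hs (htau Mp) hc (@offdiag_noninj M) (ltW hL) hM.
rewrite ms_sqdistE; apply: le_lt_trans (sqdist_triangle P measurableT
  (measurable_increment_sum i s c) (mXs M) mX) _.
apply: (@le_lt_trans _ _ (2%:E * ((4 * K * (e / (16 * K)))%:E + (e / 8)%:E))%E).
  by apply: lee_wpmul2l => //; exact: leeD.
have -> : 4 * K * (e / (16 * K)) = e / 4.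
  have aux (x y : R) : x != 0 -> 4 * x * (y / (16 * x)) = y / 4.
    by move=> x0; field; rewrite x0.
  by apply: aux; rewrite gt_eqF.
by rewrite -EFinD -EFinM lte_fin; lra.
Qed.

Lemma wiener_integral_cvg (e : R) : 0 < e -> exists N0, forall N, (N0 <= N)%N ->
  (sqdist P setT (Xs N) (wiener_integral W t T i f) <= e%:E)%E.
Proof.
move=> e0; rewrite /wiener_integral; case: ifPn => [/eqP n0|nN0].
  (* In dimension 0 the sum has one term, at the empty multi-index, which is vacuously injective,
     and the grid point is the only point of the space. *)
  exists 0%N => N _; rewrite /sqdist.
  rewrite (eq_integral (cst 0%E)) ?integral0 ?lee_fin ?(ltW e0)// => w _.
  suff -> : Xs N w = f 0 by rewrite subrr expr0n.
  apply: increment_sum0 => // j; rewrite /offdiag.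
  have nol (l : 'I_n) : False by have := ltn_ord l; rewrite [X in (_ < X)%N]n0.
  rewrite (_ : injectiveb j = true); last by apply/injectiveP => l; have := nol l.
  by congr f; apply/rowP => l; have := nol l.
have h : is_wiener_integral W t T i f (xget (cst 0 : {mfun Omega >-> R}) (is_wiener_integral W t T i f)).
  by have [X hX] := wiener_integral_exists; exact: (xgetI _ hX).
have [_ /(_ e e0)[dl dl0 hdl]] := h.
have d2 : 0 < dl / 2 by rewrite divr_gt0.
have [N0 HN] := offdiag_L2 d2; exists N0 => N /HN[Np hL].
have := hdl N (tau N) (@offdiag N) (htau Np) (@offdiag_noninj N).
rewrite ms_sqdistE => H; apply/ltW/H; apply: le_lt_trans hL _.
by rewrite lte_fin; lra.
Qed.

End approximation.
End wiener_integral_existence.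

(** * Pairings *)

Section pairings.
Context (k : nat) (S : {set {set 'I_k}}).

Definition pairing : bool := finset.trivIset S && [forall B in S, #|B| == 2].

Definition same_block (a b : 'I_k) : bool :=
  (a == b) || [exists B in S, (a \in (B : {set 'I_k})) && (b \in B)].

Definition slot := ('I_#|unpaired S| + 'I_#|S|)%type.

(** The two searches are those of [pairing_point] in the same order, so that gluing indices and
    gluing points agree by unfolding. *)
Definition slot_of (a : 'I_k) : option slot :=
  if [pick l : 'I_#|unpaired S| | enum_val l == a] is Some l then Some (inl l)
  else if [pick s : 'I_#|S| | a \in (enum_val s : {set 'I_k})] is Some s
  then Some (inr s) else None.

Lemma slot_ofP a :
  (exists2 l : 'I_#|unpaired S|, slot_of a = Some (inl l) & enum_val l = a) \/
  (exists2 s : 'I_#|S|, slot_of a = Some (inr s) & a \in (enum_val s : {set 'I_k})).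
Proof.
rewrite /slot_of; case: pickP => [l /eqP la|nl]; first by left; exists l.
case: pickP => [s sa|ns]; first by right; exists s.
have [au|] := boolP (a \in unpaired S).
  by have := nl (enum_rank_in au a); rewrite enum_rankK_in// eqxx.
rewrite inE negbK => /finset.bigcupP[B BS aB].
by have := ns (enum_rank_in BS B); rewrite enum_rankK_in// aB.
Qed.

Lemma slot_of_unpaired (l : 'I_#|unpaired S|) : slot_of (enum_val l) = Some (inl l).
Proof.
rewrite /slot_of; case: pickP => [l' /eqP /enum_val_inj -> //|/(_ l)].
by rewrite eqxx.
Qed.

Hypothesis hS : pairing.

Let trivS : finset.trivIset S. Proof. by case/andP: hS. Qed.

Lemma card_block (s : 'I_#|S|) : #|(enum_val s : {set 'I_k})| = 2.
Proof.
by case/andP: hS => _ /forallP /(_ (enum_val s)); rewrite enum_valP => /eqP.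
Qed.

Lemma block_cover (s : 'I_#|S|) a : a \in (enum_val s : {set 'I_k}) -> a \in finset.cover S.
Proof. by move=> sa; apply/finset.bigcupP; exists (enum_val s) => //; exact: enum_valP. Qed.

Lemma block_inj (s s' : 'I_#|S|) a : a \in (enum_val s : {set 'I_k}) ->
  a \in (enum_val s' : {set 'I_k}) -> s = s'.
Proof.
move=> sa s'a; apply: enum_val_inj; apply/eqP; rewrite -[_ == _]negbK; apply/negP => ne.
have := finset.trivIsetP trivS (enum_val s) (enum_val s') (enum_valP s) (enum_valP s') ne.
move=> /(disjointFr (x := a)) /(_ sa).
by rewrite s'a.
Qed.

Lemma slot_of_block (s : 'I_#|S|) a : a \in (enum_val s : {set 'I_k}) ->
  slot_of a = Some (inr s).
Proof.
move=> sa; have [[l _ la]|[s' -> s'a]] := slot_ofP a; last by rewrite (block_inj sa s'a).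
by have := enum_valP l; rewrite la inE (block_cover sa).
Qed.

Lemma slot_of_eq a b : (slot_of a == slot_of b) = same_block a b.
Proof.
apply/eqP/orP => [E|[/eqP -> //|/existsP[B /andP[BS /andP[aB bB]]]]].
  have [[l la lE]|[s sa sE]] := slot_ofP a.
    have [[l' lb lE']|[s sb _]] := slot_ofP b; last by move: E; rewrite la sb.
    by left; rewrite -lE -lE'; move: E; rewrite la lb => -[->].
  have [[l' lb _]|[s' sb sE']] := slot_ofP b; first by move: E; rewrite sa lb.
  right; apply/existsP; exists (enum_val s); rewrite enum_valP sE /=.
  by move: E; rewrite sa sb => -[->].
have aB' : a \in (enum_val (enum_rank_in BS B) : {set 'I_k}) by rewrite enum_rankK_in.
have bB' : b \in (enum_val (enum_rank_in BS B) : {set 'I_k}) by rewrite enum_rankK_in.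
by rewrite (slot_of_block aB') (slot_of_block bB').
Qed.

Section gluing.
Variables (N : nat) (p0 : 'I_N).
Implicit Types (u : {ffun 'I_#|unpaired S| -> 'I_N}) (v : {ffun 'I_#|S| -> 'I_N}).

Definition slot_val u v (x : slot) : 'I_N :=
  match x with inl l => u l | inr s => v s end.

(** By [slot_ofP] every index has a slot, so the default [p0] never shows in the values. *)
Definition glue u v : {ffun 'I_k -> 'I_N} :=
  [ffun a => oapp (slot_val u v) p0 (slot_of a)].

Definition unglue (j : {ffun 'I_k -> 'I_N}) :
    {ffun 'I_#|unpaired S| -> 'I_N} * {ffun 'I_#|S| -> 'I_N} :=
  ([ffun l => j (enum_val l)],
   [ffun s : 'I_#|S| => oapp j p0 [pick a in (enum_val s : {set 'I_k})]]).

Definition joint_inj u v : bool :=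
  [forall x, forall y, (slot_val u v x == slot_val u v y) ==> (x == y)].

(** An equality of truth values, not an implication: the coincidences of [j] are exactly those of
    [S], so that different pairings claim different multi-indices. *)
Definition kernel (j : {ffun 'I_k -> 'I_N}) : bool :=
  [forall a, forall b, (j a == j b) == same_block a b].

Lemma glueE u v a x : slot_of a = Some x -> glue u v a = slot_val u v x.
Proof. by rewrite ffunE => ->. Qed.

Lemma unglueK j : kernel j -> glue (unglue j).1 (unglue j).2 = j.
Proof.
move=> /forallP kj; apply/ffunP => a.
have [[l la lE]|[s sa sE]] := slot_ofP a.
  by rewrite (glueE _ _ la) /= ffunE lE.
rewrite (glueE _ _ sa) /= ffunE; case: pickP => [b bs|/(_ a)]; last by rewrite sE.
apply/eqP; move/forallP: (kj b) => /(_ a) /eqP ->.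
by rewrite -slot_of_eq (slot_of_block bs) (slot_of_block sE).
Qed.

Lemma glueK u v : unglue (glue u v) = (u, v).
Proof.
congr pair; apply/ffunP => x; rewrite ffunE.
  by rewrite (glueE _ _ (slot_of_unpaired x)).
case: pickP => [b bs|nb]; first by rewrite /= (glueE _ _ (slot_of_block bs)).
have /card_gt0P[a ax] : (0 < #|(enum_val x : {set 'I_k})|)%N by rewrite card_block.
by have := nb a; rewrite ax.
Qed.

Lemma slot_of_surj (x : slot) : exists a, slot_of a = Some x.
Proof.
case: x => [l|s]; first by exists (enum_val l); exact: slot_of_unpaired.
have /card_gt0P[a ax] : (0 < #|(enum_val s : {set 'I_k})|)%N by rewrite card_block.
by exists a; exact: slot_of_block.
Qed.

Lemma kernel_glue u v : kernel (glue u v) = joint_inj u v.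
Proof.
apply/idP/idP.
  move=> /forallP kg; apply/forallP => x; apply/forallP => y; apply/implyP => xy.
  have [a ax] := slot_of_surj x; have [b bY] := slot_of_surj y.
  move/forallP: (kg a) => /(_ b) /eqP.
  by rewrite (glueE _ _ ax) (glueE _ _ bY) xy -slot_of_eq ax bY => /esym /eqP [->].
move=> /forallP ji; apply/forallP => a; apply/forallP => b; apply/eqP.
have sx c : exists x, slot_of c = Some x.
  by have [[l -> _]|[s -> _]] := slot_ofP c; eexists.
have [x ax] := sx a; have [y bY] := sx b.
rewrite (glueE _ _ ax) (glueE _ _ bY) -slot_of_eq ax bY.
apply/eqP/eqP => [/eqP E|[-> //]].
by move/forallP: (ji x) => /(_ y); rewrite E /= => /eqP ->.
Qed.

(** [glue] and [unglue] match the multi-indices with coincidence pattern [S] to the injective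
    assignments of cells to slots. *)
Lemma sum_kernel (V : nmodType) (G : {ffun 'I_k -> 'I_N} -> V) :
  \sum_(j | kernel j) G j = \sum_u \sum_(v | joint_inj u v) G (glue u v).
Proof.
rewrite (reindex_onto (fun x => glue x.1 x.2) unglue) /=; last exact: unglueK.
rewrite pair_big_dep /=; apply: eq_bigl => -[u v] /=.
by rewrite kernel_glue glueK eqxx andbT.
Qed.

End gluing.
End pairings.

(** A pair {a, b} of [S] shows in [j] as a coincidence, which forces a pair of [S'] containing both;
    having two elements, it equals {a, b}. *)
Lemma kernel_pairing_uniq k N (S S' : {set {set 'I_k}}) (j : {ffun 'I_k -> 'I_N}) :
  pairing S -> pairing S' -> kernel S j -> kernel S' j -> S = S'.
Proof.
wlog suff sub : S S' / forall B, pairing S -> pairing S' -> kernel S j -> kernel S' j ->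
    B \in S -> B \in S'.
  move=> hS hS' hk hk'; apply/setP => B.
  by apply/idP/idP; [exact: (sub S S')|exact: (sub S' S)].
move=> B hS hS' hk hk' BS; have /cards2P[a [b [ab EB]]] : #|B| == 2.
  by case/andP: hS => _ /forallP /(_ B); rewrite BS.
have jab : j a = j b.
  apply/eqP; move/forallP: hk => /(_ a) /forallP /(_ b) /eqP ->.
  apply/orP; right; apply/existsP; exists B; rewrite BS EB !inE !eqxx /=.
  by rewrite orbT.
move/forallP: hk' => /(_ a) /forallP /(_ b) /eqP; rewrite jab eqxx => /esym.
rewrite /same_block (negbTE ab) /= => /existsP[B' /andP[B'S /andP[aB bB]]].
have /eqP cB' : #|B'| == 2 by case/andP: hS' => _ /forallP /(_ B'); rewrite B'S.
suff -> : B = B' by [].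
apply/eqP; rewrite eqEcard cB' EB cards2 ab andbT.
by apply/fintype.subsetP => c; rewrite !inE => /orP[] /eqP ->.
Qed.

Definition cell_set k N (j : {ffun 'I_k -> 'I_N}) (p : 'I_N) : {set 'I_k} :=
  [set a | j a == p]%SET.

(** The pairs are the index sets of the cells visited exactly twice. *)
Lemma kernel_pairing_exists k N (j : {ffun 'I_k -> 'I_N}) :
  (forall p : 'I_N, #|cell_set j p| <= 2)%N -> exists2 S, pairing S & kernel S j.
Proof.
move=> h2; pose S := [set cell_set j p | p in 'I_N & #|cell_set j p| == 2]%SET.
have SP B : B \in S -> exists2 p, B = cell_set j p & #|cell_set j p| == 2.
  by move=> /imsetP[p]; rewrite !inE => pp ->; exists p.
exists S.
  apply/andP; split.
    apply/finset.trivIsetP => A B /SP[p -> _] /SP[q -> _] pq.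
    rewrite -setI_eq0; apply/eqP/setP => a; rewrite !inE; apply/negP => /andP[/eqP ap /eqP aq].
    by move: pq; rewrite -ap -aq eqxx.
  by apply/forallP => B; apply/implyP => /SP[p -> ].
apply/forallP => a; apply/forallP => b; apply/eqP; apply/idP/idP.
  move=> /eqP jab; have [ab|ab] := eqVneq a b; rewrite /same_block ?ab ?eqxx//=.
  rewrite (negbTE ab) /=.
  apply/existsP; exists (cell_set j (j a)); rewrite !inE jab eqxx /= andbT.
  apply/imsetP; exists (j b) => //; rewrite !inE /= eqn_leq h2 /=.
  have <- : #|[set a; b]%SET| = 2 by rewrite cards2 ab.
  by apply/subset_leq_card/fintype.subsetP => c; rewrite !inE => /orP[] /eqP ->; rewrite ?jab.
move=> /orP[/eqP -> //|/existsP[B /andP[/SP[p -> _]]]].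
by rewrite !inE => /andP[/eqP -> /eqP ->].
Qed.

Lemma pairing0 k : pairing (finset.set0 : {set {set 'I_k}}).
Proof.
apply/andP; split; first by apply/finset.trivIsetP => A B; rewrite inE.
by apply/forallP => B; rewrite inE.
Qed.

Lemma card_pairing k (S : {set {set 'I_k}}) : pairing S -> (#|S| <= k./2)%N.
Proof.
move=> /andP[tS /forallP cS]; rewrite -(half_bit_double #|S| false) half_leq// add0n.
have -> : (#|S|.*2 = #|finset.cover S|)%N.
  rewrite -(eqP tS) -muln2 -sum_nat_const; apply: eq_bigr => B BS.
  by have := cS B; rewrite BS => /eqP.
by rewrite -[leqRHS]card_ord max_card.
Qed.

Lemma sum_pairing (V : nmodType) k (G : {set {set 'I_k}} -> V) :
  \sum_(S | pairing S) G S = G finset.set0 +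
    \sum_(1 <= r < (k./2).+1) \sum_(S : {set {set 'I_k}} | is_pairing r S) G S.
Proof.
rewrite (bigD1 finset.set0) ?pairing0//=; congr (_ + _).
have E r (S : {set {set 'I_k}}) : is_pairing r S = pairing S && (#|S| == r).
  by rewrite /is_pairing /pairing andbA.
under [RHS]eq_bigr do rewrite (eq_bigl _ _ (E _)).
under [RHS]eq_bigr do rewrite big_mkcondr /=.
rewrite exchange_big /= big_mkcondr /=; apply: eq_bigr => S pS.
rewrite -big_mkcond /=.
under eq_bigl do rewrite eq_sym.
rewrite big_nat1_eq ltnS card_pairing// andbT.
by rewrite lt0n cards_eq0; case: eqP.
Qed.

(** * Leading products sorted by coincidence pattern *)

Section lead_products.
Context d (Omega : measurableType d) (R : realType) (P : probability Omega R).
Context (m : nat) (W : 'I_m -> R -> {RV P >-> R}).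
Variables (k : nat) (i : 'I_k -> 'I_m.+1) (N : nat) (tau : nat -> R) (w : Omega).
Implicit Types (j : {ffun 'I_k -> 'I_N}) (p : 'I_N) (S : {set {set 'I_k}}).

Let X p l := (lead tau p l).1 * mono W (tau p) (tau p.+1) (lead tau p l).2 w.

Let X0 p : X p [::] = 1. Proof. by rewrite /X /= /mono big_nil mulr1. Qed.

Lemma size_fiber_card j p : size (fiber i j p) = #|cell_set j p|.
Proof. rewrite /fiber size_map size_filter -sum1_count big_enum_cond /= -sum1_card.
by apply: eq_bigl => a; rewrite !inE. Qed.

Lemma lead_prod_eq0 j p : (2 < #|cell_set j p|)%N -> lead_prod W tau i j w = 0.
Proof.
rewrite -size_fiber_card => h; rewrite /lead_prod (bigD1 p)//=.
by case: (fiber i j p) h => [|a [|b [|c l]]]//= _; rewrite !mul0r.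
Qed.

Lemma lead_prod_inj j : injectiveb j -> lead_prod W tau i j w = incr_prod W tau i j w.
Proof.
move=> /injectiveP ij; rewrite incr_prodE; apply: eq_bigr => p _.
have : (size (fiber i j p) <= 1)%N.
  rewrite size_fiber_card; apply/card_le1_eqP => a b; rewrite !inE => /eqP <- /eqP.
  exact: ij.
by case: (fiber i j p) => [|a [|b l]]//= _; rewrite mul1r.
Qed.

(** A multi-index visiting a cell three times has leading product 0; any other one has exactly one
    pairing as its coincidence pattern. *)
Lemma sum_lead_prod (c : {ffun 'I_k -> 'I_N} -> R) :
  \sum_j c j * lead_prod W tau i j w =
  \sum_(S | pairing S) \sum_(j | kernel S j) c j * lead_prod W tau i j w.
Proof.
rewrite (exchange_big_dep xpredT)//=; apply: eq_bigr => j _.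
have [/existsP[S /andP[pS kS]]|/existsPn nS] := boolP [exists S, pairing S && kernel S j].
  rewrite (big_pred1 S)// => S'; apply/andP/eqP => [[pS' kS']|-> //].
  exact: (kernel_pairing_uniq pS' pS kS' kS).
rewrite big_pred0 => [|S]; last exact/negbTE/nS.
have [/existsP[p hp]|/existsPn h2] := boolP [exists p, 2 < #|cell_set j p|]%N.
  by rewrite (lead_prod_eq0 hp) mulr0.
have [|S pS kS] := @kernel_pairing_exists k N j; first by move=> p; rewrite leqNgt h2.
by have := nS S; rewrite pS kS.
Qed.

(** The empty pairing is treated apart because the first term of the expansion is indexed by ['I_k],
    which is not convertible to ['I_#|unpaired finset.set0|]. *)
Lemma sum_kernel0 (c : {ffun 'I_k -> 'I_N} -> R) :
  \sum_(j | kernel finset.set0 j) c j * lead_prod W tau i j w =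
  increment_sum W i tau (fun j => if injectiveb j then c j else 0) w.
Proof.
rewrite /increment_sum big_mkcond /=; apply: eq_bigr => j _.
have -> : kernel finset.set0 j = injectiveb j.
  apply/idP/injectiveP => [/forallP kj a b ab|ij].
    move/forallP: (kj a) => /(_ b); rewrite ab eqxx /same_block.
    by case/eqP/esym/orP => [/eqP //|/existsP[B]]; rewrite inE.
  apply/forallP => a; apply/forallP => b; rewrite (inj_eq ij) /same_block.
  by rewrite [X in _ || X](_ : _ = false) ?orbF//; apply/existsP => -[B]; rewrite inE.
case: ifP => ij; last by rewrite mul0r.
by rewrite lead_prod_inj.
Qed.

Section one_pairing.
Variables (S : {set {set 'I_k}}) (hS : pairing S).

(** Joint injectivity puts different slots into different cells, so the product over visited cells
    is one over slots: a pair contributes its indicator and the length of its cell, an unpaired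
    index its increment. *)
Lemma lead_prod_glue p0 u v : @joint_inj k S N u v ->
  lead_prod W tau i (glue p0 u v) w =
  pairing_indicator R i S * \prod_(s < #|S|) delta tau (v s) *
  incr_prod W tau (fun l : 'I_#|unpaired S| => i (enum_val l)) u w.
Proof.
move=> ji; set g := slot_val u v.
have gi : injective g.
  move=> x y xy; move/forallP: ji => /(_ x) /forallP /(_ y).
  by rewrite -/(g x) -/(g y) xy eqxx => /eqP.
have gE a x : slot_of S a = Some x -> glue p0 u v a = g x by exact: glueE.
have sx a : exists x, slot_of S a = Some x.
  by have [[l -> _]|[s -> _]] := slot_ofP S a; eexists.
have fibE x a : (glue p0 u v a == g x) = (slot_of S a == Some x).
  have [y ay] := sx a; rewrite (gE _ _ ay) ay (inj_eq gi).
  by apply/eqP/eqP => [->|[->]].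
have -> : lead_prod W tau i (glue p0 u v) w =
    \prod_(x : slot S) X (g x) (fiber i (glue p0 u v) (g x)).
  rewrite /lead_prod (bigID (mem (g @: [set: slot S]%SET))) /= [X in _ * X]big1 ?mulr1.
    rewrite big_imset /=; last by move=> x y _ _ /gi.
    by apply: eq_bigl => x; rewrite inE.
  move=> p np; suff /eqP -> : fiber i (glue p0 u v) p == [::] by exact: X0.
  rewrite fiber_eq0; apply: contra np => /imsetP[a _ ->].
  have [x ax] := sx a; rewrite (gE _ _ ax); exact: imset_f.
rewrite big_sumType /= mulrC; congr (_ * _).
  have -> : pairing_indicator R i S = \prod_(s < #|S|)
      ([forall g in enum_val s, forall h in enum_val s, (i g == i h) && (i g != ord0)])%:R.
    by rewrite /pairing_indicator big_enum_val.
  rewrite -big_split /=; apply: eq_bigr => s _.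
  have [a [b [ab EB]]] : exists a b, a != b /\ enum (enum_val s : {set 'I_k}) = [:: a; b].
    have := card_block hS s; rewrite cardE; have := enum_uniq (enum_val s : {set 'I_k}).
    case: (enum _) => [|a [|b [|? ?]]]//=; rewrite inE andbT => ab _.
    by exists a, b.
  have -> : fiber i (glue p0 u v) (v s) = [:: i a; i b].
    rewrite /fiber -[RHS]/[seq i l | l <- [:: a; b]] -EB; congr map.
    rewrite [RHS]/enum_mem -enumT; apply: eq_filter => l /=.
    rewrite (fibE (inr s)); apply/eqP/idP => [|ls]; last exact: (slot_of_block hS).
    by have [[l' -> _]|[s' -> s'l [<-]]] := slot_ofP S l.
  have mB x : (x \in (enum_val s : {set 'I_k})) = (x == a) || (x == b).
    by rewrite -mem_enum EB !inE.
  rewrite /X /= /mono big_nil mulr1.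
  set f := [forall _ in _, _]; suff -> : f = (i a == i b) && (i a != ord0).
    by case: ifP; rewrite ?mul1r ?mul0r.
  apply/idP/andP => [/forallP h|[/eqP iab ia]].
    have := h a; rewrite mB eqxx /= => /forallP /(_ b).
    by rewrite mB eqxx orbT /= => /andP.
  apply/forallP => x; apply/implyP; rewrite mB => xab.
  apply/forallP => y; apply/implyP; rewrite mB => yab.
  by case/orP: xab => /eqP ->; case/orP: yab => /eqP ->; rewrite ?iab ?eqxx -?iab.
apply: eq_bigr => l _.
have -> : fiber i (glue p0 u v) (u l) = [:: i (enum_val l)].
  rewrite /fiber -[RHS]/[seq i x | x <- [:: enum_val l]]; congr map.
  rewrite -[RHS](filter_pred1_uniq (enum_uniq 'I_k) (mem_enum 'I_k (enum_val l))).
  apply: eq_filter => x /=.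
  rewrite (fibE (inl l)); apply/eqP/eqP => [|->]; last exact: slot_of_unpaired.
  by have [[l' -> <- [->]]|[s' -> _]] := slot_ofP S x.
by rewrite /X /= mul1r /mono big_seq1.
Qed.

Lemma sum_kernel_pairing (p0 : 'I_N) (c : {ffun 'I_k -> 'I_N} -> R) :
  \sum_(j | kernel S j) c j * lead_prod W tau i j w =
  pairing_indicator R i S *
  increment_sum W (fun l : 'I_#|unpaired S| => i (enum_val l)) tau
    (fun u => \sum_(v | @joint_inj k S N u v) c (glue p0 u v) * vol tau v) w.
Proof.
rewrite (sum_kernel hS p0) /increment_sum mulr_sumr; apply: eq_bigr => u _.
rewrite mulr_suml mulr_sumr; apply: eq_bigr => v ji.
by rewrite lead_prod_glue// /incr_prod /vol /incr; ring.
Qed.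

End one_pairing.
End lead_products.

Lemma pairing_point_glue (R : realType) k (S : {set {set 'I_k}}) N (tau : nat -> R) p0
    (u : {ffun 'I_#|unpaired S| -> 'I_N}) (v : {ffun 'I_#|S| -> 'I_N}) :
  pairing_point (gridpt tau u) (gridpt tau v) = gridpt tau (glue p0 u v).
Proof.
apply/rowP => a; rewrite !mxE ffunE /slot_of.
have := slot_ofP S a; rewrite /slot_of.
case: pickP => [l _|_]; first by rewrite mxE.
case: pickP => [s _|_]; first by rewrite mxE.
by case=> -[].
Qed.

(** * Convergence of the Stratonovich sums *)

(** Heine-Cantor, with compactness in its near-covering form: a radius that works near each point
    becomes one radius for the cube. *)
Lemma continuous_ucont (R : realType) (t T : R) n (f : 'rV[R]_n -> R) :
  {within cube t T n, continuous f} -> ucont t T f.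
Proof.
move=> /subspace_continuousP cf e e0.
have /compact_near_coveringP cK : compact (cube t T n).
  have -> : cube t T n = [set v | forall l, `[t, T]%classic (v ord0 l)].
    by apply/seteqP; split => x /= h l; have := h l; rewrite in_itv.
  by apply: (@rV_compact R n (fun=> `[t, T]%classic)) => _; exact: segment_compact.
pose Q (dl : R) x := cube t T n x -> forall y, cube t T n y ->
  (forall l, `|x ord0 l - y ord0 l| < dl) -> `|f x - f y| <= e.
have : \forall dl \near 0^'+, cube t T n `<=` Q dl.
  apply: cK => x hx.
  have /nbhs_ballP[r /= r0 hr] : nbhs x (fun y => cube t T n y -> `|f x - f y| < e / 2).
    by have /cvgrPdist_lt/(_ (e / 2)) := cf x hx; apply; rewrite divr_gt0.
  have r2 : 0 < r / 2 by rewrite divr_gt0.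
  exists (ball x (r / 2), [set dl | dl < r / 2]) => /=.
    split; [exact: nbhsx_ballx|exact: nbhs_right_lt].
  move=> -[x' dl] /= [xx' dlr] hx' y hy xy.
  have fx' : `|f x - f x'| < e / 2.
    by apply: hr => //; apply: le_ball xx'; rewrite ler_pdivrMr// ler_pMr// ler1n.
  have fy : `|f x - f y| < e / 2.
    apply: hr => //; split=> // a l; rewrite (ord1 a).
    have [_ /(_ ord0 l)] := xx'; rewrite /ball /= => h.
    have -> : x ord0 l - y ord0 l = (x ord0 l - x' ord0 l) + (x' ord0 l - y ord0 l) by ring.
    rewrite (splitr r) (le_lt_trans (ler_normD _ _))// ltrD//.
    exact: lt_trans (xy l) dlr.
  have -> : f x' - f y = (f x - f y) - (f x - f x') by ring.
  rewrite (splitr e) (le_trans (ler_normB _ _))// lerD// ltW//.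
move=> [r /= r0 hr]; exists (r / 2); first by rewrite divr_gt0.
move=> x y hx hy xy; apply: (hr (r / 2)) => //=; last by rewrite divr_gt0.
by rewrite sub0r normrN ger0_norm ?divr_ge0 ?ltW// ltr_pdivrMr// ltr_pMr// ltr1n.
Qed.

(** The selected coordinate depends on [S] and [a] alone, so gluing preserves the cube and
    coordinatewise distances. *)
Lemma pairing_point_coord (R : realType) k (S : {set {set 'I_k}}) (a : 'I_k) :
  (exists l, forall u v, @pairing_point R k S u v ord0 a = u ord0 l) \/
  (exists s, forall u v, @pairing_point R k S u v ord0 a = v ord0 s).
Proof.
have := slot_ofP S a; rewrite /slot_of.
case pu : [pick l : 'I_#|unpaired S| | enum_val l == a] => [l|].
  by move=> _; left; exists l => u v; rewrite mxE pu.
case ps : [pick s : 'I_#|S| | a \in (enum_val s : {set 'I_k})] => [s|].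
  by move=> _; right; exists s => u v; rewrite mxE pu ps.
by case=> -[].
Qed.

(** * Riemann sums of traces *)

Section traces.
Context (R : realType) (t T : R).
Hypothesis htT : t < T.
Variable tau : nat -> nat -> R.
Hypothesis htau : forall N, (0 < N)%N -> is_partition t T N (tau N).
Hypothesis hmesh : (fun N => mesh N (tau N)) @ \oo --> (0 : R).

Lemma cube_integral_dist n (f g : 'rV[R]_n -> R) (e : R) : ucont t T f -> ucont t T g ->
  (forall x, cube t T n x -> `|f x - g x| <= e) ->
  `|fine (cube_integral t T (fun x => (f x)%:E)) -
    fine (cube_integral t T (fun x => (g x)%:E))| <= e * (T - t) ^+ n.
Proof.
move=> uf ug fg; have mC := @measurable_tcube R t T n.
have int h : ucont t T h -> (lebesgue_tuple R n).-integrable (@tcube R t T n)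
    (EFin \o (h \o @row_of_tuple R n)).
  move=> uh; have [M _ hM] := ucont_bounded htT htau hmesh uh.
  apply: (bounded_integrable htT (M := M)) => [|v hv]; last exact: hM.
  exact: (ucont_measurable htT htau hmesh uh).
rewrite /cube_integral -/(@tcube R t T n).
have iB : (lebesgue_tuple R n).-integrable (@tcube R t T n)
    (EFin \o (fun v => (f \o @row_of_tuple R n) v - (g \o @row_of_tuple R n) v)).
  apply: (@integrableB _ _ _ _ _ _ (EFin \o (f \o _)) (EFin \o (g \o _))) => //; exact: int.
have E h : fine (\int[lebesgue_tuple R n]_(v in @tcube R t T n) (h (row_of_tuple v))%:E) =
  \int[lebesgue_tuple R n]_(v in @tcube R t T n) (h \o @row_of_tuple R n) v by [].
rewrite !E -RintegralB//; [|exact: int..].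
apply: le_trans (le_normr_Rintegral _ iB) _ => //.
have <- : \int[lebesgue_tuple R n]_(v in @tcube R t T n) cst e v = e * (T - t) ^+ n.
  by rewrite Rintegral_cst// [X in _ * fine X](lebesgue_tcube htT).
apply: le_Rintegral => //.
- exact: (integrable_norm iB).
- by apply: (bounded_integrable htT (M := `|e|)).
- by move=> v hv; exact: fg.
Qed.

Variables (k : nat) (Phi : 'rV[R]_k -> R).
Hypothesis uPhi : ucont t T Phi.
Variable S : {set {set 'I_k}}.

Lemma pairing_point_cube u v : cube t T _ u -> cube t T _ v ->
  cube t T k (@pairing_point R k S u v).
Proof. by move=> hu hv a; have [[l ->]|[s ->]] := @pairing_point_coord R k S a. Qed.

Lemma pairing_point_dist (dl : R) (u u' : 'rV[R]_#|unpaired S|) (v v' : 'rV[R]_#|S|) :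
  (forall l, `|u ord0 l - u' ord0 l| < dl) -> (forall s, `|v ord0 s - v' ord0 s| < dl) ->
  forall a, `|@pairing_point R k S u v ord0 a - pairing_point u' v' ord0 a| < dl.
Proof.
by move=> hu hv a; have [[l E]|[s E]] := @pairing_point_coord R k S a; rewrite !E.
Qed.

Lemma ucont_pairing_point u : cube t T _ u ->
  ucont t T (fun v => Phi (@pairing_point R k S u v)).
Proof.
move=> hu e e0; have [dl dl0 h] := uPhi e0; exists dl => // x y hx hy xy.
apply: h; [exact: pairing_point_cube..|].
by apply: pairing_point_dist => // l; rewrite subrr normr0.
Qed.

(** Integration over the pair variables multiplies the oscillation of [Phi] by the volume of their
    cube, hence the tolerance divided by that volume. *)
Lemma ucont_pairing_trace : ucont t T (@pairing_trace R t T k S Phi).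
Proof.
move=> e e0; have V0 : 0 < (T - t) ^+ #|S| by rewrite exprn_gt0// subr_gt0.
have [|dl dl0 h] := uPhi (e := e / (T - t) ^+ #|S|); first by rewrite divr_gt0.
exists dl => // u u' hu hu' uu'.
rewrite -[leRHS](divfK (lt0r_neq0 V0)).
apply: cube_integral_dist; [exact: ucont_pairing_point..|] => v hv.
apply: h; [exact: pairing_point_cube..|].
by apply: pairing_point_dist => // s; rewrite subrr normr0.
Qed.

(** A Riemann sum for the trace from which the [v] that repeat a cell or meet a cell of [u] are
    missing, since those belong to other coincidence patterns. *)
Definition trace_coef N (u : {ffun 'I_#|unpaired S| -> 'I_N}) : R :=
  \sum_(v : {ffun 'I_#|S| -> 'I_N} | joint_inj u v)
    Phi (pairing_point (gridpt (tau N) u) (gridpt (tau N) v)) * vol (tau N) v.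

Lemma not_joint_inj N (u : {ffun 'I_#|unpaired S| -> 'I_N}) (v : {ffun 'I_#|S| -> 'I_N}) :
  injectiveb u -> ~~ joint_inj u v -> ~~ injectiveb v \/ im v :&: im u != finset.set0.
Proof.
move=> /injectiveP iu nj; have [iv|] := boolP (injectiveb v); last by left.
right; apply: contra nj => /eqP e0.
have dis (s : 'I_#|S|) (l : 'I_#|unpaired S|) : v s = u l -> False.
  move=> E; have : v s \in im v :&: im u by rewrite inE mem_im E mem_im.
  by rewrite e0 inE.
apply/forallP => -[l|s]; apply/forallP => -[l'|s']; apply/implyP => /eqP /= E.
- by rewrite (iu _ _ E).
- by case: (dis s' l).
- by case: (dis s l').
- by move/injectiveP: iv => /(_ _ _ E) ->.
Qed.

(** Uniformity in [u] is the point. The full Riemann sum is within e / 2 of the trace, and by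
    [prod_le_wt] with [A] = [im u] the missing terms have total volume of the order of the mesh. If
    [u] repeats a cell, both coefficients vanish. *)
Lemma trace_coef_close (e : R) : 0 < e -> exists N0, forall N, (N0 <= N)%N ->
  (0 < N)%N /\ forall u : {ffun 'I_#|unpaired S| -> 'I_N},
    `|trace_coef u - offdiag tau (@pairing_trace R t T k S Phi) u| <= e.
Proof.
move=> e0; pose D := T - t + 1; pose r := #|S|.
have D1 : 1 <= D by rewrite /D lerDr subr_ge0 ltW.
have D0 : 0 <= D by exact: le_trans D1.
have V0 : 0 < (T - t) ^+ r by rewrite exprn_gt0// subr_gt0.
have e2 : 0 < e / 2 by rewrite divr_gt0.
have [M M0 hM] := ucont_bounded htT htau hmesh uPhi.
have [|dl dl0 hdl] := uPhi (e := e / 2 / (T - t) ^+ r); first by rewrite divr_gt0.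
(* [M] bounds the integrand; the rest combines [prod_le_wt] with [sum_wt], where [im u] has at most
   [#|unpaired S|] cells. *)
set C := M * (D ^+ r * ((#|unpaired S|)%:R + r%:R + D) ^+ r).
have C0 : 0 <= C.
  by rewrite mulr_ge0// mulr_ge0// exprn_ge0// addr_ge0// addr_ge0.
set h : R := Num.min D (e / 2 / (C + 1)).
have h0 : 0 < h by rewrite lt_min (lt_le_trans _ D1)//= divr_gt0// ltr_wpDl.
have hD : h <= D by rewrite ge_min lexx.
have hC : h * C <= e / 2.
  apply: (@le_trans _ _ (h * (C + 1))); first by rewrite ler_wpM2l ?(ltW h0)// lerDl.
  by rewrite -ler_pdivlMr ?ltr_wpDl// ge_min lexx orbT.
have [N0 HN] : exists N0, forall N, (N0 <= N)%N -> (0 < N)%N /\ mesh N (tau N) < Num.min h dl.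
  by apply: fine_mesh; rewrite // lt_min h0.
exists N0 => N /HN[Np]; rewrite lt_min => /andP[hh hdlt]; split=> // u.
have hs := htau Np.
have [iu|nu] := boolP (injectiveb u); last first.
  rewrite /offdiag (negbTE nu) subr0 /trace_coef big_pred0 ?normr0 ?ltW// => v.
  apply/negbTE; apply: contra nu => /forallP ji; apply/injectiveP => l l' E.
  have := ji (inl l) => /forallP /(_ (inl l')); rewrite /= E eqxx => /eqP [] //.
rewrite /offdiag iu.
set f := fun v => Phi (@pairing_point R k S (gridpt (tau N) u) v).
have uc : cube t T _ (gridpt (tau N) u) by exact: gridpt_cube.
have := riemann_sum_close htT hs (ucont_measurable htT htau hmesh (ucont_pairing_point uc))
  (M := M) (e := e / 2 / (T - t) ^+ r).
rewrite (divfK (lt0r_neq0 V0)) -/f -/(pairing_trace t T Phi (gridpt (tau N) u)) => rs.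
rewrite /trace_coef; under eq_bigr do rewrite -/(f _).
have {rs} : `|pairing_trace t T Phi (gridpt (tau N) u) -
    \sum_(v : {ffun 'I_#|S| -> 'I_N}) f (gridpt (tau N) v) * vol (tau N) v| <= e / 2.
  apply: rs => [v hv|j v jv]; first exact/hM/pairing_point_cube.
  apply: hdl; [apply: pairing_point_cube => //..|].
  - by have := cellsc_sub hs jv.
  - exact: gridpt_cube.
  - apply: pairing_point_dist => [l|]; first by rewrite subrr normr0.
    by apply: gridpt_dist jv => p; apply: le_lt_trans hdlt; exact: delta_le_mesh.
rewrite (bigID (fun v => joint_inj u v)) /=.
set X := \sum_(v | joint_inj u v) _; set Y := \sum_(v | ~~ joint_inj u v) _.
set Z := pairing_trace _ _ _ _.
move=> rs.
have {}hC : `|Y| <= e / 2.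
  apply: le_trans hC.
  have dh (p : 'I_N) : delta (tau N) p <= h.
    by apply: le_trans (ltW hh); exact: delta_le_mesh.
  have d0 (p : 'I_N) : 0 <= delta (tau N) p by exact: (ltW (delta_gt0 hs p)).
  have sD : \sum_(p < N) delta (tau N) p <= D by rewrite (sum_delta hs) /D lerDl.
  apply: (@le_trans _ _ (\sum_(v : {ffun 'I_r -> 'I_N}) M * (h * D ^+ r * wt (delta (tau N)) (im u) v))).
    rewrite /Y [leRHS](bigID (fun v => joint_inj u v)) /= addrC -[leLHS]addr0 lerD//; last first.
      by apply: sumr_ge0 => v _; rewrite mulr_ge0// mulr_ge0 ?(wt_ge0 d0)// mulr_ge0 ?(ltW h0)// exprn_ge0.
    apply: le_trans (ler_norm_sum _ _ _) _; apply: ler_sum => v nj.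
    rewrite normrM; apply: ler_pM => //; first exact/hM/pairing_point_cube/gridpt_cube.
    rewrite ger0_norm ?(vol_ge0 hs)//.
    apply: (prod_le_wt d0 (im u) v D1 dh hD).2; exact: not_joint_inj.
  rewrite -mulr_sumr -mulr_sumr /C [leRHS]mulrCA -[h * _ * _]mulrA.
  do 2 (apply: ler_wpM2l; first by rewrite ?(ltW h0)).
  rewrite ler_wpM2l ?exprn_ge0//.
  apply: le_trans (sum_wt d0 sD _ _) _.
  have nD (a b : nat) : 0 <= a%:R + b%:R + D by rewrite addr_ge0// addr_ge0.
  by rewrite lerXn2r ?nnegrE ?nD// !lerD2r ler_nat card_im.
have -> : X - Z = - ((Z - (X + Y)) + Y) by ring.
rewrite normrN (le_trans (ler_normD _ _))// (splitr e) lerD//.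
Qed.

End traces.

(** * Calculus of mean-square limits *)

Section mean_square.
Context d (Omega : measurableType d) (R : realType) (P : probability Omega R).
Local Notation dist := (sqdist P setT).

Definition ms_cvg (Y : nat -> Omega -> R) (X : Omega -> R) :=
  forall e : R, 0 < e -> exists N0, forall N, (N0 <= N)%N -> (dist (Y N) X <= e%:E)%E.

Lemma ms_cvg_close (Y Z : nat -> Omega -> R) (X : Omega -> R) :
  (forall N, measurable_fun setT (Y N)) -> (forall N, measurable_fun setT (Z N)) ->
  measurable_fun setT X -> ms_cvg Y X ->
  (forall e : R, 0 < e -> exists N0, forall N, (N0 <= N)%N -> (dist (Z N) (Y N) <= e%:E)%E) ->
  ms_cvg Z X.
Proof.
move=> mY mZ mX YX ZY e e0; have e4 : 0 < e / 4 by rewrite divr_gt0.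
have [N1 h1] := YX _ e4; have [N2 h2] := ZY _ e4.
exists (maxn N1 N2) => N; rewrite geq_max => /andP[/h1 l1 /h2 l2].
apply: le_trans (sqdist_triangle P measurableT (mZ N) (mY N) mX) _.
apply: (@le_trans _ _ (2%:E * ((e / 4)%:E + (e / 4)%:E))%E).
  by apply: lee_wpmul2l => //; exact: leeD.
by rewrite -EFinD -EFinM lee_fin; lra.
Qed.

Lemma ms_cvgD (Y Z : nat -> Omega -> R) (X U : Omega -> R) :
  (forall N, measurable_fun setT (Y N)) -> (forall N, measurable_fun setT (Z N)) ->
  measurable_fun setT X -> measurable_fun setT U -> ms_cvg Y X -> ms_cvg Z U ->
  ms_cvg (fun N w => Y N w + Z N w) (fun w => X w + U w).
Proof.
move=> mY mZ mX mU YX ZU; apply: (@ms_cvg_close (fun N w => X w + Z N w)) => [N|N| | |].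
- exact: measurable_funD.
- exact: measurable_funD.
- exact: measurable_funD.
- move=> e /ZU[N0 h]; exists N0 => N /h; congr (_ <= _)%E.
  by apply: eq_integral => w _; congr (_ ^+ 2)%:E; ring.
- move=> e /YX[N0 h]; exists N0 => N /h; congr (_ <= _)%E.
  by apply: eq_integral => w _; congr (_ ^+ 2)%:E; ring.
Qed.

Lemma ms_cvgZ (a : R) (Y : nat -> Omega -> R) (X : Omega -> R) :
  (forall N, measurable_fun setT (Y N)) -> measurable_fun setT X -> ms_cvg Y X ->
  ms_cvg (fun N w => a * Y N w) (fun w => a * X w).
Proof.
move=> mY mX YX e e0; have c0 : 0 < a ^+ 2 + 1 by rewrite ltr_wpDl// sqr_ge0.
have [N0 h] := YX _ (divr_gt0 e0 c0); exists N0 => N /h {}h.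
have -> : dist (fun w => a * Y N w) (fun w => a * X w) = ((a ^+ 2)%:E * dist (Y N) X)%E.
  rewrite /sqdist -ge0_integralZl//; last 3 first.
  - exact: measurable_sqrB.
  - by move=> w _; rewrite lee_fin sqr_ge0.
  - by rewrite lee_fin sqr_ge0.
  by apply: eq_integral => w _; rewrite -EFinM; congr EFin; ring.
apply: (@le_trans _ _ ((a ^+ 2)%:E * (e / (a ^+ 2 + 1))%:E)%E).
  by apply: lee_wpmul2l => //; rewrite lee_fin sqr_ge0.
by rewrite -[(_ * (e / _)%:E)%E]EFinM lee_fin mulrA ler_pdivrMr// mulrC ler_wpM2l ?(ltW e0)// lerDl.
Qed.

Lemma ms_cvg_sum (I : Type) (s : seq I) (Q : pred I) (a : I -> R)
    (Y : I -> nat -> Omega -> R) (X : I -> Omega -> R) :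
  (forall x N, measurable_fun setT (Y x N)) -> (forall x, measurable_fun setT (X x)) ->
  (forall x, Q x -> ms_cvg (Y x) (X x)) ->
  ms_cvg (fun N w => \sum_(x <- s | Q x) a x * Y x N w)
         (fun w => \sum_(x <- s | Q x) a x * X x w).
Proof.
move=> mY mX YX.
have mS (Z : I -> Omega -> R) s' : (forall x, measurable_fun setT (Z x)) ->
    measurable_fun setT (fun w => \sum_(x <- s' | Q x) a x * Z x w).
  move=> mZ; under eq_fun do rewrite -big_filter.
  by apply: measurable_sum => y; exact: measurable_funM.
elim: s => [|x s IH].
  move=> e e0; exists 0%N => N _; rewrite /sqdist.
  under eq_integral do rewrite !big_nil subrr expr0n /=.
  by rewrite integral0 lee_fin ltW.
have [Qx|Qx] := boolP (Q x); last first.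
  move=> e /IH[N0 h]; exists N0 => N /h; congr (_ <= _)%E.
  by apply: eq_integral => w _; rewrite !big_cons (negbTE Qx).
move=> e e0; have [|||||| N0 h] := @ms_cvgD (fun N w => a x * Y x N w)
    (fun N w => \sum_(x <- s | Q x) a x * Y x N w) (fun w => a x * X x w)
    (fun w => \sum_(x <- s | Q x) a x * X x w) _ _ _ _ _ _ e e0.
- by move=> N; apply: measurable_funM => //; exact: mY.
- by move=> N; exact: (mS (fun x => Y x N)).
- by apply: measurable_funM => //; exact: mX.
- exact: mS.
- by apply: ms_cvgZ => //; exact: YX.
- exact: IH.
- exists N0 => N /h; congr (_ <= _)%E.
  by apply: eq_integral => w _; rewrite !big_cons Qx.
Qed.

(** The distances are extended reals; on either side they are finite from some index on, and the
    limit can then be read in the reals. *)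
Lemma ms_cvgP (Y : nat -> Omega -> R) (X : Omega -> R) :
  ms_cvg Y X <-> (fun N => ms_sqdist P (Y N) X) @ \oo --> 0%E.
Proof.
under [X in _ <-> X @ _ --> _]eq_fun do rewrite ms_sqdistE.
split=> [h|/fine_cvgP[/= [N1 _ fin] /cvgrPdist_le h] e e0].
  have fin (e : \bar R) (r : R) : (0 <= e)%E -> (e <= r%:E)%E -> e \is a fin_num.
    by move=> e0 er; rewrite ge0_fin_numE// (le_lt_trans er) ?ltry.
  apply/fine_cvgP; split.
    have [N0 HN] := h _ ltr01; exists N0 => // N /HN; apply: fin; exact: sqdist_ge0.
  apply/cvgrPdist_le => e /h[N0 HN]; exists N0 => // N /HN le.
  rewrite /= sub0r normrN ger0_norm ?fine_ge0 ?sqdist_ge0//.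
  by rewrite -lee_fin fineK// (fin _ _ (sqdist_ge0 _ _ _ _) le).
have [N2 _ HN] := h _ e0; exists (maxn N1 N2) => N; rewrite geq_max => /andP[/fin fN /HN].
by rewrite /= sub0r normrN ger0_norm ?fine_ge0 ?sqdist_ge0// -lee_fin fineK.
Qed.

Lemma ms_cvg_unique (Y : nat -> Omega -> R) (X X' : Omega -> R) :
  (forall N, measurable_fun setT (Y N)) -> measurable_fun setT X -> measurable_fun setT X' ->
  ms_cvg Y X -> ms_cvg Y X' -> {ae P, forall w, X w = X' w}.
Proof.
move=> mY mX mX' YX YX'; apply: sqdist_eq0 => //; apply/eqP.
rewrite eq_le sqdist_ge0 andbT; apply/lee_addgt0Pr => e e0; rewrite add0e.
have e4 : 0 < e / 4 by rewrite divr_gt0.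
have [N1 h1] := YX _ e4; have [N2 h2] := YX' _ e4; set N := maxn N1 N2.
apply: le_trans (sqdist_triangle P measurableT mX (mY N) mX') _.
apply: (@le_trans _ _ (2%:E * ((e / 4)%:E + (e / 4)%:E))%E).
  apply: lee_wpmul2l => //; apply: leeD; last by apply: h2; exact: leq_maxr.
  by rewrite sqdistC; apply: h1; exact: leq_maxl.
by rewrite -EFinD -EFinM lee_fin; lra.
Qed.

End mean_square.

(** * Assembly of the expansion *)

Section stratonovich.
Context d (Omega : measurableType d) (R : realType) (P : probability Omega R).
Context (m : nat) (t T : R) (F : R -> set (set Omega)).
Hypothesis hF : is_filtration T F.
Variable W : 'I_m -> R -> {RV P >-> R}.
Hypothesis hW : is_wiener W T F.
Hypothesis t0 : 0 <= t.
Hypothesis htT : t < T.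
Variable tau : nat -> nat -> R.
Hypothesis htau : forall N, (0 < N)%N -> is_partition t T N (tau N).
Hypothesis hmesh : (fun N => mesh N (tau N)) @ \oo --> (0 : R).

Let D := T - t + 1.
Let D1 : 1 <= D. Proof. by rewrite /D lerDr subr_ge0 ltW. Qed.
Let TD : T - t <= D. Proof. by rewrite /D lerDl. Qed.
Let D0 : 0 <= D. Proof. exact: le_trans D1. Qed.

Lemma sum_sqr_wt n N (c : {ffun 'I_n -> 'I_N} -> R) (e : R) : (0 < N)%N ->
  (forall j, `|c j| <= e) ->
  0 <= \sum_j c j ^+ 2 * wt (delta (tau N)) finset.set0 j <= e ^+ 2 * (n%:R + D) ^+ n.
Proof.
move=> Np ce; have hs := htau Np.
have d0 (p : 'I_N) : 0 <= delta (tau N) p by exact: (ltW (delta_gt0 hs p)).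
have sD : \sum_(p < N) delta (tau N) p <= D by rewrite (sum_delta hs).
apply/andP; split; first by apply: sumr_ge0 => j _; rewrite mulr_ge0 ?sqr_ge0 ?(wt_ge0 d0).
apply: (@le_trans _ _ (e ^+ 2 * \sum_(j : {ffun 'I_n -> 'I_N}) wt (delta (tau N)) finset.set0 j)).
  rewrite mulr_sumr; apply: ler_sum => j _; rewrite ler_wpM2r ?(wt_ge0 d0)//.
  by rewrite -real_normK ?num_real// lerXn2r ?nnegrE// (le_trans _ (ce j)).
by rewrite ler_wpM2l ?sqr_ge0// (le_trans (sum_wt d0 sD _ _))// cards0 add0r.
Qed.

(** Coefficients on the diagonals are included here: the total weight of all multi-indices is
    bounded, so uniform closeness suffices. *)
Lemma increment_sum_close n (i : 'I_n -> 'I_m.+1) N (c c' : {ffun 'I_n -> 'I_N} -> R) (e : R) :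
  (0 < N)%N -> (forall j, `|c j - c' j| <= e) ->
  (sqdist P setT (increment_sum W i (tau N) c) (increment_sum W i (tau N) c') <=
   (isometry_const t T n * (e ^+ 2 * (n%:R + D) ^+ n))%:E)%E.
Proof.
move=> Np ce; have hs := htau Np.
have E w : increment_sum W i (tau N) c w - increment_sum W i (tau N) c' w =
    increment_sum W i (tau N) (fun j => c j - c' j) w.
  by rewrite /increment_sum -sumrB; apply: eq_bigr => j _; rewrite mulrBl.
rewrite /sqdist; under eq_integral do rewrite E.
apply: le_trans (increment_sum_sq_le hF hW t0 htT i _ hs) _.
rewrite lee_fin ler_wpM2l ?isometry_const_ge0//.
by have /andP[] := sum_sqr_wt Np ce.
Qed.

Variables (k : nat) (i : 'I_k -> 'I_m.+1) (Phi : 'rV[R]_k -> R).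
Hypothesis uPhi : ucont t T Phi.

Lemma trace_sum_cvg (S : {set {set 'I_k}}) :
  ms_cvg P (fun N => increment_sum W (fun l : 'I_#|unpaired S| => i (enum_val l)) (tau N)
              (@trace_coef R tau k Phi S N))
    (wiener_integral W t T (fun l : 'I_#|unpaired S| => i (enum_val l)) (pairing_trace t T Phi)).
Proof.
set n := #|unpaired S|; set i' := fun l : 'I_n => _.
have uT : ucont t T (@pairing_trace R t T k S Phi).
  by exact: (ucont_pairing_trace htT htau hmesh uPhi).
apply: (@ms_cvg_close _ _ _ _
  (fun N => increment_sum W i' (tau N) (offdiag tau (pairing_trace t T Phi) (N := N)))).
- by move=> N; exact: measurable_increment_sum.
- by move=> N; exact: measurable_increment_sum.
- exact: measurable_funPT.
- exact: (wiener_integral_cvg hF hW t0 htT i' htau hmesh uT).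
move=> e e0; set K := isometry_const t T n * (n%:R + D) ^+ n.
have K0 : 0 <= K by rewrite mulr_ge0 ?isometry_const_ge0// exprn_ge0// addr_ge0.
(* Closeness of coefficients enters the estimate squared, hence the square root. *)
set e1 := Num.sqrt (e / (K + 1)).
have e10 : 0 < e1 by rewrite sqrtr_gt0 divr_gt0// ltr_wpDl.
have [N0 HN] := trace_coef_close htT htau hmesh uPhi S e10.
exists N0 => N /HN[Np h]; apply: le_trans (increment_sum_close i' Np h) _.
rewrite lee_fin mulrCA sqr_sqrtr ?divr_ge0 ?addr_ge0 ?(ltW e0)//.
by rewrite mulrAC ler_pdivrMr ?ltr_wpDl// ler_wpM2l ?(ltW e0)// lerDl.
Qed.

Let term (S : {set {set 'I_k}}) (N : nat) : Omega -> R :=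
  if S == finset.set0 then increment_sum W i (tau N) (offdiag tau Phi (N := N))
  else increment_sum W (fun l : 'I_#|unpaired S| => i (enum_val l)) (tau N)
    (@trace_coef R tau k Phi S N).

Let limit (S : {set {set 'I_k}}) : {RV P >-> R} :=
  if S == finset.set0 then wiener_integral W t T i Phi
  else wiener_integral W t T (fun l : 'I_#|unpaired S| => i (enum_val l)) (pairing_trace t T Phi).

Let ind (S : {set {set 'I_k}}) : R := if S == finset.set0 then 1 else pairing_indicator R i S.

Let measurable_term S N : measurable_fun setT (term S N).
Proof. by rewrite /term; case: ifP => _; exact: measurable_increment_sum. Qed.

Let term_cvg S : ms_cvg P (term S) (limit S).
Proof.
rewrite /term /limit; case: ifP => _; last exact: trace_sum_cvg.
exact: (wiener_integral_cvg hF hW t0 htT i htau hmesh uPhi).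
Qed.

Let term_sum (N : nat) (w : Omega) : (0 < N)%N ->
  \sum_(S | pairing S) ind S * term S N w =
  \sum_(j : {ffun 'I_k -> 'I_N}) Phi (gridpt (tau N) j) * lead_prod W (tau N) i j w.
Proof.
move=> Np; rewrite sum_lead_prod; apply: eq_bigr => S hS.
rewrite /ind /term; case: ifP => [/eqP ->|_].
  by rewrite sum_kernel0 mul1r.
rewrite (sum_kernel_pairing _ _ _ _ hS (Ordinal Np)); congr (_ * _).
apply: eq_bigr => u _; congr (_ * _); apply: eq_bigr => v _.
by rewrite (pairing_point_glue _ (Ordinal Np)).
Qed.

Lemma stratonovich_sum_cvg :
  ms_cvg P (fun N => stratonovich_sum W i Phi N (tau N))
    (fun w => \sum_(S | pairing S) ind S * limit S w).
Proof.
have mL (Z : {set {set 'I_k}} -> Omega -> R) : (forall S, measurable_fun setT (Z S)) ->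
    measurable_fun setT (fun w => \sum_(S | pairing S) ind S * Z S w).
  move=> mZ; under eq_fun do rewrite -big_filter.
  by apply: measurable_sum => S; exact: measurable_funM.
apply: (@ms_cvg_close _ _ _ _ (fun N w => \sum_(S | pairing S) ind S * term S N w)).
- by move=> N; apply: mL => S; exact: measurable_term.
- by move=> N; exact: measurable_increment_sum.
- by apply: mL => S; exact: measurable_funPT.
- apply: ms_cvg_sum => [S N|S|S _]; [exact: measurable_term|exact: measurable_funPT|].
  exact: term_cvg.
move=> e e0; have [M M0 hM] := ucont_bounded htT htau hmesh uPhi.
set K := 2 * (k + k)%:R * lead_const D k ^+ (k + k) * (k%:R + k%:R + D) ^+ k *
  (M ^+ 2 * (k%:R + D) ^+ k).
have L0 : 0 <= lead_const D k by apply: le_trans (lead_const_ge1 D1 k).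
have kD : 0 <= k%:R + D by rewrite addr_ge0.
have K1 : 0 <= 2 * (k + k)%:R * lead_const D k ^+ (k + k) * (k%:R + k%:R + D) ^+ k.
  by rewrite mulr_ge0 ?mulr_ge0 ?exprn_ge0// -addrA addr_ge0.
have K0 : 0 <= K by rewrite mulr_ge0// mulr_ge0 ?sqr_ge0// exprn_ge0.
set e1 := e / (K + 1); have e10 : 0 < e1 by rewrite divr_gt0// ltr_wpDl.
(* The error estimate is linear in a bound on the square roots of the cell lengths, so the mesh is
   taken below [e1 ^+ 2]. *)
have [N0 HN] := fine_mesh hmesh (exprn_gt0 2 e10).
exists N0 => N /HN[Np hN]; have hs := htau Np.
have de (p : 'I_N) : Num.sqrt (delta (tau N) p) <= e1.
  rewrite -[leRHS](ger0_norm (ltW e10)) -sqrtr_sqr.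
  by apply: ler_wsqrtr; apply: le_trans (ltW hN); exact: delta_le_mesh.
have E w : stratonovich_sum W i Phi N (tau N) w - \sum_(S | pairing S) ind S * term S N w =
    \sum_(j : {ffun 'I_k -> 'I_N}) Phi (gridpt (tau N) j) *
      (incr_prod W (tau N) i j w - lead_prod W (tau N) i j w).
  by rewrite (term_sum w Np) -sumrB; apply: eq_bigr => j _; rewrite mulrBr.
rewrite /sqdist; under eq_integral do rewrite E.
apply: le_trans (incr_lead_sum_le hF hW t0 hs D1 TD de i _ (ltW e10)) _.
have /andP[_ h] := sum_sqr_wt (c := fun j => Phi (gridpt (tau N) j)) Np
  (fun j => hM _ (gridpt_cube hs j)).
rewrite lee_fin; apply: (@le_trans _ _ (e1 * K)).
  by rewrite ler_wpM2l ?(ltW e10)// /K ler_wpM2l.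
by rewrite /e1 mulrAC ler_pdivrMr ?ltr_wpDl// ler_wpM2l ?(ltW e0)// lerDl.
Qed.

Lemma sum_limitE w : \sum_(S | pairing S) ind S * limit S w =
  wiener_integral W t T i Phi w +
    \sum_(1 <= r < (k./2).+1) \sum_(S : {set {set 'I_k}} | is_pairing r S)
      pairing_indicator R i S *
      wiener_integral W t T (fun l : 'I_#|unpaired S| => i (enum_val l))
        (pairing_trace t T Phi) w.
Proof.
rewrite sum_pairing /ind /limit eqxx mul1r; congr (_ + _).
rewrite big_nat_cond [RHS]big_nat_cond; apply: eq_bigr => r /andP[/andP[r1 _] _].
apply: eq_bigr => S /and3P[_ _ /eqP Sr]; case: eqP => // S0.
by rewrite -Sr S0 cards0 in r1.
Qed.

Lemma stratonovich_wiener_expansion :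
  ms_cvg P (fun N => stratonovich_sum W i Phi N (tau N))
    (fun w => wiener_integral W t T i Phi w +
       \sum_(1 <= r < (k./2).+1) \sum_(S : {set {set 'I_k}} | is_pairing r S)
         pairing_indicator R i S *
         wiener_integral W t T (fun l : 'I_#|unpaired S| => i (enum_val l))
           (pairing_trace t T Phi) w).
Proof.
have := stratonovich_sum_cvg; congr (ms_cvg P _ _).
by apply/funext => w; exact: sum_limitE.
Qed.

Lemma measurable_wiener_expansion : measurable_fun setT
  (fun w => wiener_integral W t T i Phi w +
     \sum_(1 <= r < (k./2).+1) \sum_(S : {set {set 'I_k}} | is_pairing r S)
       pairing_indicator R i S *
       wiener_integral W t T (fun l : 'I_#|unpaired S| => i (enum_val l))
         (pairing_trace t T Phi) w).
Proof.
under eq_fun do rewrite -sum_limitE -big_filter.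
apply: measurable_sum => S; apply: measurable_funM => //; exact: measurable_funPT.
Qed.

End stratonovich.

Theorem mainTheorem3 (d : measure_display) (Omega : measurableType d)
    (R : realType) (P : probability Omega R) (hP : measure_is_complete P)
    (m : nat) (t T : R) (ht : 0 <= t) (htT : t < T)
    (F : R -> set (set Omega)) (hF : is_filtration T F)
    (W : 'I_m -> R -> {RV P >-> R}) (hW : is_wiener W T F)
    (k : nat) (hk : (2 <= k)%N) (i : 'I_k -> 'I_m.+1)
    (Phi : 'rV[R]_k -> R) (hPhi : {within cube t T k, continuous Phi})
    (tau : nat -> nat -> R)
    (htau : forall N, (0 < N)%N -> is_partition t T N (tau N))
    (hmesh : (fun N => mesh N (tau N)) @ \oo --> (0 : R)) :
  (exists J : {RV P >-> R}, is_stratonovich W i Phi tau J) /\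
  (forall J : {RV P >-> R}, is_stratonovich W i Phi tau J ->
   {ae P, forall w : Omega,
     J w = wiener_integral W t T i Phi w +
       \sum_(1 <= r < (k./2).+1) \sum_(S : {set {set 'I_k}} | is_pairing r S)
         pairing_indicator R i S *
         wiener_integral W t T
           (fun l : 'I_#|unpaired S| => i (enum_val l))
           (pairing_trace t T Phi) w}).
Proof.
have uPhi := continuous_ucont hPhi.
have mX := measurable_wiener_expansion t T W i Phi.
have cX := stratonovich_wiener_expansion hF hW ht htT htau hmesh i uPhi.
split.
  exists (MeasurableFun.Pack (MeasurableFun.Class (isMeasurableFun.Build _ _ _ _ _ mX))).
  by apply/ms_cvgP; exact: cX.
move=> J /ms_cvgP cJ; apply: (ms_cvg_unique _ _ mX cJ cX).
- by move=> N; exact: measurable_increment_sum.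
- exact: measurable_funPT.
Qed.
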